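(* Let $k$ be a positive integer with $k \equiv 2$ or $3 \pmod 4$. For $g \geq 1$ let $H$ be a $\mathbb{Q}$-vector space of dimension $2g$, let $\mathcal{L}_H=\bigoplus_{j\ge 1}\mathcal{L}_H(j)$ be the free Lie algebra generated by $H$ with its natural grading, and regard $$\mathfrak{h}_{g,1}(k)=\mathrm{Ker}\left([\ ,\ ]: H\otimes \mathcal{L}_H(k+1)\longrightarrow \mathcal{L}_H(k+2)\right)$$ as a $\mathrm{GL}(2g,\mathbb{Q})$-module. Then the stable irreducible decomposition of $\mathfrak{h}_{g,1}(k)$ as a $\mathrm{GL}(2g,\mathbb{Q})$-module, expressed as a linear combination of Young diagrams with $k+2$ boxes, is symmetric with respect to taking conjugate Young diagrams. That is, if $m_\lambda$ denotes the stable multiplicity in $\mathfrak{h}_{g,1}(k)$ of the irreducible $\mathrm{GL}(2g,\mathbb{Q})$-module corresponding to the Young diagram $\lambda$, then $m_\lambda = m_{\lambda'}$ for every Young diagram $\lambda$ with $k+2$ boxes, where $\lambda'$ is the conjugate Young diagram of $\lambda$.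
   Context: Here $H=H_1(\Sigma_{g,1};\mathbb{Q})$ is the first rational homology group of a compact oriented surface of genus $g\ge 1$ with one boundary component, so $\dim_{\mathbb{Q}} H=2g$. The Lie algebra $\mathfrak{h}_{g,1}$ is the Lie algebra of symplectic derivations of $\mathcal{L}_H$, whose degree $k$ part is $\{D\in \mathrm{Hom}(H,\mathcal{L}_H(k+1)) : D(\omega_0)=0\}$, with $D$ extended to a derivation of $\mathcal{L}_H$, where $\omega_0\in\mathcal{L}_H(2)\cong\wedge^2 H$ is the symplectic class of the intersection form. Via Poincaré duality $H^*\cong H$ this is isomorphic to the kernel displayed in the claim, and the theorem concerns this kernel with its $\mathrm{GL}(2g,\mathbb{Q})$-module structure. The map $[\ ,\ ]: H\otimes \mathcal{L}_H(k+1)\to\mathcal{L}_H(k+2)$ is induced by the Lie bracket, $x\otimes u\mapsto [x,u]$ with $x \in H=\mathcal{L}_H(1)$. The group $\mathrm{GL}(2g,\mathbb{Q})=\mathrm{GL}(H)$ acts on $\mathcal{L}_H$ by extending its action on the generators $H$, and it acts diagonally on $H\otimes\mathcal{L}_H(k+1)$; the bracket map is $\mathrm{GL}(2g,\mathbb{Q})$-equivariant, so its kernel is a $\mathrm{GL}(2g,\mathbb{Q})$-module. Irreducible constituents of this kernel are polynomial representations of $\mathrm{GL}(2g,\mathbb{Q})$ of degree $k+2$; these are indexed by Young diagrams $\lambda$ with $k+2$ boxes and at most $2g$ rows, with $\lambda$ corresponding to the Schur functor module $S_\lambda(H)=H^{\otimes (k+2)}\otimes_{\mathbb{Q}\mathfrak{S}_{k+2}}V_\lambda$,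 where $V_\lambda$ is the irreducible representation of the symmetric group $\mathfrak{S}_{k+2}$ associated with $\lambda$. For fixed $k$, the multiplicity of $S_\lambda(H)$ in $\mathfrak{h}_{g,1}(k)$ is independent of $g$ for all sufficiently large $g$; the stable multiplicity $m_\lambda$ is this common value, and the stable irreducible decomposition is the formal linear combination $\sum_\lambda m_\lambda\lambda$ over Young diagrams with $k+2$ boxes. The conjugate Young diagram $\lambda'$ of $\lambda$ is obtained by interchanging rows and columns. *)

(* Defs.v *)
From HB Require Import structures.
From mathcomp Require Import all_boot all_order all_algebra all_fingroup.
From mathcomp Require Import mxrepresentation generic_quotient.
From mathcomp Require Import boolp.

Set Implicit Arguments.
Unset Strict Implicit.
Unset Printing Implicit Defensive.

Import GRing.Theory.
Local Open Scope ring_scope.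
Local Open Scope quotient_scope.

(* A rational vector space given up to a congruence [peq]; [premod_quot P] is
   the quotient.  Both the free Lie algebra and the tensor products below are
   obtained this way, from formal expressions modulo the relations that define
   them. *)
Record premod := Premod {
  psort : Type;
  pzero : psort;
  padd : psort -> psort -> psort;
  pscale : rat -> psort -> psort;
  peq : psort -> psort -> Prop;
  peq_refl : forall x, peq x x;
  peq_sym : forall x y, peq x y -> peq y x;
  peq_trans : forall x y z, peq x y -> peq y z -> peq x z;
  peq_add : forall x x' y y', peq x x' -> peq y y' -> peq (padd x y) (padd x' y');
  peq_scale : forall a x x', peq x x' -> peq (pscale a x) (pscale a x');
  paddA : forall x y z, peq (padd x (padd y z)) (padd (padd x y) z);
  paddC : forall x y, peq (padd x y) (padd y x);
  padd0 : forall x, peq (padd pzero x) x;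
  pscaleA : forall a b x, peq (pscale a (pscale b x)) (pscale (a * b) x);
  pscale1 : forall x, peq (pscale 1 x) x;
  pscale0 : forall x, peq (pscale 0 x) pzero;
  pscaleDr : forall a x y, peq (pscale a (padd x y)) (padd (pscale a x) (pscale a y));
  pscaleDl : forall a b x, peq (pscale (a + b) x) (padd (pscale a x) (pscale b x))
}.

Section PremodQuot.
Variable P : premod.

HB.instance Definition _ := gen_eqMixin (psort P).
HB.instance Definition _ := gen_choiceMixin (psort P).

Definition peqb (x y : psort P) : bool := `[< peq x y >].

Lemma peqb_equiv : equiv_class_of peqb.
Proof.
split=> [x|x y|y x z].
- exact/asboolP/peq_refl.
- by apply/asboolP/asboolP; apply: peq_sym.
- by move=> /asboolP xy /asboolP yz; apply/asboolP; apply: peq_trans yz.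
Qed.

Canonical peqb_rel := EquivRelPack peqb_equiv.

Definition premod_quot : Type := {eq_quot peqb_rel}.
HB.instance Definition _ := Choice.on premod_quot.

Definition pclass (x : psort P) : premod_quot := \pi_({eq_quot peqb_rel}) x.
Definition prepr (z : premod_quot) : psort P := repr (z : {eq_quot peqb_rel}).

Lemma preprK z : pclass (prepr z) = z.
Proof. exact: reprK. Qed.

Lemma pclassP x y : pclass x = pclass y <-> peq x y.
Proof.
have E := eqmodP peqb_rel x y.
by split=> [/E/asboolP|/asboolP/E].
Qed.

Lemma prepr_class x : peq (prepr (pclass x)) x.
Proof. by apply/pclassP; rewrite preprK. Qed.

Lemma pquot_ind (Q : premod_quot -> Prop) :
  (forall x, Q (pclass x)) -> forall z, Q z.
Proof. by move=> Qx z; rewrite -(preprK z). Qed.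

Definition qadd (z w : premod_quot) :=
  locked (pclass (padd (prepr z) (prepr w))).
Definition qscale (a : rat) (z : premod_quot) :=
  locked (pclass (pscale a (prepr z))).

Lemma qaddE x y : qadd (pclass x) (pclass y) = pclass (padd x y).
Proof. by rewrite /qadd -lock; apply/pclassP/peq_add; apply: prepr_class. Qed.

Lemma qscaleE a x : qscale a (pclass x) = pclass (pscale a x).
Proof. by rewrite /qscale -lock; apply/pclassP/peq_scale/prepr_class. Qed.

Lemma qaddA : associative qadd.
Proof.
elim/pquot_ind=> x; elim/pquot_ind=> y; elim/pquot_ind=> z.
by rewrite !qaddE; apply/pclassP/paddA.
Qed.

Lemma qaddC : commutative qadd.
Proof.
elim/pquot_ind=> x; elim/pquot_ind=> y.
by rewrite !qaddE; apply/pclassP/paddC.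
Qed.

Lemma qadd0 : left_id (pclass (pzero P)) qadd.
Proof. by elim/pquot_ind=> x; rewrite qaddE; apply/pclassP/padd0. Qed.

Lemma qscale1 : left_id 1 qscale.
Proof. by elim/pquot_ind=> x; rewrite qscaleE; apply/pclassP/pscale1. Qed.

Lemma qscaleDl z : {morph qscale^~ z : a b / a + b >-> qadd a b}.
Proof.
by elim/pquot_ind: z => x a b; rewrite !qscaleE qaddE; apply/pclassP/pscaleDl.
Qed.

Lemma qaddN : left_inverse (pclass (pzero P)) (qscale (-1)) qadd.
Proof.
move=> z; rewrite -[X in qadd _ X]qscale1 -qscaleDl addNr.
by elim/pquot_ind: z => x; rewrite qscaleE; apply/pclassP/pscale0.
Qed.

HB.instance Definition _ :=
  GRing.isZmodule.Build premod_quot qaddA qaddC qadd0 qaddN.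

Lemma qscaleA a b z : qscale a (qscale b z) = qscale (a * b) z.
Proof. by elim/pquot_ind: z => x; rewrite !qscaleE; apply/pclassP/pscaleA. Qed.

Lemma qscaleDr : right_distributive qscale qadd.
Proof.
move=> a; elim/pquot_ind=> x; elim/pquot_ind=> y.
by rewrite !qaddE !qscaleE qaddE; apply/pclassP/pscaleDr.
Qed.

HB.instance Definition _ := GRing.Zmodule_isLmodule.Build rat premod_quot
  qscaleA qscale1 qscaleDr qscaleDl.

Lemma pclassD x y : pclass (padd x y) = pclass x + pclass y.
Proof. by rewrite -qaddE. Qed.

Lemma pclassZ a x : pclass (pscale a x) = a *: pclass x.
Proof. by rewrite -qscaleE. Qed.

Lemma pclass0 : pclass (pzero P) = 0.
Proof. by []. Qed.

End PremodQuot.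

(* Vector space with generators X and relations [rel]. *)
Section Presented.
Variable X : Type.

Inductive lin_expr : Type :=
| LGen of X
| LZero
| LAdd of lin_expr & lin_expr
| LScale of rat & lin_expr.

Variable rel : lin_expr -> lin_expr -> Prop.

Inductive lin_eq : lin_expr -> lin_expr -> Prop :=
| lin_rel x y : rel x y -> lin_eq x y
| lin_refl x : lin_eq x x
| lin_sym x y : lin_eq x y -> lin_eq y x
| lin_trans x y z : lin_eq x y -> lin_eq y z -> lin_eq x z
| lin_add x x' y y' : lin_eq x x' -> lin_eq y y' -> lin_eq (LAdd x y) (LAdd x' y')
| lin_scale a x x' : lin_eq x x' -> lin_eq (LScale a x) (LScale a x')
| lin_addA x y z : lin_eq (LAdd x (LAdd y z)) (LAdd (LAdd x y) z)
| lin_addC x y : lin_eq (LAdd x y) (LAdd y x)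
| lin_add0 x : lin_eq (LAdd LZero x) x
| lin_scaleA a b x : lin_eq (LScale a (LScale b x)) (LScale (a * b) x)
| lin_scale1 x : lin_eq (LScale 1 x) x
| lin_scale0 x : lin_eq (LScale 0 x) LZero
| lin_scaleDr a x y : lin_eq (LScale a (LAdd x y)) (LAdd (LScale a x) (LScale a y))
| lin_scaleDl a b x : lin_eq (LScale (a + b) x) (LAdd (LScale a x) (LScale b x)).

Definition presented_premod : premod :=
  @Premod lin_expr LZero LAdd LScale lin_eq lin_refl lin_sym lin_trans lin_add
    lin_scale lin_addA lin_addC lin_add0 lin_scaleA lin_scale1 lin_scale0
    lin_scaleDr lin_scaleDl.

Definition presented : lmodType rat := premod_quot presented_premod.
Definition pgen (x : X) : presented := @pclass presented_premod (LGen x).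

Variables (W : lmodType rat) (f : X -> W).

Fixpoint lin_eval (e : lin_expr) : W :=
  match e with
  | LGen x => f x
  | LZero => 0
  | LAdd e1 e2 => lin_eval e1 + lin_eval e2
  | LScale a e1 => a *: lin_eval e1
  end.

(* Meaningful when [f] respects [rel]: see [presented_liftE] and
   [presented_lift_linear]. *)
Definition presented_lift (z : presented) : W :=
  lin_eval (@prepr presented_premod z).

Hypothesis f_rel : forall x y, rel x y -> lin_eval x = lin_eval y.

Lemma lin_eval_eq x y : lin_eq x y -> lin_eval x = lin_eval y.
Proof.
elim=> //=.
- by move=> ? ? ? _ -> _ ->.
- by move=> ? ? ? ? _ -> _ ->.
- by move=> ? ? ? _ ->.
- by move=> *; rewrite addrA.
- by move=> *; rewrite addrC.
- by move=> *; rewrite add0r.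
- by move=> *; rewrite scalerA.
- by move=> *; rewrite scale1r.
- by move=> *; rewrite scale0r.
- by move=> *; rewrite scalerDr.
- by move=> *; rewrite scalerDl.
Qed.

Lemma presented_lift_class e :
  presented_lift (@pclass presented_premod e) = lin_eval e.
Proof. exact/lin_eval_eq/(@prepr_class presented_premod). Qed.

Lemma presented_liftE x : presented_lift (pgen x) = f x.
Proof. exact: presented_lift_class. Qed.

Lemma presented_lift_linear : linear presented_lift.
Proof.
move=> a; elim/(@pquot_ind presented_premod)=> x.
elim/(@pquot_ind presented_premod)=> y.
by rewrite -pclassZ -pclassD !presented_lift_class.
Qed.

End Presented.

HB.mixin Record Lmodule_isLie L of GRing.Lmodule rat L := {
  lie : L -> L -> L;
  lie_linearl : forall y, linear (lie^~ y);
  lie_linearr : forall x, linear (lie x);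
  liexx : forall x, lie x x = 0;
  lie_jacobi : forall x y z,
    lie x (lie y z) + lie y (lie z x) + lie z (lie x y) = 0
}.

#[short(type="lieAlgType")]
HB.structure Definition LieAlgebra := {L of Lmodule_isLie L & GRing.Lmodule rat L}.

Section FreeLie.
Variable H : lmodType rat.

Inductive lie_expr : Type :=
| EGen of H
| EZero
| EAdd of lie_expr & lie_expr
| EScale of rat & lie_expr
| EBr of lie_expr & lie_expr.

Inductive lie_eq : lie_expr -> lie_expr -> Prop :=
| lie_refl x : lie_eq x x
| lie_sym x y : lie_eq x y -> lie_eq y x
| lie_trans x y z : lie_eq x y -> lie_eq y z -> lie_eq x z
| lie_add x x' y y' : lie_eq x x' -> lie_eq y y' -> lie_eq (EAdd x y) (EAdd x' y')
| lie_scale a x x' : lie_eq x x' -> lie_eq (EScale a x) (EScale a x')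
| lie_br x x' y y' : lie_eq x x' -> lie_eq y y' -> lie_eq (EBr x y) (EBr x' y')
| lie_addA x y z : lie_eq (EAdd x (EAdd y z)) (EAdd (EAdd x y) z)
| lie_addC x y : lie_eq (EAdd x y) (EAdd y x)
| lie_add0 x : lie_eq (EAdd EZero x) x
| lie_scaleA a b x : lie_eq (EScale a (EScale b x)) (EScale (a * b) x)
| lie_scale1 x : lie_eq (EScale 1 x) x
| lie_scale0 x : lie_eq (EScale 0 x) EZero
| lie_scaleDr a x y : lie_eq (EScale a (EAdd x y)) (EAdd (EScale a x) (EScale a y))
| lie_scaleDl a b x : lie_eq (EScale (a + b) x) (EAdd (EScale a x) (EScale b x))
| lie_gen a h h' : lie_eq (EGen (a *: h + h')) (EAdd (EScale a (EGen h)) (EGen h'))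
| lie_brl a x x' y :
    lie_eq (EBr (EAdd (EScale a x) x') y) (EAdd (EScale a (EBr x y)) (EBr x' y))
| lie_brr a x y y' :
    lie_eq (EBr x (EAdd (EScale a y) y')) (EAdd (EScale a (EBr x y)) (EBr x y'))
| lie_brxx x : lie_eq (EBr x x) EZero
| lie_brJ x y z :
    lie_eq (EAdd (EAdd (EBr x (EBr y z)) (EBr y (EBr z x))) (EBr z (EBr x y))) EZero.

Definition lie_premod : premod :=
  @Premod lie_expr EZero EAdd EScale lie_eq lie_refl lie_sym lie_trans lie_add
    lie_scale lie_addA lie_addC lie_add0 lie_scaleA lie_scale1 lie_scale0
    lie_scaleDr lie_scaleDl.

Definition free_lie : Type := premod_quot lie_premod.
HB.instance Definition _ := GRing.Lmodule.on free_lie.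

Local Notation cl := (@pclass lie_premod : lie_expr -> free_lie).
Local Notation rp := (@prepr lie_premod : free_lie -> lie_expr).

Definition free_br (x y : free_lie) : free_lie :=
  locked (cl (EBr (rp x) (rp y))).

Lemma free_brE x y : free_br (cl x) (cl y) = cl (EBr x y).
Proof.
rewrite /free_br -lock.
by apply/(@pclassP lie_premod)/lie_br; apply: (@prepr_class lie_premod).
Qed.

Lemma free_br_linearl y : linear (free_br^~ y).
Proof.
move=> a; elim/(@pquot_ind lie_premod)=> x; elim/(@pquot_ind lie_premod)=> x'.
elim/(@pquot_ind lie_premod): y => y.
rewrite -pclassZ -pclassD !free_brE -pclassZ -pclassD.
exact/(@pclassP lie_premod)/lie_brl.
Qed.

Lemma free_br_linearr x : linear (free_br x).
Proof.
move=> a; elim/(@pquot_ind lie_premod)=> y; elim/(@pquot_ind lie_premod)=> y'.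
elim/(@pquot_ind lie_premod): x => x.
rewrite -pclassZ -pclassD !free_brE -pclassZ -pclassD.
exact/(@pclassP lie_premod)/lie_brr.
Qed.

Lemma free_brxx x : free_br x x = 0.
Proof.
elim/(@pquot_ind lie_premod): x => x; rewrite free_brE.
exact/(@pclassP lie_premod)/lie_brxx.
Qed.

Lemma free_jacobi x y z :
  free_br x (free_br y z) + free_br y (free_br z x) + free_br z (free_br x y) = 0.
Proof.
elim/(@pquot_ind lie_premod): x => x; elim/(@pquot_ind lie_premod): y => y.
elim/(@pquot_ind lie_premod): z => z.
rewrite !free_brE -!pclassD.
exact/(@pclassP lie_premod)/lie_brJ.
Qed.

HB.instance Definition _ := Lmodule_isLie.Build free_lie
  free_br_linearl free_br_linearr free_brxx free_jacobi.

Definition free_gen (h : H) : free_lie := cl (EGen h).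

Lemma free_gen_linear : linear free_gen.
Proof.
move=> a h h'; rewrite /free_gen -pclassZ -pclassD.
exact/(@pclassP lie_premod)/lie_gen.
Qed.

(* [lie_part j] is the degree j part L_H(j). *)
Inductive lie_part : nat -> free_lie -> Prop :=
| lie_part_gen h : lie_part 1 (free_gen h)
| lie_part0 j : lie_part j 0
| lie_partD j x y : lie_part j x -> lie_part j y -> lie_part j (x + y)
| lie_partZ j a x : lie_part j x -> lie_part j (a *: x)
| lie_part_br i j x y : lie_part i x -> lie_part j y -> lie_part (i + j) (lie x y).

Section Lift.
Variables (L : lieAlgType) (f : H -> L).

Fixpoint lie_eval (e : lie_expr) : L :=
  match e with
  | EGen h => f h
  | EZero => 0
  | EAdd e1 e2 => lie_eval e1 + lie_eval e2
  | EScale a e1 => a *: lie_eval e1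
  | EBr e1 e2 => lie (lie_eval e1) (lie_eval e2)
  end.

Definition free_lift (z : free_lie) : L := lie_eval (rp z).

(* The universal property of the free Lie algebra. *)
Hypothesis f_linear : linear f.

Lemma lie_eval_eq x y : lie_eq x y -> lie_eval x = lie_eval y.
Proof.
elim=> //=.
- by move=> ? ? ? _ -> _ ->.
- by move=> ? ? ? ? _ -> _ ->.
- by move=> ? ? ? _ ->.
- by move=> ? ? ? ? _ -> _ ->.
- by move=> *; rewrite addrA.
- by move=> *; rewrite addrC.
- by move=> *; rewrite add0r.
- by move=> *; rewrite scalerA.
- by move=> *; rewrite scale1r.
- by move=> *; rewrite scale0r.
- by move=> *; rewrite scalerDr.
- by move=> *; rewrite scalerDl.
- by move=> *; rewrite lie_linearl.
- by move=> *; rewrite lie_linearr.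
- by move=> *; rewrite liexx.
- by move=> *; rewrite lie_jacobi.
Qed.

Lemma free_lift_class e : free_lift (cl e) = lie_eval e.
Proof. exact/lie_eval_eq/(@prepr_class lie_premod). Qed.

Lemma free_liftE h : free_lift (free_gen h) = f h.
Proof. exact: free_lift_class. Qed.

Lemma free_lift_linear : linear free_lift.
Proof.
move=> a; elim/(@pquot_ind lie_premod)=> x; elim/(@pquot_ind lie_premod)=> y.
by rewrite -pclassZ -pclassD !free_lift_class.
Qed.

Lemma free_lift_lie x y : free_lift (lie x y) = lie (free_lift x) (free_lift y).
Proof.
elim/(@pquot_ind lie_premod): x => x; elim/(@pquot_ind lie_premod): y => y.
by rewrite [lie _ _]free_brE !free_lift_class.
Qed.

Lemma free_lift_unique (F : free_lie -> L) :
    linear F -> (forall x y, F (lie x y) = lie (F x) (F y)) ->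
  (forall h, F (free_gen h) = f h) -> F =1 free_lift.
Proof.
move=> linF lieF genF; elim/(@pquot_ind lie_premod)=> e.
have F0 : F 0 = 0.
  by move: (linF (-1) 0 0); rewrite scaler0 addr0 scaleN1r addNr.
have FD x y : F (x + y) = F x + F y by have := linF 1 x y; rewrite !scale1r.
have FZ a x : F (a *: x) = a *: F x by have := linF a x 0; rewrite F0 !addr0.
rewrite free_lift_class.
elim: e => [h||x IHx y IHy|a x IHx|x IHx y IHy] /=.
- exact: genF.
- exact: F0.
- by rewrite pclassD FD IHx IHy.
- by rewrite pclassZ FZ IHx.
- by rewrite -free_brE lieF IHx IHy.
Qed.

End Lift.

End FreeLie.

(* Action of an automorphism of H on the free Lie algebra. *)
Definition free_map (H : lmodType rat) (phi : H -> H) : free_lie H -> free_lie H :=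
  free_lift (fun h => free_gen (phi h)).

Lemma free_map_spec (H : lmodType rat) (phi : H -> H) : linear phi ->
  [/\ linear (free_map phi),
      forall x y, free_map phi (lie x y) = lie (free_map phi x) (free_map phi y)
    & forall h, free_map phi (free_gen h) = free_gen (phi h)].
Proof.
move=> linphi; have lin : linear (fun h => free_gen (phi h)).
  by move=> a h h'; rewrite linphi free_gen_linear.
split; [exact: free_lift_linear | exact: free_lift_lie | exact: free_liftE].
Qed.

Section Tensor.
Variables U V : lmodType rat.

Inductive tens_rel : lin_expr (U * V) -> lin_expr (U * V) -> Prop :=
| tens_rell a u u' v : tens_rel (LGen (a *: u + u', v))
    (LAdd (LScale a (LGen (u, v))) (LGen (u', v)))
| tens_relr a u v v' : tens_rel (LGen (u, a *: v + v'))
    (LAdd (LScale a (LGen (u, v))) (LGen (u, v'))).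

Definition tens : lmodType rat := presented tens_rel.
Definition tpure (u : U) (v : V) : tens := pgen tens_rel (u, v).

Definition tens_lift (W : lmodType rat) (b : U -> V -> W) (z : tens) : W :=
  presented_lift (fun p => b p.1 p.2) z.

Lemma tens_lift_spec (W : lmodType rat) (b : U -> V -> W) :
    (forall v, linear (b^~ v)) -> (forall u, linear (b u)) ->
  linear (tens_lift b) /\ (forall u v, tens_lift b (tpure u v) = b u v).
Proof.
move=> bl br; have b_rel x y : tens_rel x y ->
    lin_eval (fun p => b p.1 p.2) x = lin_eval (fun p => b p.1 p.2) y.
  by case=> [a u u' v|a u v v'] /=; [apply: bl | apply: br].
by split=> [|u v]; [apply: presented_lift_linear | apply: presented_liftE].
Qed.

End Tensor.

Definition tens_map (U V : lmodType rat) (phi : U -> U) (psi : V -> V) :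
    tens U V -> tens U V :=
  tens_lift (fun u v => tpure (phi u) (psi v)).

Section Kernel.
Variable H : lmodType rat.

Definition HL : lmodType rat := tens H (free_lie H).

(* The subspace H (x) L_H(j) of H (x) L_H; over a field the inclusion of L_H(j)
   in L_H remains injective after tensoring with H. *)
Inductive HL_part (j : nat) : HL -> Prop :=
| HL_part_pure h u : lie_part j u -> HL_part j (tpure h u)
| HL_part0 : HL_part j 0
| HL_partD x y : HL_part j x -> HL_part j y -> HL_part j (x + y)
| HL_partZ a x : HL_part j x -> HL_part j (a *: x).

Definition HL_bracket : HL -> free_lie H :=
  tens_lift (fun h u => lie (free_gen h) u).

Lemma HL_bracket_spec : linear HL_bracket /\
  (forall h u, HL_bracket (tpure h u) = lie (free_gen h) u).
Proof.
apply: tens_lift_spec => [u a h h'|h]; last exact: lie_linearr.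
by rewrite free_gen_linear lie_linearl.
Qed.

(* h_{g,1}(k), for H of dimension 2g. *)
Definition hg1 (k : nat) (z : HL) : Prop :=
  HL_part k.+1 z /\ HL_bracket z = 0.

Definition HL_act (phi : H -> H) : HL -> HL := tens_map phi (free_map phi).

Lemma HL_act_spec (phi : H -> H) : linear phi -> linear (HL_act phi) /\
  (forall h u, HL_act phi (tpure h u) = tpure (phi h) (free_map phi u)).
Proof.
move=> linphi; have [linF _ _] := free_map_spec linphi.
have pl (v : free_lie H) : linear ((@tpure H (free_lie H))^~ v).
  move=> a u u'; rewrite /tpure /pgen -pclassZ -pclassD.
  exact/(@pclassP (presented_premod (@tens_rel H (free_lie H))))/lin_rel/tens_rell.
have pr (u : H) : linear (@tpure H (free_lie H) u).
  move=> a v v'; rewrite /tpure /pgen -pclassZ -pclassD.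
  exact/(@pclassP (presented_premod (@tens_rel H (free_lie H))))/lin_rel/tens_relr.
apply: tens_lift_spec => [v a u u'|u a v v']; first by rewrite linphi pl.
by rewrite linF pr.
Qed.

End Kernel.

(* Young diagrams with N boxes, as sets of boxes (row, column); such a diagram
   fits in an N x N square. *)
Section Diagrams.
Variable N : nat.

Definition is_diagram (D : {set 'I_N * 'I_N}) : bool :=
  (#|D| == N) &&
  [forall c in D, forall d : 'I_N * 'I_N,
     (d.1 <= c.1)%N && (d.2 <= c.2)%N ==> (d \in D)].

Record diagram := Diagram {
  boxes : {set 'I_N * 'I_N};
  boxesP : is_diagram boxes
}.

HB.instance Definition _ := [isSub for boxes].
HB.instance Definition _ := [Finite of diagram by <:].

Definition swap (c : 'I_N * 'I_N) : 'I_N * 'I_N := (c.2, c.1).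

Lemma conj_subproof (D : diagram) : is_diagram (swap @: boxes D).
Proof.
have swapK : involutive swap by case.
case: D => D /= /andP[/eqP cardD /forall_inP downD].
rewrite /is_diagram card_imset ?cardD ?eqxx /=; last exact: inv_inj.
apply/forall_inP=> _ /imsetP[c cD ->]; apply/forallP=> d; apply/implyP=> /andP[h1 h2].
rewrite -[d]swapK; apply: imset_f.
by have /forallP/(_ (swap d))/implyP := downD c cD; apply; rewrite /= h1 h2.
Qed.

Definition conj_diagram (D : diagram) : diagram := Diagram (conj_subproof D).

Lemma card_boxes (D : diagram) : N = #|boxes D|.
Proof. by case: D => D /= /andP[/eqP]. Qed.

(* A fixed bijective filling of the boxes of D by the elements of 'I_N. *)
Definition box (D : diagram) (i : 'I_N) : 'I_N * 'I_N :=
  enum_val (cast_ord (card_boxes D) i).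

Definition row_group (D : diagram) : {set 'S_N} :=
  [set s : 'S_N | [forall i, (box D (s i)).1 == (box D i).1]].

Definition col_group (D : diagram) : {set 'S_N} :=
  [set s : 'S_N | [forall i, (box D (s i)).2 == (box D i).2]].

(* The Young symmetrizer: a row vector in the basis of the regular
   representation of 'S_N. *)
Definition young_symmetrizer (D : diagram) : 'rV[rat]_#|[set: 'S_N]| :=
  \sum_(p in row_group D) \sum_(q in col_group D)
    (-1) ^+ odd_perm q *: delta_mx 0 (gring_index [set: 'S_N] (p * q)%g).

Definition specht_module (D : diagram) : 'M[rat]_#|[set: 'S_N]| :=
  cyclic_mx (regular_repr rat [set: 'S_N]%G) (young_symmetrizer D).

(* The irreducible representation V_D of the symmetric group, as the right
   submodule c_D Q[S_N] of the regular representation. *)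
Definition specht_repr (D : diagram) :
    mx_representation rat [set: 'S_N]%G (\rank (specht_module D)) :=
  submod_repr (cyclic_mx_module (regular_repr rat [set: 'S_N]%G)
                 (young_symmetrizer D)).

End Diagrams.

(* H^{(x) N} (x)_{Q S_N} V, for a representation rV of the symmetric group on
   V = 'rV_d.  Representations act on the right of row vectors, so V is made a
   left module by sigma v := v *m rV sigma^-1; the right action on H^{(x) N} is
   the permutation of factors. *)
Section Schur.
Variables (H : lmodType rat) (N d : nat).
Variable rV : mx_representation rat [set: 'S_N]%G d.

Definition set_slot (h : {ffun 'I_N -> H}) (i : 'I_N) (x : H) : {ffun 'I_N -> H} :=
  [ffun j => if j == i then x else h j].

Definition permute_slots (h : {ffun 'I_N -> H}) (s : 'S_N) : {ffun 'I_N -> H} :=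
  [ffun j => h ((s^-1)%g j)].

Let X := ({ffun 'I_N -> H} * 'rV[rat]_d)%type.

Inductive schur_rel : lin_expr X -> lin_expr X -> Prop :=
| schur_rel_slot h i a x y v : schur_rel (LGen (set_slot h i (a *: x + y), v))
    (LAdd (LScale a (LGen (set_slot h i x, v))) (LGen (set_slot h i y, v)))
| schur_rel_vec h a v w : schur_rel (LGen (h, a *: v + w))
    (LAdd (LScale a (LGen (h, v))) (LGen (h, w)))
| schur_rel_perm h s v : schur_rel (LGen (permute_slots h s, v))
    (LGen (h, v *m rV (s^-1)%g)).

Definition tens_repr : lmodType rat := presented schur_rel.

Definition tens_repr_act (phi : H -> H) : tens_repr -> tens_repr :=
  presented_lift (fun p : X => pgen schur_rel ([ffun i => phi (p.1 i)], p.2)).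

Lemma tens_repr_act_spec (phi : H -> H) : linear phi ->
  linear (tens_repr_act phi) /\
  (forall h v, tens_repr_act phi (pgen schur_rel (h, v))
               = pgen schur_rel ([ffun i => phi (h i)], v)).
Proof.
move=> linphi; pose f (p : X) := pgen schur_rel ([ffun i => phi (p.1 i)], p.2).
have f_rel x y : schur_rel x y -> lin_eval f x = lin_eval f y.
  case=> [h i a {}x {}y v|h a v w|h s v] /=; rewrite /f /pgen /=.
  - rewrite -pclassZ -pclassD; apply/(@pclassP (presented_premod schur_rel)).
    have E z : [ffun j => phi (set_slot h i z j)]
               = set_slot [ffun j => phi (h j)] i (phi z).
      by apply/ffunP=> j; rewrite !ffunE; case: eqP.
    by rewrite !E linphi; apply/lin_rel/schur_rel_slot.
  - rewrite -pclassZ -pclassD; apply/(@pclassP (presented_premod schur_rel)).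
    exact/lin_rel/schur_rel_vec.
  - apply/(@pclassP (presented_premod schur_rel)).
    have -> : [ffun j => phi (permute_slots h s j)]
              = permute_slots [ffun j => phi (h j)] s.
      by apply/ffunP=> j; rewrite !ffunE.
    exact/lin_rel/schur_rel_perm.
by split=> [|h v]; [apply: presented_lift_linear | apply: presented_liftE].
Qed.

End Schur.

Definition schur_module (H : lmodType rat) (N : nat) (D : diagram N) : lmodType rat :=
  tens_repr H (specht_repr D).

Definition schur_act (H : lmodType rat) (N : nat) (D : diagram N) (phi : H -> H) :
    schur_module H D -> schur_module H D :=
  @tens_repr_act H N _ (specht_repr D) phi.

(* As a GL(H)-module, h_{g,1}(k) is the direct sum over the diagrams D with k+2
   boxes of m D copies of S_D(H); [f D i] is the inclusion of the i-th copy. *)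
Definition gl_decomposition (H : lmodType rat) (k : nat)
    (m : diagram k.+2 -> nat) : Prop :=
  exists f : forall D : diagram k.+2, 'I_(m D) -> {linear schur_module H D -> HL H},
  let total (s : forall D : diagram k.+2, 'I_(m D) -> schur_module H D) : HL H :=
    \sum_(D : diagram k.+2) \sum_(i < m D) f D i (s D i) in
  [/\ forall (phi : {linear H -> H}), bijective phi ->
        forall D i (x : schur_module H D),
          f D i (schur_act phi x) = HL_act phi (f D i x),
      forall z : HL H, hg1 k z <-> exists s, z = total s
    & forall s, total s = 0 -> forall D i, s D i = 0].

(* For dim H >= k+2 the S_D(H) are irreducible and pairwise non-isomorphic, so
   that m D is the multiplicity of S_D(H) in h_{g,1}(k) for all large g. *)
Definition stable_decomposition (k : nat) (m : diagram k.+2 -> nat) : Prop :=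
  exists g0 : nat, forall g : nat, (1 <= g)%N -> (g0 <= g)%N ->
    forall H : vectType rat, \dim {:H} = (2 * g)%N -> gl_decomposition H m.

(* Main.v *)
Require Import Defs.
From HB Require Import structures.
From mathcomp Require Import all_boot all_order all_algebra all_fingroup.
From mathcomp Require Import all_field mxrepresentation zify ring lra.

(** Let N = k+2.  The space H \otimes L_H(k+1) is spanned by words of length N in
    H, a letter tensored with a right-normed bracket, and Q[S_N] acts on words by
    place permutations.  With P and Q the Dynkin idempotents (the normalized
    right-normed brackets of the last N-1, respectively of all N letters), one
    has Q P = Q, and the kernel of the bracket is the Schur functor of the right
    ideal e Q[S_N], where e = P (1 - Q).  So S_lambda(H) occurs in it with
    multiplicity the trace of x |-> e x eps_lambda, where eps_lambda is a
    primitive idempotent of shape lambda.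

    Conjugating lambda twists eps_lambda by the sign character; therefore the
    multiplicities are symmetric as soon as x |-> e x s has trace zero for all
    odd permutations s.  Here e may be replaced by P - Q.  By Klyachko, the
    Dynkin idempotent on n letters is equivalent to the idempotent of a faithful
    character c |-> w of the group generated by an n-cycle c, for any primitive
    n-th root of unity w.  If n is odd, this group has no odd permutation; if 4
    divides n, then w may be replaced by -w, which changes the sign of the trace
    at every odd s.  The hypothesis on k says that neither N nor N-1 is congruent
    to 2 modulo 4.

    That every idempotent decomposes into copies of the eps_lambda is proved by
    comparing the action of the sum of all transpositions on row symmetrized and
    on column antisymmetrized elements with the number of incidences of rows and
    columns.  The multiplicities are unique for dim H >= N, because the space of
    vectors of weight (1,...,1,0,...,0) in S_lambda(H) is the Specht module. *)

Set Implicit Arguments.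
Unset Strict Implicit.
Unset Printing Implicit Defensive.

Import GRing.Theory Num.Theory.
Local Open Scope ring_scope.

(** * Group algebras *)

(** Characters are replaced by the traces [gtr a b] of x |-> a * x * b, which allow cyclic shifts
    inside [a] and inside [b]. Over the rationals, semisimplicity enters as positivity: for the
    involution s |-> s^-1 the coefficient at 1 of a * star a is a sum of squares, so a nonzero
    element can always be paired with its adjoint to produce a nonzero scalar. Roots of unity occur
    only in the comparison with cyclic groups; the Dynkin elements have integral coefficients, so
    their traces may be computed in [algC].

    On the Lie side the obstacle is that free Lie algebras and Schur modules are given by generators
    and relations: elements are easy to build but hard to tell apart. They are separated by
    coordinates. A matrix representation of the truncated free associative algebra reads off the
    expansion of a bracket into words, and the embedding of a Schur module in the tensor power of H
    reads off its weights. *)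

Definition galg (F : fieldType) (gT : finGroupType) : Type := {ffun gT -> F^o}.

Definition linear_pack (R : pzRingType) (U V : lmodType R) (f : U -> V)
    (l : linear f) : {linear U -> V} :=
  HB.pack f (GRing.isLinear.Build R U V *:%R f l).

Section LinearFunctions.
Variables (R : pzRingType) (U V : lmodType R) (f : U -> V).
Hypothesis l : linear f.

Lemma lin0 : f 0 = 0. Proof. exact: (linear0 (linear_pack l)). Qed.
Lemma linD x y : f (x + y) = f x + f y.
Proof. exact: (linearD (linear_pack l)). Qed.
Lemma linB x y : f (x - y) = f x - f y.
Proof. exact: (linearB (linear_pack l)). Qed.
Lemma linZ a x : f (a *: x) = a *: f x.
Proof. exact: (linearZ_LR (linear_pack l)). Qed.
Lemma linMn x n : f (x *+ n) = f x *+ n.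
Proof. exact: (linearMn (linear_pack l)). Qed.
Lemma lin_sum I (r : seq I) (P : pred I) (E : I -> U) :
  f (\sum_(i <- r | P i) E i) = \sum_(i <- r | P i) f (E i).
Proof. exact: (linear_sum (linear_pack l)). Qed.

End LinearFunctions.

Section GroupAlgebra.
Variables (F : fieldType) (gT : finGroupType).
Local Notation A := (galg F gT).
Implicit Types (a b c : A) (g h : gT).

HB.instance Definition _ := GRing.Lmodule.on A.

Definition gcoef a g : F := a g.
Definition ge g : A := [ffun h => (h == g)%:R].
Definition gmul a b : A := [ffun g => \sum_h gcoef a h * gcoef b (h^-1 * g)%g].

Lemma gcoefP a b : gcoef a =1 gcoef b -> a = b.
Proof. by move=> E; apply/ffunP => g; apply: E. Qed.

Lemma gcoefD a b g : gcoef (a + b) g = gcoef a g + gcoef b g.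
Proof. by rewrite /gcoef ffunE. Qed.

Lemma gcoefN a g : gcoef (- a) g = - gcoef a g.
Proof. by rewrite /gcoef ffunE. Qed.

Lemma gcoefB a b g : gcoef (a - b) g = gcoef a g - gcoef b g.
Proof. by rewrite gcoefD gcoefN. Qed.

Lemma gcoef0 g : gcoef 0 g = 0.
Proof. by rewrite /gcoef ffunE. Qed.

Lemma gcoefZ k a g : gcoef (k *: a) g = k * gcoef a g.
Proof. by rewrite /gcoef ffunE. Qed.

Lemma gcoef_sum I (r : seq I) P (E : I -> A) g :
  gcoef (\sum_(i <- r | P i) E i) g = \sum_(i <- r | P i) gcoef (E i) g.
Proof. exact: (big_morph (gcoef^~ g) (fun a b => gcoefD a b g) (gcoef0 g)). Qed.

Lemma gcoef_ge g h : gcoef (ge g) h = (h == g)%:R.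
Proof. by rewrite /gcoef ffunE. Qed.

Lemma gcoef_mul a b g : gcoef (gmul a b) g = \sum_h gcoef a h * gcoef b (h^-1 * g)%g.
Proof. by rewrite /gcoef ffunE. Qed.

Lemma gmulA : associative gmul.
Proof.
move=> a b c; apply: gcoefP => g; rewrite !gcoef_mul.
under eq_bigr do rewrite gcoef_mul mulr_sumr.
under [RHS]eq_bigr do rewrite gcoef_mul mulr_suml.
rewrite [RHS]exchange_big; apply: eq_bigr => h _ /=.
rewrite (reindex_inj (mulgI (h^-1)%g)) /=; apply: eq_bigr => x _.
by rewrite mulrA invMg invgK -!mulgA mulKVg.
Qed.

Lemma gmul1 : left_id (ge 1%g) gmul.
Proof.
move=> a; apply: gcoefP => g; rewrite gcoef_mul (bigD1 1%g) //= big1 ?addr0.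
  by rewrite gcoef_ge eqxx mul1r invg1 mul1g.
by move=> h /negbTE hN; rewrite gcoef_ge hN mul0r.
Qed.

Lemma gmulr1 : right_id (ge 1%g) gmul.
Proof.
move=> a; apply: gcoefP => g; rewrite gcoef_mul (bigD1 g) //= big1 ?addr0.
  by rewrite gcoef_ge mulVg eqxx mulr1.
move=> h hN; rewrite gcoef_ge -(inj_eq (mulgI h)) mulKVg mulg1.
by rewrite eq_sym (negbTE hN) mulr0.
Qed.

Lemma gmulDl : left_distributive gmul +%R.
Proof.
move=> a b c; apply: gcoefP => g; rewrite gcoefD !gcoef_mul -big_split.
by apply: eq_bigr => h _; rewrite gcoefD mulrDl.
Qed.

Lemma gmulDr : right_distributive gmul +%R.
Proof.
move=> a b c; apply: gcoefP => g; rewrite gcoefD !gcoef_mul -big_split.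
by apply: eq_bigr => h _; rewrite gcoefD mulrDr.
Qed.

Lemma ge1_neq0 : ge 1%g != 0.
Proof.
apply/eqP => /(congr1 (gcoef^~ 1%g)); rewrite gcoef_ge eqxx gcoef0.
by move/eqP; rewrite oner_eq0.
Qed.

HB.instance Definition _ := GRing.Zmodule_isNzRing.Build A
  gmulA gmul1 gmulr1 gmulDl gmulDr ge1_neq0.

Lemma gscaleAl k a b : k *: (a * b) = (k *: a) * b.
Proof.
apply: gcoefP => g; rewrite gcoefZ !gcoef_mul mulr_sumr.
by apply: eq_bigr => h _; rewrite gcoefZ mulrA.
Qed.

HB.instance Definition _ := GRing.Lmodule_isLalgebra.Build F A gscaleAl.

Lemma gscaleAr k a b : k *: (a * b) = a * (k *: b).
Proof.
apply: gcoefP => g; rewrite gcoefZ !gcoef_mul mulr_sumr.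
by apply: eq_bigr => h _; rewrite gcoefZ mulrCA.
Qed.

HB.instance Definition _ := GRing.Lalgebra_isAlgebra.Build F A gscaleAr.

Lemma gcoefM a b g : gcoef (a * b) g = \sum_h gcoef a h * gcoef b (h^-1 * g)%g.
Proof. exact: gcoef_mul. Qed.

Lemma ge1 : ge 1%g = 1. Proof. by []. Qed.

Lemma geM g h : ge (g * h)%g = ge g * ge h.
Proof.
apply: gcoefP => x; rewrite gcoefM (bigD1 g) //= big1 ?addr0.
  by rewrite !gcoef_ge eqxx mul1r -(inj_eq (mulgI (g^-1)%g)) mulKg.
by move=> y /negbTE yN; rewrite gcoef_ge yN mul0r.
Qed.

Lemma geVK g : ge (g^-1)%g * ge g = 1. Proof. by rewrite -geM mulVg. Qed.
Lemma geKV g : ge g * ge (g^-1)%g = 1. Proof. by rewrite -geM mulgV. Qed.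

Lemma gsumE a : a = \sum_g gcoef a g *: ge g.
Proof.
apply: gcoefP => g; rewrite gcoef_sum (bigD1 g) //= big1 ?addr0.
  by rewrite gcoefZ gcoef_ge eqxx mulr1.
by move=> h /negbTE hN; rewrite gcoefZ gcoef_ge eq_sym hN mulr0.
Qed.

Lemma gcoefMg a g h : gcoef (a * ge g) h = gcoef a (h * g^-1)%g.
Proof.
rewrite gcoefM (bigD1 (h * g^-1)%g) //= big1 ?addr0.
  by rewrite gcoef_ge invMg invgK mulgKV eqxx mulr1.
move=> x xN; rewrite gcoef_ge -(inj_eq (mulgI x)) mulKVg eq_sym.
by rewrite -(inj_eq (mulIg (g^-1)%g)) mulgK (negbTE xN) mulr0.
Qed.

Lemma gcoefgM a g h : gcoef (ge g * a) h = gcoef a (g^-1 * h)%g.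
Proof.
rewrite gcoefM (bigD1 g) //= big1 ?addr0; first by rewrite gcoef_ge eqxx mul1r.
by move=> x /negbTE xN; rewrite gcoef_ge xN mul0r.
Qed.

Lemma galg_ext (V : lmodType F) (f1 f2 : A -> V) : linear f1 -> linear f2 ->
  (forall g, f1 (ge g) = f2 (ge g)) -> f1 =1 f2.
Proof.
move=> l1 l2 E a; rewrite (gsumE a) (lin_sum l1) (lin_sum l2).
by apply: eq_bigr => g _; rewrite (linZ l1) (linZ l2) E.
Qed.

Lemma commr_ge a : (forall g, ge g * a = a * ge g) -> forall x, x * a = a * x.
Proof.
move=> C; apply: (@galg_ext _ (fun x => x * a) (fun x => a * x)) => [k x y|k x y|g] //=.
  by rewrite mulrDl -scalerAl.
by rewrite mulrDr -scalerAr.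
Qed.

Definition star a : A := [ffun g => gcoef a (g^-1)%g].

Lemma gcoef_star a g : gcoef (star a) g = gcoef a (g^-1)%g.
Proof. by rewrite {1}/gcoef ffunE. Qed.

Lemma starK : involutive star.
Proof. by move=> a; apply: gcoefP => g; rewrite !gcoef_star invgK. Qed.

Lemma starM a b : star (a * b) = star b * star a.
Proof.
apply: gcoefP => g; rewrite gcoef_star !gcoefM.
rewrite (reindex_inj (mulgI (g^-1)%g)) /=; apply: eq_bigr => h _.
by rewrite !gcoef_star mulrC !invMg !invgK mulgK.
Qed.

Lemma star_is_linear : linear star.
Proof.
by move=> k a b; apply: gcoefP => g; rewrite !(gcoef_star, gcoefD, gcoefZ).
Qed.
HB.instance Definition _ := GRing.isLinear.Build F A A _ star star_is_linear.

(** [gtr a b] is the trace of the operator [x |-> a * x * b]. *)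
Definition gtr a b : F^o := \sum_g gcoef (a * ge g * b) g.

Lemma gtr_linearl b : linear (gtr^~ b : A -> F^o).
Proof.
move=> k a a'; rewrite /gtr /= scaler_sumr -big_split; apply: eq_bigr => g _ /=.
by rewrite !mulrDl gcoefD -!scalerAl gcoefZ.
Qed.

Lemma gtr_linearr a : linear (gtr a : A -> F^o).
Proof.
move=> k b b'; rewrite /gtr /= scaler_sumr -big_split; apply: eq_bigr => g _ /=.
by rewrite mulrDr gcoefD -!scalerAr gcoefZ.
Qed.

Lemma gtrZr k a b : gtr a (k *: b) = k * gtr a b.
Proof. exact: (linZ (gtr_linearr a)). Qed.

Lemma gtrZl k a b : gtr (k *: a) b = k * gtr a b.
Proof. exact: (linZ (gtr_linearl b)). Qed.

Lemma gtr_subl a a' b : gtr (a - a') b = gtr a b - gtr a' b.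
Proof. exact: (linB (gtr_linearl b)). Qed.

Lemma gtr_suml I (r : seq I) (P : pred I) (E : I -> A) b :
  gtr (\sum_(i <- r | P i) E i) b = \sum_(i <- r | P i) gtr (E i) b.
Proof. exact: (lin_sum (gtr_linearl b)). Qed.

Lemma gtr_geML g a c : gtr (ge g * a) c = gtr (a * ge g) c.
Proof.
rewrite /gtr (reindex_inj (mulgI g)) /=; apply: eq_bigr => h _.
by rewrite -!mulrA gcoefgM mulKg geM -!mulrA.
Qed.

Lemma gtr_mulCl a b c : gtr (a * b) c = gtr (b * a) c.
Proof.
have linl x : linear (fun y => gtr (y * x) c : F^o).
  by move=> k y z; rewrite mulrDl -scalerAl gtr_linearl.
have linr x : linear (fun y => gtr (x * y) c : F^o).
  by move=> k y z; rewrite mulrDr -scalerAr gtr_linearl.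
by apply: (galg_ext (linl b) (linr b) _ a) => g; apply: gtr_geML.
Qed.

Lemma gtr_geMr g a c : gtr a (c * ge g) = gtr a (ge g * c).
Proof.
rewrite /gtr (reindex_inj (mulIg g)) /=; apply: eq_bigr => h _.
by rewrite !mulrA gcoefMg mulgK geM !mulrA.
Qed.

Lemma gtr_mulCr a b c : gtr a (b * c) = gtr a (c * b).
Proof.
have linl x : linear (fun y => gtr a (y * x) : F^o).
  by move=> k y z; rewrite mulrDl -scalerAl gtr_linearr.
have linr x : linear (fun y => gtr a (x * y) : F^o).
  by move=> k y z; rewrite mulrDr -scalerAr gtr_linearr.
by apply: (galg_ext (linr b) (linl b) _ c) => g; apply: gtr_geMr.
Qed.

Lemma gtr_ge a h : gtr a (ge h) = \sum_x gcoef a (x * h^-1 * x^-1)%g.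
Proof. by apply: eq_bigr => x _; rewrite !gcoefMg. Qed.

(** Row i holds a * ge i, so these matrices act on row vectors and their products come out reversed.
    The diagonal is constant, equal to the coefficient of a at 1. *)
Definition gmx a : 'M[F]_#|gT| :=
  \matrix_(i, j) gcoef (a * ge (enum_val i)) (enum_val j).

Lemma gmxM a b : gmx (a * b) = gmx b *m gmx a.
Proof.
apply/matrixP => i j; rewrite !mxE -mulrA [X in a * X]gsumE mulr_sumr gcoef_sum.
rewrite (reindex (@enum_val gT gT)) /=; last exact: onW_bij (enum_val_bij _).
by apply: eq_bigr => k _; rewrite !mxE -scalerAr gcoefZ.
Qed.

Lemma gmx_eq0 a : gmx a = 0 -> a = 0.
Proof.
move=> E; apply: gcoefP => g; rewrite gcoef0.
have := congr1 (fun M : 'M_#|gT| => M (enum_rank 1%g) (enum_rank g)) E.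
by rewrite !mxE !enum_rankK ge1 mulr1.
Qed.

Lemma mxtrace_gmx a : \tr (gmx a) = #|gT|%:R * gcoef a 1%g.
Proof.
rewrite /mxtrace (eq_bigr (fun=> gcoef a 1%g)) => [|i _].
  by rewrite sumr_const card_ord mulr_natl.
by rewrite mxE gcoefMg mulgV.
Qed.

End GroupAlgebra.

Lemma mxtrace_idem (F : fieldType) n (M : 'M[F]_n) :
  M *m M = M -> \tr M = (\rank M)%:R.
Proof.
move=> MM; rewrite -{1}(mulmx_base M) mxtrace_mulC.
suff -> : row_base M *m col_base M = 1%:M by rewrite mxtrace1.
apply: (row_free_inj (row_base_free M)); apply: (row_full_inj (col_base_full M)).
by rewrite mul1mx mulmx_base -mulmxA mulmxA !mulmx_base MM.
Qed.

Section Idempotents.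
Variables (F : numFieldType) (gT : finGroupType).
Implicit Types a b e : galg F gT.

Definition grank e := \rank (gmx e).

Lemma grankE e : e * e = e -> (grank e)%:R = #|gT|%:R * gcoef e 1%g.
Proof. by move=> ee; rewrite -mxtrace_gmx mxtrace_idem // -gmxM ee. Qed.

Lemma grank_eq0 e : grank e = 0%N -> e = 0.
Proof. by move/eqP; rewrite mxrank_eq0 => /eqP/gmx_eq0. Qed.

Lemma idem_coef1_eq0 e : e * e = e -> gcoef e 1%g = 0 -> e = 0.
Proof.
move=> ee e1; apply/grank_eq0/eqP; rewrite -(eqr_nat F) grankE // e1.
by rewrite mulr0.
Qed.

End Idempotents.

(** * Positivity over a real field *)

Section RealGroupAlgebra.
Variables (F : realFieldType) (gT : finGroupType).
Implicit Types a b e : galg F gT.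

(** The coefficient at 1 of a * star a is the sum of the squares of the coefficients of a. *)
Lemma mul_star_eq0 a : a * star a = 0 -> a = 0.
Proof.
move=> E; apply: gcoefP => g; rewrite gcoef0; apply/eqP.
have := congr1 (fun x => gcoef x 1%g) E; rewrite gcoefM gcoef0.
under eq_bigr do rewrite gcoef_star mulg1 invgK.
move/eqP; rewrite psumr_eq0 => [/allP/(_ g)|h _]; last exact: sqr_ge0.
by rewrite mem_index_enum mulf_eq0 orbb; apply.
Qed.

Lemma star_id_sqr_neq0 a : star a = a -> a != 0 -> a * a != 0.
Proof. by move=> sa; apply: contra_neq => E; apply: mul_star_eq0; rewrite sa. Qed.

Lemma mul_star_mul_neq0 a : a != 0 -> a * star a * a != 0.
Proof.
move=> a0; have n0 : a * star a != 0 by apply: contra_neq a0; apply: mul_star_eq0.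
have := star_id_sqr_neq0 _ n0; rewrite starM starK mulrA => /(_ erefl).
by apply: contra_neq => ->; rewrite mul0r.
Qed.

End RealGroupAlgebra.

(** * Row and column symmetrizers *)

Section SignTwist.
Variables (F : fieldType) (T : finType).
Local Notation A := (galg F {perm T}).
Implicit Types (a b : A) (g : {perm T}).

Definition tw a : A := [ffun g => (-1) ^+ odd_perm g * gcoef a g].

Lemma gcoef_tw a g : gcoef (tw a) g = (-1) ^+ odd_perm g * gcoef a g.
Proof. by rewrite {1}/gcoef ffunE. Qed.

Lemma twK : involutive tw.
Proof. by move=> a; apply: gcoefP => g; rewrite !gcoef_tw signrMK. Qed.

Lemma twM a b : tw (a * b) = tw a * tw b.
Proof.
apply: gcoefP => g; rewrite gcoef_tw !gcoefM mulr_sumr; apply: eq_bigr => h _.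
rewrite !gcoef_tw mulrACA -signr_addb; congr ((-1) ^+ nat_of_bool _ * _).
by rewrite odd_permM odd_permV addKb.
Qed.

Lemma tw_is_linear : linear tw.
Proof.
move=> k a b; apply: gcoefP => g.
by rewrite !(gcoef_tw, gcoefD, gcoefZ) mulrDr mulrCA.
Qed.
HB.instance Definition _ := GRing.isLinear.Build F A A _ tw tw_is_linear.

Lemma tw_ge g : tw (ge F g) = (-1) ^+ odd_perm g *: ge F g.
Proof.
apply: gcoefP => h; rewrite gcoef_tw gcoefZ gcoef_ge.
by case: eqP => [->|]; rewrite ?mulr0.
Qed.

Lemma tw_eq0 a : (tw a == 0) = (a == 0).
Proof. by rewrite -[0 in LHS](linear0 tw) (inj_eq (inv_inj twK)). Qed.

Lemma star_tw a : star (tw a) = tw (star a).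
Proof.
by apply: gcoefP => g; rewrite gcoef_star !gcoef_tw gcoef_star odd_permV.
Qed.

(** The twist changes only the coefficients of [b] at odd permutations, and these meet zero traces.
    The symmetry under conjugation rests on this. *)
Lemma gtr_tw a b : (forall g : {perm T}, odd_perm g -> gtr a (ge F g) = 0) ->
  gtr a (tw b) = gtr a b.
Proof.
move=> a_odd; apply: (@galg_ext _ _ F^o (fun b => gtr a (tw b)) (gtr a)) => [k x y|k x y|g].
- by rewrite linearP gtr_linearr.
- by rewrite gtr_linearr.
rewrite tw_ge gtrZr; have [/a_odd ->|_] := boolP (odd_perm g).
  by rewrite mulr0.
by rewrite mul1r.
Qed.

End SignTwist.

Section Labels.
Variables (F : realFieldType) (N : nat).
Local Notation A := (galg F 'S_N).
Local Notation ge := (@ge F _ : 'S_N -> A).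
Local Notation label := {ffun 'I_N -> 'I_N}.
Implicit Types (f g : label) (s w : 'S_N) (a x : A).

Definition fixes f s := [forall i, f (s i) == f i].

Lemma fixesP f s : reflect (forall i, f (s i) = f i) (fixes f s).
Proof. exact: 'forall_eqP. Qed.

Lemma fixes1 f : fixes f 1.
Proof. by apply/fixesP => i; rewrite perm1. Qed.

Lemma fixesM f s t : fixes f s -> fixes f t -> fixes f (s * t).
Proof.
by move=> /fixesP fs /fixesP ft; apply/fixesP => i; rewrite permM ft fs.
Qed.

Lemma fixesV f s : fixes f s^-1 = fixes f s.
Proof.
have V t : fixes f t -> fixes f t^-1.
  by move=> /fixesP ft; apply/fixesP => i; rewrite -[in RHS](permKV t i) ft.
by apply/idP/idP => [/V|/V //]; rewrite invgK.
Qed.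

Lemma fixes_mulgl f s t : fixes f s -> fixes f (s * t) = fixes f t.
Proof.
move=> fs; apply/idP/idP => [fst|]; last exact: fixesM.
by rewrite -(mulKg s t) fixesM // fixesV.
Qed.

Lemma fixes_mulgr f s t : fixes f s -> fixes f (t * s) = fixes f t.
Proof. by move=> fs; rewrite -fixesV invMg fixes_mulgl fixesV. Qed.

(** A labelling encodes a partition of the places into rows or columns, and [sym f] sums its Young
    subgroup. Labellings need not come from a diagram, because the completeness proof changes them
    one label at a time. *)
Definition sym f : A := [ffun s => (fixes f s)%:R].
Definition asym f : A := tw (sym f).

Lemma gcoef_sym f s : gcoef (sym f) s = (fixes f s)%:R.
Proof. by rewrite /gcoef ffunE. Qed.

Lemma sym_sum f : sym f = \sum_(s | fixes f s) ge s.
Proof.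
rewrite [LHS]gsumE [RHS]big_mkcond; apply: eq_bigr => s _.
by rewrite gcoef_sym; case: ifP; rewrite ?scale1r ?scale0r.
Qed.

Lemma eq_sym_lab f g : (forall i j, (f i == f j) = (g i == g j)) -> sym f = sym g.
Proof.
move=> E; apply: gcoefP => s; rewrite !gcoef_sym; congr (nat_of_bool _)%:R.
by apply: eq_forallb => i; rewrite E.
Qed.

Lemma ge_sym f s : fixes f s -> ge s * sym f = sym f.
Proof.
by move=> fs; apply: gcoefP => t; rewrite gcoefgM !gcoef_sym fixes_mulgl ?fixesV.
Qed.

Lemma sym_ge f s : fixes f s -> sym f * ge s = sym f.
Proof.
by move=> fs; apply: gcoefP => t; rewrite gcoefMg !gcoef_sym fixes_mulgr ?fixesV.
Qed.

Lemma star_sym f : star (sym f) = sym f.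
Proof. by apply: gcoefP => t; rewrite gcoef_star !gcoef_sym fixesV. Qed.

Lemma ge_asym f s : fixes f s -> ge s * asym f = (-1) ^+ odd_perm s *: asym f.
Proof.
move=> fs; apply: (can_inj (@twK _ _)); rewrite twM linearZ /= tw_ge twK.
by rewrite -scalerAl ge_sym.
Qed.

Definition lcomp f w : label := [ffun i => f (w i)].

Lemma ge_sym_conj f w : ge w * sym f = sym (lcomp f w) * ge w.
Proof.
apply: gcoefP => t; rewrite gcoefgM gcoefMg !gcoef_sym; congr (nat_of_bool _)%:R.
apply/fixesP/fixesP => E i.
  by rewrite !ffunE -[RHS]E !permM permKV permK.
by rewrite permM; have := E ((w^-1)%g i); rewrite !ffunE permM !permKV.
Qed.

Lemma ge_asym_conj f w : ge w * asym f = asym (lcomp f w) * ge w.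
Proof.
apply: (can_inj (@twK _ _)); rewrite !twM !tw_ge !twK.
by rewrite -scalerAl ge_sym_conj scalerAr.
Qed.

Lemma sym_sqr f : exists2 k : nat, (k > 0)%N & sym f * sym f = k%:R *: sym f.
Proof.
exists #|fixes f|; first by apply/card_gt0P; exists 1%g; apply: fixes1.
rewrite {1}sym_sum mulr_suml (eq_bigr (fun=> sym f)) => [|s]; last exact: ge_sym.
by rewrite sumr_const scaler_nat.
Qed.

Lemma asym_sqr f : exists2 k : nat, (k > 0)%N & asym f * asym f = k%:R *: asym f.
Proof.
by have [k k0 E] := sym_sqr f; exists k; rewrite // /asym -twM E linearZ.
Qed.

Lemma star_asym f : star (asym f) = asym f.
Proof. by rewrite star_tw star_sym. Qed.

Definition pair_inj f g := forall i j, f i = f j -> g i = g j -> i = j.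

(** The transposition of two places sharing both labels is absorbed by [sym f] with sign 1 and by
    [asym g] with sign -1, so the product would equal its negative. *)
Lemma sym_asym_inj f g : sym f * asym g != 0 -> pair_inj f g.
Proof.
move=> n0 i j fij gij; apply: contra_neq_eq n0 => ij.
have fx (h : label) : h i = h j -> fixes h (tperm i j).
  by move=> hij; apply/fixesP => l; case: tpermP => // ->.
have E : sym f * asym g = - (sym f * asym g).
  rewrite -{1}(sym_ge (fx f fij)) -mulrA (ge_asym (fx g gij)) odd_tperm ij.
  by rewrite scaleN1r mulrN.
apply/eqP; rewrite -[_ == 0]orFb -[false](pnatr_eq0 F 2) -scaler_eq0.
by rewrite scaler_nat mulr2n {2}E subrr.
Qed.

Lemma sym_ge_asym_inj f g w : sym f * ge w * asym g != 0 -> pair_inj f (lcomp g w).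
Proof.
move=> n0; apply: sym_asym_inj; apply: contra_neq n0.
by rewrite -mulrA ge_asym_conj mulrA => ->; rewrite mul0r.
Qed.

End Labels.

(** * Diagrams and labellings *)

Lemma card_ord_lt N (t : nat) : #|[set i : 'I_N | (i < t)%N]| = minn t N.
Proof.
rewrite -sum1_card -[in RHS](card_ord (minn t N)) -[RHS]sum1_card.
rewrite (big_ord_widen_cond N (fun=> true) (fun=> 1%N)) ?geq_minr //.
by apply: eq_bigl => i; rewrite inE leq_min ltn_ord andbT.
Qed.

Lemma down_closedE N (S : {set 'I_N}) :
  (forall i j : 'I_N, (j <= i)%N -> i \in S -> j \in S) ->
  forall i, (i \in S) = (i < #|S|)%N.
Proof.
move=> dS i; apply/idP/idP => [iS|].
  have /subset_leq_card : [set j : 'I_N | (j < i.+1)%N] \subset S.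
    by apply/subsetP => j; rewrite inE ltnS => /dS; apply.
  by rewrite card_ord_lt (minn_idPl (ltn_ord i)).
apply: contraTT => iNS; rewrite -leqNgt.
have /subset_leq_card : S \subset [set j : 'I_N | (j < i)%N].
  apply/subsetP => j jS; rewrite inE ltnNge; apply: contra iNS.
  by move/dS; apply.
by rewrite card_ord_lt => /leq_trans-> //; apply: geq_minl.
Qed.

Section DiagramCounting.
Variable N : nat.
Local Notation label := {ffun 'I_N -> 'I_N}.
Implicit Types (D E : diagram N) (w : 'S_N) (f g : label).

Definition rlab D : label := [ffun i => (box D i).1].
Definition clab D : label := [ffun i => (box D i).2].

Lemma box_inj D : injective (box D).
Proof. by move=> i j /enum_val_inj/cast_ord_inj. Qed.

Lemma box_in D i : box D i \in boxes D.
Proof. exact: enum_valP. Qed.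

Lemma box_onto D c : c \in boxes D -> exists i, box D i = c.
Proof.
move=> cD; exists (cast_ord (esym (card_boxes D)) (enum_rank_in cD c)).
by rewrite /box cast_ordKV enum_rankK_in.
Qed.

Lemma box_perm D (P : 'I_N -> 'I_N * 'I_N) : injective P ->
  (forall i, P i \in boxes D) -> exists w : 'S_N, forall i, box D (w i) = P i.
Proof.
move=> Pinj PD; have /fin_all_exists [p pP] i := box_onto (PD i).
have pinj : injective p by move=> i j /(congr1 (box D)); rewrite !pP => /Pinj.
by exists (perm pinj) => i; rewrite permE.
Qed.

Lemma diagram_down D (c d : 'I_N * 'I_N) : c \in boxes D ->
  (d.1 <= c.1)%N -> (d.2 <= c.2)%N -> d \in boxes D.
Proof.
case: D => D /= /andP[_ /forall_inP downD] cD d1 d2.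
by have /forallP/(_ d)/implyP := downD c cD; apply; rewrite d1 d2.
Qed.

Definition rlen D r := #|[set j | (r, j) \in boxes D]|.
Definition clen D j := #|[set r | (r, j) \in boxes D]|.

Lemma in_boxes_rlen D r j : ((r, j) \in boxes D) = (j < rlen D r)%N.
Proof.
rewrite -[RHS]down_closedE ?inE // => i l li; rewrite !inE => rD.
exact: diagram_down rD _ _.
Qed.

Lemma in_boxes_clen D r j : ((r, j) \in boxes D) = (r < clen D j)%N.
Proof.
rewrite -[RHS]down_closedE ?inE // => i l li; rewrite !inE => rD.
exact: diagram_down rD _ _.
Qed.

Lemma diagram_inj D E : boxes D = boxes E -> D = E.
Proof. exact: val_inj. Qed.

(** For column labels these are the partial sums of the column lengths, so comparing them for all
    [t] compares shapes in the dominance order. *)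
Definition cnt f (t : nat) := #|[set i | (f i < t)%N]|.

Lemma cnt_lcomp f w t : cnt (lcomp f w) t = cnt f t.
Proof.
rewrite /cnt -[RHS](card_imset _ (@perm_inj _ (w^-1)%g)); congr #|pred_of_set _|.
apply/setP => i; rewrite inE ffunE; apply/idP/imsetP => [it|[j jt ->]].
  by exists (w i); rewrite ?inE ?permK.
by rewrite permKV; rewrite inE in jt.
Qed.

Lemma card_fibers (f : label) (P : pred 'I_N) :
  #|[set i | P i]| = (\sum_r #|[set i | (f i == r) && P i]|)%N.
Proof.
rewrite -sum1_card (partition_big f xpredT) //=; apply: eq_bigr => r _.
by rewrite -[RHS]sum1_card; apply: eq_bigl => i; rewrite !inE andbC.
Qed.

Lemma rlab_fiber D r (P : pred 'I_N) :
  #|[set i | (rlab D i == r) && P (clab D i)]|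
  = #|[set j | ((r, j) \in boxes D) && P j]|.
Proof.
rewrite -(@card_in_imset _ _ (clab D)).
  congr #|pred_of_set _|; apply/setP => j; rewrite inE.
  apply/imsetP/andP => [[i]|[/box_onto[i iE] Pj]].
    rewrite inE !ffunE => /andP[/eqP <- Pi] ->; split=> //.
    by rewrite -surjective_pairing box_in.
  by exists i; rewrite ?inE !ffunE iE ?eqxx.
move=> i j; rewrite !inE !ffunE => /andP[/eqP ri _] /andP[/eqP rj _] ij.
by apply: (@box_inj D); rewrite [LHS]surjective_pairing [RHS]surjective_pairing ri rj ij.
Qed.

Lemma rlab_fiber_all D r : #|[set i | rlab D i == r]| = rlen D r.
Proof.
have := rlab_fiber D r xpredT; congr (_ = _).
  by congr #|pred_of_set _|; apply/setP => i; rewrite !inE andbT.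
by congr #|pred_of_set _|; apply/setP => i; rewrite !inE andbT.
Qed.

Lemma cnt_clab D t : cnt (clab D) t = (\sum_r minn (rlen D r) t)%N.
Proof.
rewrite /cnt (card_fibers (rlab D)); apply: eq_bigr => r _.
rewrite (rlab_fiber _ _ (fun j => (j < t)%N)).
transitivity #|[set j : 'I_N | (j < minn (rlen D r) t)%N]|.
  by congr #|pred_of_set _|; apply/setP => j; rewrite !inE in_boxes_rlen leq_min.
rewrite card_ord_lt; apply/minn_idPl; apply: leq_trans (geq_minl _ _) _.
by rewrite -[leqRHS]card_ord max_card.
Qed.

Section InjectivePair.
Variables (D : diagram N) (g : label).
Hypothesis inj : pair_inj (rlab D) g.

Lemma fiber_le r t :
  (#|[set i | (rlab D i == r) && (g i < t)%N]| <= minn (rlen D r) t)%N.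
Proof.
rewrite leq_min -rlab_fiber_all subset_leq_card /=; last first.
  by apply/subsetP => i; rewrite !inE => /andP[].
rewrite -(@card_in_imset _ _ g) => [|i j].
  apply: (@leq_trans #|[set j : 'I_N | (j < t)%N]|).
    apply: subset_leq_card; apply/subsetP => _ /imsetP[i it ->].
    by move: it; rewrite !inE => /andP[].
  by rewrite card_ord_lt geq_minl.
by rewrite !inE => /andP[/eqP ri _] /andP[/eqP rj _]; apply: inj; rewrite ri rj.
Qed.

(** The places of a row of length l carry distinct labels, hence at most min(l, t) of them have a
    label below t; the column labelling of D attains this bound in every row. *)
Lemma cnt_le t : (cnt g t <= cnt (clab D) t)%N.
Proof.
rewrite cnt_clab /cnt (card_fibers (rlab D)).
by apply: leq_sum => r _; apply: fiber_le.
Qed.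

(** Equality forces each row to occupy its leftmost columns. *)
Lemma cnt_eq_in_boxes : (forall t, cnt g t = cnt (clab D) t) ->
  forall i, (rlab D i, g i) \in boxes D.
Proof.
move=> E i; have E' r t :
    #|[set i | (rlab D i == r) && (g i < t)%N]| = minn (rlen D r) t.
  have /leqif_sum L : forall r, true ->
      (#|[set i | (rlab D i == r) && (g i < t)%N]| <= minn (rlen D r) t
       ?= iff (#|[set i | (rlab D i == r) && (g i < t)%N]| == minn (rlen D r) t))%N.
    by move=> r' _; split; first exact: fiber_le.
  have := E t; rewrite cnt_clab /cnt (card_fibers (rlab D)) => /eqP.
  by rewrite (eq_leqif L) => /forall_inP/(_ r isT)/eqP.
set r := rlab D i; set j := g i.
rewrite in_boxes_rlen ltnNge; apply/negP => le.
have := E' r j.+1; rewrite (minn_idPl (leq_trans le (leqnSn j))).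
rewrite -(minn_idPl le) -(E' r j).
move/eqP; rewrite eqn_leq leqNgt => /andP[/negP[]]; rewrite proper_card //.
apply/properP; split; last by exists i; rewrite inE /r /j eqxx ?ltnn ?ltnSn.
by apply/subsetP => l; rewrite !inE => /andP[-> /ltnW].
Qed.

End InjectivePair.

Lemma eq_cnt_diagram D E : (forall t, cnt (clab D) t = cnt (clab E) t) -> D = E.
Proof.
move=> H; have cl D' j : clen D' j = (cnt (clab D') j.+1 - cnt (clab D') j)%N.
  rewrite /cnt -cardsDS; last by apply/subsetP => i; rewrite !inE => /ltnW.
  transitivity #|[set i | clab D' i == j]|.
    rewrite -(@card_in_imset _ _ (rlab D')) => [|i l].
      congr #|pred_of_set _|; apply/setP => r; rewrite inE.
      apply/idP/imsetP => [/box_onto[i iE]|[i]].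
        by exists i; rewrite ?inE !ffunE iE.
      rewrite !inE !ffunE => /eqP <- ->.
      by rewrite -surjective_pairing box_in.
    rewrite !inE !ffunE => /eqP ri /eqP rj ij; apply: (@box_inj D').
    by rewrite [LHS]surjective_pairing [RHS]surjective_pairing ri rj ij.
  congr #|pred_of_set _|; apply/setP => i; rewrite !inE ltnS -ltnNge.
  by rewrite -eqn_leq eq_sym -val_eqE /= eqn_leq; lia.
apply: diagram_inj; apply/setP => -[r j].
by rewrite !in_boxes_clen !cl !H.
Qed.

End DiagramCounting.

(** * Young symmetrizers *)

Section YoungSymmetrizers.
Variables (F : realFieldType) (N : nat).
Local Notation A := (galg F 'S_N).
Local Notation ge := (@ge F _ : 'S_N -> A).
Local Notation sym := (@sym F N).
Local Notation asym := (@asym F N).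
Implicit Types (D E : diagram N) (w : 'S_N) (x : A).

Definition ysym D : A := sym (rlab D) * asym (clab D).

Lemma fixes_both D s : fixes (rlab D) s -> fixes (clab D) s -> s = 1%g.
Proof.
move=> /fixesP rs /fixesP cs; apply/permP => i; rewrite perm1.
apply: (@box_inj _ D); rewrite [LHS]surjective_pairing [RHS]surjective_pairing.
by have := cs i; have := rs i; rewrite !ffunE => -> ->.
Qed.

Lemma ysym_coef1 D : gcoef (ysym D) 1%g = 1.
Proof.
rewrite gcoefM (bigD1 1%g) //= big1 ?addr0 => [|s s1].
  by rewrite invg1 mulg1 gcoef_tw odd_perm1 !gcoef_sym !fixes1 expr0 !mulr1.
rewrite mulg1 gcoef_tw !gcoef_sym fixesV.
case: (boolP (fixes (rlab D) s)) => rs; last by rewrite mul0r.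
case: (boolP (fixes (clab D) s)) => cs; last by rewrite !mulr0.
by rewrite (fixes_both rs cs) eqxx in s1.
Qed.

Lemma ysym_neq0 D : ysym D != 0.
Proof.
apply/eqP => /(congr1 (fun x => gcoef x 1%g)); rewrite ysym_coef1 gcoef0.
by move/eqP; rewrite oner_eq0.
Qed.

(** If the product is nonzero, then w = p * q with p in the row group and q in the column group: p
    keeps place i in its row and moves it to the column of w i. The target is a box of D by the case
    of equality in [cnt_le]. *)
Lemma sym_ge_asym D w : exists l : F, sym (rlab D) * ge w * asym (clab D) = l *: ysym D.
Proof.
have [->|n0] := eqVneq (sym (rlab D) * ge w * asym (clab D)) 0.
  by exists 0; rewrite scale0r.
have inj := sym_ge_asym_inj n0.
have inD := cnt_eq_in_boxes inj (cnt_lcomp _ _).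
pose P i := (rlab D i, lcomp (clab D) w i).
have [p pP] : exists p : 'S_N, forall i, box D (p i) = P i.
  by apply: box_perm inD => i j [ri ci]; apply: inj.
have rp : fixes (rlab D) p.
  by apply/fixesP => i; rewrite {1}ffunE pP.
have cq : fixes (clab D) (p^-1 * w)%g.
  apply/fixesP => i; have := pP ((p^-1)%g i); rewrite permKV => /(congr1 snd) /=.
  by rewrite permM [in RHS]ffunE => <-; rewrite ffunE.
exists ((-1) ^+ odd_perm (p^-1 * w)%g).
rewrite -{1}(mulKVg p w) geM mulrA (sym_ge _ rp) -mulrA (ge_asym _ cq).
by rewrite -scalerAr.
Qed.

Lemma sym_mul_asym D x : exists l : F, sym (rlab D) * x * asym (clab D) = l *: ysym D.
Proof.
rewrite (gsumE x) mulr_sumr mulr_suml.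
elim/big_ind: _ => [|y z [l ->] [l' ->]|w _]; first by exists 0; rewrite scale0r.
  by exists (l + l'); rewrite scalerDl.
have [l E] := sym_ge_asym D w; exists (gcoef x w * l).
by rewrite -scalerAr -scalerAl E scalerA.
Qed.

Lemma ysym_corner D x :
  ysym D * x * ysym D = gcoef (ysym D * x * ysym D) 1%g *: ysym D.
Proof.
have [l E] := sym_mul_asym D (asym (clab D) * x * sym (rlab D)).
have -> : ysym D * x * ysym D = l *: ysym D by rewrite -E !mulrA.
by rewrite gcoefZ ysym_coef1 mulr1.
Qed.

Lemma sym_mul_asym_inj D E x : sym (rlab D) * x * asym (clab E) != 0 ->
  exists w, pair_inj (rlab D) (lcomp (clab E) w).
Proof.
move=> n0; suff [w n0'] : exists w, sym (rlab D) * ge w * asym (clab E) != 0.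
  by exists w; apply: sym_ge_asym_inj n0'.
apply/existsP; apply: contra_neqT n0; rewrite negb_exists => /forallP H.
rewrite (gsumE x) mulr_sumr mulr_suml big1 // => w _.
by rewrite -scalerAr -scalerAl (eqP (negbNE (H w))) scaler0.
Qed.

(** The outer factors of a nonzero product give one dominance inequality; the inner factors, read
    backwards through [star], give the opposite one. *)
Lemma ysym_ortho D E x : D != E -> ysym D * x * ysym E = 0.
Proof.
apply: contra_neq_eq => n0; apply: eq_cnt_diagram => t; apply/eqP.
rewrite eqn_leq; apply/andP; split.
  have [|w inj] := @sym_mul_asym_inj E D (star x).
    apply: contra_neq n0 => /(congr1 (@star _ _)); rewrite linear0 !starM.
    rewrite starK star_sym star_asym /ysym => H.
    by rewrite -(mulrA (sym _)) -mulrA (mulrA _ (sym _)) -(mulrA (asym _)) H mul0r mulr0.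
  by rewrite -(cnt_lcomp (clab D) w); apply: cnt_le.
have [|w inj] := @sym_mul_asym_inj D E (asym (clab D) * x * sym (rlab E)).
  by apply: contra_neq n0 => H; rewrite -H /ysym !mulrA.
by rewrite -(cnt_lcomp (clab E) w); apply: cnt_le.
Qed.

(** This scalar is the product of the hook lengths of D; that it is nonzero is obtained from
    positivity. *)
Definition ykap D : F := gcoef (ysym D * ysym D) 1%g.

Lemma ysym_sqr D : ysym D * ysym D = ykap D *: ysym D.
Proof. by have := ysym_corner D 1; rewrite mulr1. Qed.

(** With a and b the two symmetrizers, a * b * a is self-adjoint and nonzero. Its square is a
    multiple of a * b * a * b * a and is nonzero as well. *)
Lemma ysym_sqr_neq0 D : ysym D * ysym D != 0.
Proof.
set a := sym (rlab D); set b := asym (clab D).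
have [k k0 aa] := sym_sqr F (rlab D); have [l l0 bb] := asym_sqr F (clab D).
rewrite -/a in aa; rewrite -/b in bb.
have sa : star a = a := star_sym F (rlab D).
have sb : star b = b := star_asym F (clab D).
have saba : star (a * b * a) = a * b * a by rewrite !starM sa sb mulrA.
have aba0 : a * b * a != 0.
  have : ysym D * star (ysym D) != 0.
    by apply: contra_neq (ysym_neq0 D); apply: mul_star_eq0.
  rewrite /ysym -/a -/b starM sa sb mulrA -(mulrA a b b) bb.
  by rewrite -scalerAr -scalerAl; apply: contra_neq => ->; rewrite scaler0.
have := star_id_sqr_neq0 saba aba0; rewrite !mulrA -(mulrA _ a a) aa.
rewrite -scalerAr -!scalerAl; apply: contra_neq => E.
by move: E; rewrite /ysym -/a -/b => ->; rewrite mul0r scaler0.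
Qed.

Lemma ykap_neq0 D : ykap D != 0.
Proof. by apply: contra_neq (ysym_sqr_neq0 D) => E; rewrite ysym_sqr E scale0r. Qed.

Definition eps D : A := (ykap D)^-1 *: ysym D.

Lemma epsK D : eps D * eps D = eps D.
Proof.
rewrite /eps -scalerAl -scalerAr ysym_sqr !scalerA -mulrA mulVf ?ykap_neq0 //.
by rewrite mulr1.
Qed.

Lemma eps_corner D x : exists l : F, eps D * x * eps D = l *: eps D.
Proof.
rewrite /eps -!scalerAl -scalerAr ysym_corner; set g := gcoef _ _.
by exists ((ykap D)^-1 * g); rewrite !scalerA mulrC [_ * g]mulrC mulrA.
Qed.

Lemma eps_ortho D E x : D != E -> eps D * x * eps E = 0.
Proof. by move=> DE; rewrite /eps -!scalerAl -scalerAr ysym_ortho ?scaler0. Qed.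

Lemma eps_neq0 D : eps D != 0.
Proof. by rewrite scaler_eq0 invr_eq0 negb_or ykap_neq0 ysym_neq0. Qed.

Lemma ysym_eps D : ysym D = ykap D *: eps D.
Proof. by rewrite /eps scalerA divff ?scale1r ?ykap_neq0. Qed.

(** Here w carries the chosen filling of D to that of its conjugate. Exchanging rows and columns
    exchanges, up to the sign twist, the symmetrizer and the antisymmetrizer, which then stand in
    the opposite order. *)
Lemma ysym_conj D : exists w,
  ge w * ysym (conj_diagram D) = tw (asym (clab D) * sym (rlab D)) * ge w.
Proof.
have [w wP] : exists w : 'S_N, forall i, box (conj_diagram D) (w i) = swap (box D i).
  apply: box_perm => [i j|i]; last by apply: imset_f; apply: box_in.
  by case E : (box D i) => [a b]; case E' : (box D j) => [c d] [? ?];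
     apply: (@box_inj _ D); rewrite E E'; congr (_, _).
exists w; rewrite /ysym mulrA ge_sym_conj -mulrA ge_asym_conj mulrA twM twK.
by congr (sym _ * asym _ * _); apply/ffunP => i; rewrite !ffunE wP.
Qed.

Lemma ykap_conj D : ykap (conj_diagram D) = ykap D.
Proof.
have [w E] := ysym_conj D.
have E' : ysym (conj_diagram D) = ge (w^-1)%g * tw (star (ysym D)) * ge w.
  by rewrite starM star_sym star_asym -mulrA -E mulrA geVK mul1r.
have : ysym (conj_diagram D) * ysym (conj_diagram D)
       = ykap D *: ysym (conj_diagram D).
  rewrite E'; set t := tw _; have tt : t * t = ykap D *: t.
    by rewrite /t -twM -starM ysym_sqr !linearZ.
  rewrite -!mulrA (mulrA (ge w)) geKV mul1r (mulrA t) tt.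
  by rewrite -scalerAl -scalerAr.
rewrite ysym_sqr => /(congr1 (fun x => gcoef x 1%g)).
by rewrite !gcoefZ ysym_coef1 !mulr1.
Qed.

Lemma gtr_ysym_conj D x : (forall s : 'S_N, odd_perm s -> gtr x (ge s) = 0) ->
  gtr x (ysym (conj_diagram D)) = gtr x (ysym D).
Proof.
move=> x_odd; have [w E] := ysym_conj D.
rewrite -[X in gtr x X]mul1r -(geVK F w) -mulrA E gtr_mulCr -mulrA geKV mulr1.
by rewrite gtr_tw // gtr_mulCr.
Qed.

Lemma gtr_eps_conj D x : (forall s : 'S_N, odd_perm s -> gtr x (ge s) = 0) ->
  gtr x (eps (conj_diagram D)) = gtr x (eps D).
Proof. by move=> x_odd; rewrite /eps !gtrZr gtr_ysym_conj // ykap_conj. Qed.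

(** The operator is a projection onto the line spanned by eps D. Each corner eps D * g * eps D is a
    multiple of eps D that can be read off at 1, and summing these multiples against the
    coefficients of eps D gives the cube of eps D. *)
Lemma gtr_eps D : gtr (eps D) (eps D) = 1.
Proof.
have E x : eps D * x * eps D = (ykap D * gcoef (eps D * x * eps D) 1%g) *: eps D.
  have [l ->] := eps_corner D x.
  by rewrite gcoefZ gcoefZ ysym_coef1 mulr1 mulrCA divff ?mulr1 ?ykap_neq0.
have coef1 : gcoef (eps D) 1%g = (ykap D)^-1 by rewrite gcoefZ ysym_coef1 mulr1.
transitivity (ykap D * gcoef (eps D * eps D * eps D) 1%g); last first.
  by rewrite !epsK coef1 divff ?ykap_neq0.
have -> : eps D * eps D * eps D = \sum_g gcoef (eps D) g *: (eps D * ge g * eps D).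
  rewrite {2}(gsumE (eps D)) mulr_sumr mulr_suml; apply: eq_bigr => g _.
  by rewrite -[eps D * (_ *: _)]scalerAr -[_ *: (eps D * _) * _]scalerAl.
rewrite gcoef_sum mulr_sumr; apply: eq_bigr => g _.
by rewrite {1}E (gcoefZ (ykap D * _)) (gcoefZ (gcoef (eps D) g))
  -(mulrA (ykap D)) [X in _ * X]mulrC.
Qed.

Lemma gtr_eps_ortho D E : D != E -> gtr (eps D) (eps E) = 0.
Proof. by move=> DE; rewrite /gtr big1 // => g _; rewrite eps_ortho // gcoef0. Qed.

End YoungSymmetrizers.

(** * Nested labellings come from diagrams *)

Section Rank.
Variables (N : nat) (k : 'I_N -> nat).
Hypothesis k_inj : injective k.

Definition rank (r : 'I_N) := #|[set r' | (k r < k r')%N]|.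

Lemma rank_lt r : (rank r < N)%N.
Proof.
rewrite -[X in (_ < X)%N]card_ord -cardsT proper_card // properT.
by apply/eqP => /setP/(_ r); rewrite !inE ltnn.
Qed.

Lemma rank_mono r r' : (k r < k r')%N -> (rank r' < rank r)%N.
Proof.
move=> rr'; apply/proper_card/properP; split.
  by apply/subsetP => l; rewrite !inE; apply: ltn_trans.
by exists r'; rewrite inE ?rr' // ltnn.
Qed.

Lemma rank_inj : injective rank.
Proof.
move=> r r' E; case: (ltngtP (k r) (k r')) => [/rank_mono|/rank_mono|/k_inj //].
  by rewrite E ltnn.
by rewrite E ltnn.
Qed.

Lemma rank_onto r d : (d < rank r)%N -> exists2 r', rank r' = d & (k r < k r')%N.
Proof.
move=> dr; have inj : injective (fun r => Ordinal (rank_lt r)).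
  by move=> a b /(congr1 val); apply: rank_inj.
have dN : (d < N)%N by apply: ltn_trans dr (rank_lt r).
have [r' E] : exists r', Ordinal (rank_lt r') = Ordinal dN.
  by exists (invF inj (Ordinal dN)); apply: (f_invF inj).
move/(congr1 val): E => /= E.
exists r' => //; case: (ltngtP (k r) (k r')) => // [/rank_mono|/k_inj rr'].
  by rewrite E => /(ltn_trans dr); rewrite ltnn.
by rewrite rr' E ltnn in dr.
Qed.

End Rank.

Section Fibers.
Variable N : nat.
Local Notation label := {ffun 'I_N -> 'I_N}.
Implicit Types (f g : label) (i j r : 'I_N) (w : 'S_N).

Definition fib f r := #|[set i | f i == r]|.

(** Rows are ordered by length, ties being broken by their index. *)
Definition key f r := (fib f r * N.+1 + (N - r))%N.

Lemma key_inj f : injective (key f).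
Proof.
move=> r r' E; have := congr1 (fun n => n %% N.+1)%N E; rewrite /= /key.
rewrite !modnMDl !modn_small ?ltnS ?leq_subr // => H.
by apply: val_inj => /=; have := ltn_ord r; have := ltn_ord r'; lia.
Qed.

Lemma key_fib f r r' : (key f r < key f r')%N -> (fib f r <= fib f r')%N.
Proof. by rewrite /key => H; rewrite leqNgt; apply/negP => H'; nia. Qed.

(** The row index of place j once the rows are sorted; summed over j it is the statistic n(lambda)
    of the row lengths lambda. *)
Definition beta f j := rank (key f) (f j).

(** The sum of the squares of the row lengths, the potential that is maximized in the proof of
    completeness. *)
Definition pr f := (\sum_i \sum_l (f i == f l))%N.

Lemma pr_lcomp f w : pr (lcomp f w) = pr f.
Proof.
rewrite /pr [RHS](reindex_inj (@perm_inj _ w)) /=; apply: eq_bigr => i _.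
rewrite [RHS](reindex_inj (@perm_inj _ w)) /=; apply: eq_bigr => l _.
by rewrite !ffunE.
Qed.

Lemma fib_sum f r : fib f r = (\sum_l (r == f l))%N.
Proof.
rewrite /fib -sum1_card big_mkcond; apply: eq_bigr => l _.
by rewrite inE eq_sym; case: eqP.
Qed.

Definition relab f j r : label := [ffun l => if l == j then r else f l].

(** Moving j from a row of a boxes to one of b >= a boxes raises the sum of squares by 2 (b - a +
    1). *)
Lemma pr_relab f j r : r != f j -> (fib f (f j) <= fib f r)%N ->
  (pr f < pr (relab f j r))%N.
Proof.
move=> rj le.
have split h : pr h = (1 + (\sum_(l | l != j) (h j == h l)).*2
                       + \sum_(i | i != j) \sum_(l | l != j) (h i == h l))%N.
  rewrite /pr (bigD1 j) //= (bigD1 j) //= eqxx -addnn -!addnA; congr (_ + (_ + _))%N.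
  rewrite -big_split /=; apply: eq_bigr => i _.
  by rewrite (bigD1 j) //= eq_sym.
rewrite (split f) (split (relab f j r)).
have -> : (\sum_(i | i != j) \sum_(l | l != j) (relab f j r i == relab f j r l)
           = \sum_(i | i != j) \sum_(l | l != j) (f i == f l))%N.
  apply: eq_bigr => i ij; apply: eq_bigr => l lj.
  by rewrite !ffunE (negbTE ij) (negbTE lj).
rewrite ltn_add2r ltn_add2l ltn_double.
have -> : (\sum_(l | l != j) (relab f j r j == relab f j r l) = fib f r)%N.
  rewrite fib_sum [RHS](bigD1 j) //= (negbTE rj) add0n; apply: eq_bigr => l lj.
  by rewrite !ffunE eqxx (negbTE lj).
apply: leq_trans le; rewrite fib_sum [X in (_ < X)%N](bigD1 j) //= eqxx.
exact: leqnn.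
Qed.

Definition meets f g j := #|[set i | (g i == g j) && (key f (f j) < key f (f i))%N]|.

Section InjectivePair.
Variables (f g : label).
Hypothesis inj : pair_inj f g.

Lemma meets_image j : [set f i | i in [set i | (g i == g j) && (key f (f j) < key f (f i))%N]]
  \subset [set r | (key f (f j) < key f r)%N].
Proof. by apply/subsetP => _ /imsetP[i iS ->]; move: iS; rewrite !inE => /andP[]. Qed.

Lemma card_meets j :
  #|[set f i | i in [set i | (g i == g j) && (key f (f j) < key f (f i))%N]]| = meets f g j.
Proof.
apply: card_in_imset => i l; rewrite !inE => /andP[/eqP gi _] /andP[/eqP gl _] fil.
by apply: inj; rewrite // gi gl.
Qed.

Lemma meets_le j : (meets f g j <= beta f j)%N.
Proof. by rewrite -card_meets; apply/subset_leq_card/meets_image. Qed.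

Lemma meets_onto j r : meets f g j = beta f j -> (key f (f j) < key f r)%N ->
  exists2 i, f i = r & g i = g j.
Proof.
move=> E jr.
have /eqP S : [set f i | i in [set i | (g i == g j) && (key f (f j) < key f (f i))%N]]
    == [set r | (key f (f j) < key f r)%N].
  by rewrite eqEcard meets_image card_meets E leqnn.
have : r \in [set r | (key f (f j) < key f r)%N] by rewrite inE.
by rewrite -S => /imsetP[i]; rewrite inE => /andP[/eqP gi _] ->; exists i.
Qed.

(** Distinct places with equal column label lie in rows with distinct keys, so [meets] counts each
    such unordered pair once, at the place with the smaller key. The N extra pairs are diagonal. *)
Lemma pr_meets : pr g = (N + (\sum_j meets f g j).*2)%N.
Proof.
have E i j : (g i == g j : nat)
    = ((i == j) + (((g i == g j) && (key f (f j) < key f (f i))) +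
       ((g i == g j) && (key f (f i) < key f (f j)))))%N.
  have [gij|] := eqVneq (g i) (g j); last first.
    by move=> gij; have [E|//] := eqVneq i j; rewrite E eqxx in gij.
  have [->|ij] := eqVneq i j; first by rewrite ltnn.
  have fij : f i != f j by apply: contra_neq ij => fij; apply: inj.
  rewrite /=; case: (ltngtP (key f (f i)) (key f (f j))) => // /key_inj E.
  by rewrite E eqxx in fij.
rewrite /pr; under eq_bigr do under eq_bigr do rewrite E.
under eq_bigr do rewrite !big_split /=.
rewrite !big_split /= -addnn; congr (_ + (_ + _))%N.
- rewrite -[RHS]card_ord -sum1_card; apply: eq_bigr => i _.
  by rewrite (bigD1 i) //= eqxx big1 ?addn0 // => j; rewrite eq_sym => /negbTE->.
- rewrite exchange_big; apply: eq_bigr => j _; rewrite /meets -sum1_card [RHS]big_mkcond.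
  by apply: eq_bigr => i _; rewrite inE; case: ifP.
- apply: eq_bigr => j _; rewrite /meets -sum1_card [RHS]big_mkcond.
  by apply: eq_bigr => i _; rewrite inE eq_sym; case: ifP.
Qed.

End InjectivePair.

(** The hypotheses say that every column of [g] meeting a row [f j] meets all
    rows longer than it, and conversely; the diagram is obtained by sorting the
    rows and the columns by length. *)
Lemma nested_diagram f g : pair_inj f g ->
  (forall j, meets f g j = beta f j) -> (forall j, meets g f j = beta g j) ->
  exists D : diagram N, exists w,
    (forall i j, (f i == f j) = (lcomp (rlab D) w i == lcomp (rlab D) w j)) /\
    (forall i j, (g i == g j) = (lcomp (clab D) w i == lcomp (clab D) w j)).
Proof.
move=> inj Ef Eg; have inj' : pair_inj g f by move=> i j gij fij; apply: inj.
pose P i := (Ordinal (rank_lt (key f) (f i)), Ordinal (rank_lt (key g) (g i))).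
have Pf i j : ((P i).1 == (P j).1) = (f i == f j).
  by rewrite -val_eqE /=; apply: inj_eq; apply/rank_inj/key_inj.
have Pg i j : ((P i).2 == (P j).2) = (g i == g j).
  by rewrite -val_eqE /=; apply: inj_eq; apply/rank_inj/key_inj.
have Pinj : injective P.
  move=> i j E; apply: inj; apply/eqP; first by rewrite -Pf E.
  by rewrite -Pg E.
have isD : is_diagram (P @: [set: 'I_N]).
  rewrite /is_diagram card_imset // cardsT card_ord eqxx /=.
  apply/forall_inP => _ /imsetP[i _ ->]; apply/forallP => -[a b]; apply/implyP => /=.
  move=> /andP[ai bi].
  have [j fj gj] : exists2 j, rank (key f) (f j) = a & g j = g i.
    move: ai; rewrite leq_eqVlt => /predU1P[->|]; first by exists i.
    case/(rank_onto (@key_inj f)) => r <- /(meets_onto inj (Ef i))[j <- ?].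
    by exists j.
  have [l gl fl] : exists2 l, rank (key g) (g l) = b & f l = f j.
    move: bi; rewrite -gj leq_eqVlt => /predU1P[->|]; first by exists j.
    case/(rank_onto (@key_inj g)) => r <- /(meets_onto inj' (Eg j))[l <- ?].
    by exists l.
  apply/imsetP; exists l; first by rewrite inE.
  congr (_, _); apply: val_inj => /=.
    by rewrite fl fj.
  by rewrite gl.
pose D := Diagram isD; have [w wP] : exists w : 'S_N, forall i, box D (w i) = P i.
  by apply: box_perm => // i; apply: imset_f; rewrite inE.
exists D, w; split=> i j; rewrite !ffunE !wP; first by rewrite Pf.
by rewrite Pg.
Qed.

End Fibers.

(** * Completeness of the Young symmetrizers *)

Section Completeness.
Variables (F : realFieldType) (N : nat).
Local Notation A := (galg F 'S_N).
Local Notation ge := (@ge F _ : 'S_N -> A).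
Local Notation sym := (@sym F N).
Local Notation asym := (@asym F N).
Local Notation label := {ffun 'I_N -> 'I_N}.
Implicit Types (f g : label) (i j r : 'I_N) (w s : 'S_N) (x v : A).

(** Ordered pairs and the diagonal are included, which makes this N plus twice the class sum of
    transpositions. *)
Definition transp : A := \sum_i \sum_j ge (tperm i j).

Lemma transp_central x : transp * x = x * transp.
Proof.
apply/esym/commr_ge => s; rewrite /transp mulr_sumr mulr_suml.
rewrite [LHS](reindex_inj (@perm_inj _ s)); apply: eq_bigr => i _ /=.
rewrite mulr_sumr mulr_suml [LHS](reindex_inj (@perm_inj _ s)) /=.
by apply: eq_bigr => j _; rewrite -!geM -tpermJ conjgE mulKVg.
Qed.

Lemma tw_transp : tw transp = (2 * N)%:R *: 1 - transp.
Proof.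
apply/eqP; rewrite eq_sym subr_eq /transp linear_sum -big_split /=.
have E i j : tw (ge (tperm i j)) + ge (tperm i j) = (i == j)%:R *: (2%:R *: 1).
  rewrite tw_ge odd_tperm; have [->|_] := eqVneq i j.
    by rewrite tperm1 ge1 !scale1r -mulr2n scaler_nat.
  by rewrite scaleN1r addNr scale0r.
under eq_bigr do rewrite linear_sum -big_split /=.
under eq_bigr do under eq_bigr do rewrite E.
rewrite (eq_bigr (fun=> 2%:R *: 1)) => [|i _].
  by rewrite sumr_const card_ord -scaler_nat scalerA -natrM mulnC.
rewrite (bigD1 i) //= eqxx scale1r big1 ?addr0 // => j.
by rewrite eq_sym => /negbTE->; rewrite scale0r.
Qed.

(** For the row labelling of a diagram this is N plus twice the sum of the contents. *)
Definition content_ev f : F := (pr f)%:R - 2%:R * (\sum_j beta f j)%:R.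

(** If no [sym g] with longer rows survives, then moving one box into a longer row
    kills [x * sym f], hence the transpositions of a box with the boxes of that
    row act on it with sum [-1], and [transp] acts as a scalar. *)
Section Maximal.
Variables (x : A) (f : label).
Hypothesis fmax : forall g, (pr f < pr g)%N -> x * sym g = 0.
Let v := x * sym f.

Lemma sym_mul_sym_eq0 g : (pr f < pr g)%N -> v * sym g = 0.
Proof.
move=> fg; rewrite /v sym_sum mulr_sumr mulr_suml big1 // => s _.
by rewrite -mulrA ge_sym_conj mulrA fmax ?mul0r // pr_lcomp.
Qed.

Lemma move_box r j : r != f j -> (fib f (f j) <= fib f r)%N ->
  \sum_(i | f i == r) v * ge (tperm i j) = - v.
Proof.
move=> rj le; set f' := relab f j r; have ff' := pr_relab rj le.
pose S0 := [pred s : 'S_N | fixes f s && (s j == j)].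
have S0v : v * \sum_(s | S0 s) ge s = #|S0|%:R *: v.
  rewrite mulr_sumr (eq_bigr (fun=> v)) ?sumr_const ?scaler_nat // => s /andP[fs _].
  by rewrite /v -mulrA sym_ge.
have f'j : f' j = r by rewrite ffunE eqxx.
have S0E s : S0 s = fixes f' s && (s j == j).
  apply/andP/andP => -[/fixesP fs /eqP sj]; split=> //; try exact/eqP.
    apply/fixesP => l; rewrite !ffunE -{1}sj (inj_eq perm_inj) fs.
    by case: eqP.
  apply/fixesP => l; have := fs l; rewrite !ffunE -{1}sj (inj_eq perm_inj).
  by case: eqP => [->|//]; rewrite sj.
(* The stabilizer of f' splits into cosets of S0 according to the image of j. The coset of j itself
   contributes v, the others the sum in the statement. *)
have E : sym f' = (\sum_(s | S0 s) ge s) * \sum_(i | f' i == r) ge (tperm i j).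
  rewrite sym_sum mulr_sumr (partition_big (fun s : 'S_N => s j) (fun i => f' i == r)) /=.
    apply: eq_bigr => i /eqP f'i; rewrite mulr_suml.
    have tf' : fixes f' (tperm i j).
      by apply/fixesP => l; case: tpermP => // ->; rewrite f'i f'j.
    rewrite (reindex_inj (mulIg (tperm i j))) /=; apply: eq_big => [s|s _].
      transitivity (fixes f' s && (s j == j)); last by rewrite -S0E.
      rewrite fixes_mulgr // permM; congr (_ && _).
      by rewrite -[X in _ == X](tpermR i j) (inj_eq perm_inj).
    by rewrite geM.
  by move=> s /fixesP fs; rewrite fs f'j.
have := sym_mul_sym_eq0 ff'; rewrite E mulrA S0v -scalerAl => /eqP.
rewrite scaler_eq0 pnatr_eq0 => /orP[/eqP/card0_eq/(_ 1%g)|/eqP].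
  by rewrite inE fixes1 perm1 eqxx.
rewrite mulr_sumr (bigD1 j) /=; last by rewrite f'j.
rewrite tperm1 ge1 mulr1 => /eqP; rewrite addrC addr_eq0 => /eqP <-.
apply: eq_bigl => i; rewrite !ffunE; case: (eqVneq i j) => [->|_].
  by rewrite eq_sym (negbTE rj) andbF.
by rewrite andbT.
Qed.

Lemma sym_transp : v * transp = content_ev f *: v.
Proof.
have same i j : f i = f j -> v * ge (tperm i j) = v.
  move=> fij; rewrite /v -mulrA sym_ge //; apply/fixesP => l.
  by case: tpermP => // ->.
(* Of two boxes in different rows, the one with the smaller key may be moved by [move_box] into the
   row of the other. So place j receives -v from each of the [beta f j] rows that precede its
   own. *)
have better : \sum_j \sum_(i | (key f (f j) < key f (f i))%N) v * ge (tperm i j)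
    = - (\sum_j beta f j)%:R *: v.
  rewrite scaleNr scaler_nat -sumrMnr -sumrN; apply: eq_bigr => j _.
  rewrite (partition_big f (fun r => key f (f j) < key f r)%N) //=.
  rewrite (eq_bigr (fun=> - v)) => [|r jr].
    rewrite -mulNrn -sumr_const; apply: eq_bigl => r; by rewrite inE.
  rewrite -(@move_box r j) ?(key_fib (ltnW jr)) //; last 2 first.
  - by apply: contraTneq jr => ->; rewrite ltnn.
  - exact: key_fib.
  by apply: eq_bigl => i; case: eqP => [->|]; rewrite ?jr ?andbF.
have worse : \sum_j \sum_(i | (key f (f i) < key f (f j))%N) v * ge (tperm i j)
    = - (\sum_j beta f j)%:R *: v.
  rewrite -better (exchange_big_dep xpredT) //=; apply: eq_bigr => j _.
  by apply: eq_bigr => i _; rewrite tpermC.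
have -> : v * transp = \sum_j (\sum_(i | f i == f j) v * ge (tperm i j)
    + (\sum_(i | (key f (f j) < key f (f i))%N) v * ge (tperm i j)
    + \sum_(i | (key f (f i) < key f (f j))%N) v * ge (tperm i j))).
  rewrite /transp exchange_big mulr_sumr; apply: eq_bigr => j _; rewrite mulr_sumr.
  rewrite [\sum_(i | f i == _) _]big_mkcond [\sum_(i | (key f (f j) < _)%N) _]big_mkcond.
  rewrite [\sum_(i | (_ < key f (f j))%N) _]big_mkcond -!big_split; apply: eq_bigr => i _ /=.
  have [->|fij] := eqVneq (f i) (f j); first by rewrite ltnn !addr0.
  case: (ltngtP (key f (f i)) (key f (f j))) => [||/key_inj E].
  - by rewrite !add0r.
  - by rewrite add0r addr0.
  - by rewrite E eqxx in fij.
rewrite !big_split /= better worse.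
have -> : \sum_j \sum_(i | f i == f j) v * ge (tperm i j) = (pr f)%:R *: v.
  rewrite scaler_nat /pr exchange_big /= -sumrMnr; apply: eq_bigr => j _.
  rewrite -sumrMnr big_mkcond; apply: eq_bigr => i _.
  by case: eqP => [/same ->|]; rewrite ?mulr1n ?mulr0n.
rewrite -!scalerDl /content_ev; congr (_ *: _); ring.
Qed.

End Maximal.

(** For maximal row and column labellings, the two computations of the action of
    [transp] on [x * sym f * asym g] force equality in [meets_le], so that the
    labellings are those of a diagram. *)
Theorem ysym_complete x : x != 0 -> exists D w, x * ge w * ysym F D != 0.
Proof.
move=> x0; pose f0 : label := [ffun i => i].
have sym0 : sym f0 = 1.
  apply: gcoefP => s; rewrite gcoef_sym -ge1 gcoef_ge; congr (nat_of_bool _)%:R.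
  apply/fixesP/eqP => [E|-> i]; last by rewrite perm1.
  by apply/permP => i; rewrite perm1; have := E i; rewrite !ffunE.
have maximal y : y != 0 -> exists2 f, y * sym f != 0 &
    forall g, (pr f < pr g)%N -> y * sym g = 0.
  move=> y0; have P0 : y * sym f0 != 0 by rewrite sym0 mulr1.
  case: (@arg_maxnP _ f0 (fun f => y * sym f != 0) (@pr N) P0) => f Pf fmax.
  exists f => // g; rewrite ltnNge; apply: contraNeq => /fmax.
  by [].
have [f xf fmax] := maximal x x0.
have [g xg gmax] : exists2 g, tw (x * sym f) * sym g != 0 &
    forall h, (pr g < pr h)%N -> tw (x * sym f) * sym h = 0.
  by apply: maximal; rewrite tw_eq0.
have xfg : x * sym f * asym g != 0.
  by rewrite -tw_eq0 twM twK.
have inj : pair_inj f g.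
  apply: (@sym_asym_inj F); apply: contra_neq xfg => E.
  by rewrite -mulrA E mulr0.
have inj' : pair_inj g f by move=> i j gij fij; apply: inj.
have Ef := sym_transp fmax; have Eg := sym_transp gmax.
(* Since [transp] is central, its action on x * sym f * asym g can be computed next to [sym f] or,
   through the sign twist, next to [asym g]. *)
have evE : content_ev f + content_ev g = (2 * N)%:R.
  have : content_ev f *: (x * sym f * asym g) = ((2 * N)%:R - content_ev g) *: (x * sym f * asym g).
    rewrite scalerAl -Ef -(mulrA _ transp) transp_central mulrA.
    have := congr1 (@tw _ _) Eg; rewrite twM [tw (_ * sym g)]twM twK tw_transp linearZ /=.
    rewrite [tw (_ * sym g)]twM twK mulrBr -scalerAr mulr1 => H.
    by rewrite scalerBl /asym -H opprB addrC subrK.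
  move/eqP; rewrite -subr_eq0 -scalerBl scaler_eq0 (negbTE xfg) orbF.
  by rewrite opprB addrA subr_eq0 addrC => /eqP.
have natE : (pr f + pr g = 2 * N + 2 * \sum_j beta f j + 2 * \sum_j beta g j)%N.
  apply/eqP; rewrite -(eqr_nat F) !mul2n -!addnn !natrD; apply/eqP.
  by move: evE; rewrite mul2n -addnn natrD /content_ev => evE; lra.
have sumle (h h' : label) (i : pair_inj h h') :
    (\sum_j meets h h' j <= \sum_j beta h j)%N.
  by apply: leq_sum => j _; apply: meets_le.
have lef := sumle f g inj; have leg := sumle g f inj'.
have sumE (h h' : label) (i : pair_inj h h') :
    (\sum_j meets h h' j = \sum_j beta h j)%N -> forall j, meets h h' j = beta h j.
  move=> E j; have L : forall j, true ->
      (meets h h' j <= beta h j ?= iff (meets h h' j == beta h j))%N.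
    by move=> l _; split=> //; apply: meets_le.
  move/leqif_sum: L => L; move/eqP: E; rewrite (eq_leqif L).
  by move=> /forall_inP/(_ j isT)/eqP.
(* The two sums of [meets] now add up to the two sums of [beta]; being bounded term by term, they
   agree term by term. *)
rewrite (pr_meets inj) (pr_meets inj') in natE.
have [s1 s2] : (\sum_j meets f g j = \sum_j beta f j)%N /\
    (\sum_j meets g f j = \sum_j beta g j)%N.
  by move: natE lef leg; rewrite -!mul2n; lia.
have [D [w [Df Dg]]] := nested_diagram inj (sumE _ _ inj s1) (sumE _ _ inj' s2).
exists D, w; apply: contra_neq xfg => E.
have Eg' : asym g = asym (lcomp (clab D) w) by rewrite /asym (eq_sym_lab F Dg).
have : x * sym f * asym g * ge w = 0.
  rewrite Eg' (eq_sym_lab F Df) -mulrA -(ge_asym_conj F) mulrA -(mulrA x).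
  by rewrite -(ge_sym_conj F) mulrA -[LHS]mulrA E.
move=> /(congr1 (fun z => z * ge (w^-1)%g)) /=.
by rewrite -[_ * ge w * _]mulrA geKV mulr1 mul0r.
Qed.

End Completeness.

(** * Decomposition of idempotents *)

Section Decomposition.
Variables (F : realFieldType) (N : nat).
Local Notation A := (galg F 'S_N).
Local Notation ge := (@ge F _ : 'S_N -> A).
Local Notation eps := (@eps F N).
Implicit Types (D E : diagram N) (e : A).

(** [y D i] and [u D i] are mutually inverse maps between the i-th copy of
    [eps D * A] in [e * A] and [eps D * A] itself. *)
Record idem_dec (e : A) (m : diagram N -> nat) (y u : diagram N -> nat -> A) : Prop := {
  dec_ey : forall D i, (i < m D)%N -> e * y D i = y D i;
  dec_yeps : forall D i, (i < m D)%N -> y D i * eps D = y D i;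
  dec_ue : forall D i, (i < m D)%N -> u D i * e = u D i;
  dec_epsu : forall D i, (i < m D)%N -> eps D * u D i = u D i;
  dec_uy : forall D E i j, (i < m D)%N -> (j < m E)%N ->
    u D i * y E j = if (D == E) && (i == j) then eps D else 0;
  dec_sum : \sum_D \sum_(i < m D) y D i * u D i = e }.

Lemma idem_dec0 : idem_dec 0 (fun=> 0%N) (fun _ _ => 0) (fun _ _ => 0).
Proof. by split=> // ; rewrite big1 // => D _; rewrite big_ord0. Qed.

(** Completeness provides a nonzero y in e * A * eps D. Then eps D * star y * e * y is a multiple of
    eps D, nonzero because y * star y * y is nonzero; dividing by the scalar gives u. *)
Lemma idem_split e : e * e = e -> e != 0 -> exists D y u,
  [/\ e * y = y, y * eps D = y, u * e = u, eps D * u = u & u * y = eps D].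
Proof.
move=> ee e0; have [D [w n0]] := ysym_complete e0.
pose y := e * ge w * eps D; exists D, y.
have y0 : y != 0.
  apply: contra_neq n0 => y_0.
  by rewrite ysym_eps -scalerAr -[_ * eps D]/y y_0 scaler0.
have ey : e * y = y by rewrite /y !mulrA ee.
have ye : y * eps D = y by rewrite /y -mulrA epsK.
clearbody y; have [l E] := eps_corner D (star y * e * y).
pose u := eps D * (star y * e).
have uy : u * y = l *: eps D by rewrite -E /u !mulrA -(mulrA _ y (eps D)) ye.
have yuy : y * u * y = y * star y * y by rewrite /u !mulrA ye -(mulrA _ e) ey.
have eu : eps D * u = u by rewrite /u mulrA epsK.
have ue : u * e = u by rewrite /u -!mulrA ee.
clearbody u; have l0 : l != 0.
  apply: contra_neq (mul_star_mul_neq0 y0) => l0.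
  by rewrite -yuy -(mulrA y) uy l0 scale0r mulr0.
exists (l^-1 *: u); split=> //.
- by rewrite -scalerAl ue.
- by rewrite -scalerAr eu.
- by rewrite -scalerAl uy scalerA mulVf // scale1r.
Qed.

Theorem idem_dec_exists e : e * e = e -> exists m y u, idem_dec e m y u.
Proof.
have [n] := ubnP (grank e); elim: n e => // n IHn e en ee.
have [->|e0] := eqVneq e 0; first by do 3 eexists; apply: idem_dec0.
have [D0 [y0 [u0 [ey ye ue eu uy]]]] := idem_split ee e0.
pose f := y0 * u0; have ff : f * f = f.
  by rewrite /f mulrA -(mulrA y0) uy ye.
have ef : e * f = f by rewrite /f mulrA ey.
have fe : f * e = f by rewrite /f -mulrA ue.
have e'e' : (e - f) * (e - f) = e - f.
  by rewrite mulrBl !mulrBr ee ef fe ff subrr subr0.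
have f0 : f != 0.
  apply: contra_neq (@eps_neq0 F N D0) => f0.
  by rewrite -(epsK F D0) -{1}uy -uy mulrA -(mulrA u0) -/f f0 mulr0 mul0r.
have rk : (grank e = grank (e - f)%R + grank f)%N.
  apply/eqP; rewrite -(eqr_nat F) natrD !grankE // -mulrDr -gcoefD subrK.
  exact: eqxx.
have f1 : (0 < grank f)%N by rewrite lt0n; apply: contra_neq f0; apply: grank_eq0.
have [|//|m [y [u dec]]] := IHn (e - f).
  by rewrite rk in en; lia.
have ee' : e * (e - f) = e - f by rewrite mulrBr ee ef.
have e'e : (e - f) * e = e - f by rewrite mulrBl ee fe.
have u0y D i : (i < m D)%N -> u0 * y D i = 0.
  move=> im; rewrite -(dec_ey dec im) mulrA mulrBr ue /f mulrA uy eu subrr.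
  by rewrite mul0r.
have uy0 D i : (i < m D)%N -> u D i * y0 = 0.
  move=> im; rewrite -(dec_ue dec im) -mulrA mulrBl ey /f -mulrA uy ye subrr.
  by rewrite mulr0.
(* The copy split off from e receives the last index among those of shape D0. *)
pose new D i := (D == D0) && (i == m D0).
exists (fun D => (m D + (D == D0))%N), (fun D i => if new D i then y0 else y D i),
  (fun D i => if new D i then u0 else u D i).
have newF D i : (i < m D + (D == D0))%N -> ~~ new D i -> (i < m D)%N.
  by rewrite /new; have [->|] := eqVneq D D0 => /= [|_]; rewrite ?addn0 //; lia.
split=> /= [D i im|D i im|D i im|D i im|D E i j im jm|].
- by case: ifPn => [//|/(newF _ _ im) {}im]; rewrite -(dec_ey dec im) mulrA ee'.
- case: ifPn => [/andP[/eqP -> _] //|/(newF _ _ im) {}im].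
  exact: (dec_yeps dec im).
- by case: ifPn => [//|/(newF _ _ im) {}im]; rewrite -(dec_ue dec im) -mulrA e'e.
- case: ifPn => [/andP[/eqP -> _] //|/(newF _ _ im) {}im].
  exact: (dec_epsu dec im).
- case: ifPn => [/andP[/eqP -> /eqP ->]|ni].
    case: ifPn => [/andP[/eqP -> /eqP ->]|nj]; first by rewrite !eqxx uy.
    rewrite u0y; last exact: newF nj.
    case: ifP => // /andP[/eqP ED /eqP jE]; move: nj.
    by rewrite /new -ED -jE !eqxx.
  have {}im := newF _ _ im ni.
  case: ifPn => [/andP[/eqP -> /eqP ->]|nj].
    rewrite uy0 //; case: ifP => // /andP[/eqP DE /eqP iE]; move: ni.
    by rewrite /new DE iE !eqxx.
  by rewrite (dec_uy dec) //; apply: newF nj.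
- rewrite -[RHS](subrK f) -(dec_sum dec) -[X in _ = _ + X]/(f).
  rewrite (bigD1 D0) //= [X in _ = X + _](bigD1 D0) //= eqxx addn1 big_ord_recr /=.
  rewrite /new !eqxx /= -!addrA; congr (_ + _).
    by apply: eq_bigr => i _; rewrite (ltn_eqF (ltn_ord i)).
  rewrite addrC; congr (_ + _); apply: eq_bigr => D /negbTE DD0.
  by rewrite DD0 addn0.
Qed.

(** By cyclicity each y * u may be replaced by u * y = eps E, whose trace against eps D is 1 or
    0. *)
Lemma idem_dec_mult e m y u D : idem_dec e m y u -> gtr e (eps D) = (m D)%:R.
Proof.
move=> dec; rewrite -(dec_sum dec) gtr_suml (bigD1 D) //= [X in _ + X]big1 ?addr0.
  rewrite gtr_suml (eq_bigr (fun=> 1)) => [|i _]; first by rewrite sumr_const card_ord.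
  by rewrite gtr_mulCl (dec_uy dec) // !eqxx gtr_eps.
move=> E ED; rewrite gtr_suml big1 // => i _.
by rewrite gtr_mulCl (dec_uy dec) // !eqxx gtr_eps_ortho.
Qed.

Lemma idem_dec_conj e m y u : idem_dec e m y u ->
  (forall s : 'S_N, odd_perm s -> gtr e (ge s) = 0) ->
  forall D, m D = m (conj_diagram D).
Proof.
move=> dec e_odd D; apply/eqP; rewrite -(eqr_nat F).
by rewrite -!(idem_dec_mult _ dec) gtr_eps_conj.
Qed.

End Decomposition.

(** * The Dynkin operator on words *)

Lemma subrACA (V : zmodType) (a b c d : V) : a - b - (c - d) = a - c - (b - d).
Proof. by rewrite !opprB [LHS]addrACA [RHS]addrACA (addrC (- b)). Qed.

Section Dynkin.
Variables (X : Type) (V : zmodType).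
Implicit Types (f g : seq X -> V) (w u v s t : seq X) (x y : X).

(** The sum of [f] over the signed words in the expansion of the iterated
    commutator [x1,[x2,...[x(n-1),xn]]] in the free associative algebra. *)
Fixpoint dyn f w : V :=
  match w with
  | [::] => f [::]
  | x :: u => if u is [::] then f [:: x]
              else dyn (fun t => f (x :: t)) u - dyn (fun t => f (rcons t x)) u
  end.

Lemma dynS f x u : (0 < size u)%N ->
  dyn f (x :: u) = dyn (fun t => f (x :: t)) u - dyn (fun t => f (rcons t x)) u.
Proof. by case: u. Qed.

Lemma eq_dyn f g w : (forall u, size u = size w -> f u = g u) -> dyn f w = dyn g w.
Proof.
elim: w f g => [|x [|y u] IHu] f g E; [exact: E|exact: E|].
rewrite (dynS f x) // (dynS g x) //.
rewrite (IHu _ (fun t => g (x :: t))) => [|t tu]; last by rewrite E /= ?tu.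
rewrite (IHu (fun t => f (rcons t x)) (fun t => g (rcons t x))) // => t tu.
by rewrite E // size_rcons tu.
Qed.

Lemma dynB f g w : dyn (fun u => f u - g u) w = dyn f w - dyn g w.
Proof.
elim: w f g => [|x [|y u] IHu] f g //.
rewrite (dynS (fun u => f u - g u) x) // (dynS f x) // (dynS g x) //.
rewrite (IHu (fun t => f _) (fun t => g _)) (IHu (fun t => f _) (fun t => g _)).
exact: subrACA.
Qed.

Lemma dyn0 w : dyn (fun=> 0) w = 0.
Proof. by elim: w => [|x [|y u] IHu] //; rewrite (dynS _ x) // IHu subrr. Qed.

(** Let P and Q be the brackets of w and s. Applying ad letter by letter to the words of P gives ad
    P, because ad is a homomorphism of Lie algebras; the identity says that ad P maps Q to P Q - Q
    P. *)
Lemma dyn_cat f w s : (0 < size w)%N -> (0 < size s)%N ->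
  dyn (fun u => dyn f (u ++ s)) w
  = dyn (fun u => dyn (fun t => f (u ++ t) - f (t ++ u)) s) w.
Proof.
elim: w f s => [//|y [|z v] IHv] f s _ s0.
  rewrite -[LHS]/(dyn f (y :: s)) dynS // -dynB.
  by apply: eq_dyn => t _; rewrite cats1.
set vz := z :: v in IHv *; have vz0 : (0 < size vz)%N by [].
rewrite !(dynS _ _ vz0).
transitivity (dyn (fun u => dyn (fun t => f (y :: u ++ t) - f (y :: t ++ u)) s
                            - dyn (fun t => f (rcons (u ++ t) y) - f (rcons (t ++ u) y)) s) vz
              - dyn (fun u => dyn (fun t => f (u ++ t) - f (t ++ u)) (y :: s)) vz).
  congr (_ - _).
    rewrite dynB -(IHv (fun t => f (y :: t))) // -(IHv (fun t => f (rcons t y))) // -dynB.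
    by apply: eq_dyn => u _; rewrite [LHS]dynS // size_cat ltn_addl.
  by rewrite -IHv //; apply: eq_dyn => u _; rewrite cat_rcons.
rewrite -!dynB; apply: eq_dyn => u _; rewrite !dynS // -!dynB; apply: eq_dyn => t _.
rewrite !cat_rcons -!rcons_cat /=.
set a := f _; set b := f _; set c := f _; set d := f _; set e := f _; set g := f _.
by rewrite subrACA (subrACA a) subrr subr0 (subrACA c) subrr sub0r opprB subrACA.
Qed.

(** The Dynkin-Specht-Wever identity. The terms with y in front give size w - 1 copies by induction;
    those with y appended give one more, since [P, y] = - [y, P]. *)
Lemma dyn_dyn f w : (0 < size w)%N -> dyn (dyn f) w = dyn f w *+ size w.
Proof.
elim: w f => [//|y [|z v] IHv] f _; first by rewrite mulr1n.
set vz := z :: v in IHv *; have vz0 : (0 < size vz)%N by [].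
rewrite (dynS _ _ vz0) -[size (y :: vz)]/(size vz).+1 mulrSr.
have -> : dyn (fun t => dyn f (rcons t y)) vz = - dyn f (y :: vz).
  transitivity (dyn (fun t => dyn f (t ++ [:: y])) vz).
    by apply: eq_dyn => t _; rewrite cats1.
  rewrite dyn_cat // (dynS _ _ vz0) opprB -dynB; apply: eq_dyn => u _ /=.
  by rewrite cats1.
rewrite opprK; congr (_ + _).
transitivity (dyn (fun u => dyn (fun t => f (y :: t)) u - dyn (fun t => f (rcons t y)) u) vz).
  by apply: eq_dyn => u uv; rewrite dynS // uv.
by rewrite dynB !IHv // -mulrnBl -dynS.
Qed.

(** The sum of [G a b] over the splittings of [w] into a subword [a] and the
    reversal [b] of the complementary subword. *)
Fixpoint spl (G : seq X -> seq X -> V) w : V :=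
  if w is y :: v then spl (fun a b => G (y :: a) b) v + spl (fun a b => G a (rcons b y)) v
  else G [::] [::].

Lemma eq_spl G H w : (forall a b, (size a + size b)%N = size w -> G a b = H a b) ->
  spl G w = spl H w.
Proof.
elim: w G H => [|y v IHv] G H E; first exact: E.
by congr (_ + _); apply: IHv => a b ab; apply: E; rewrite /= -?ab ?size_rcons ?addnS.
Qed.

Lemma spl_rcons G w y : spl G (rcons w y)
  = spl (fun a b => G (rcons a y) b) w + spl (fun a b => G a (y :: b)) w.
Proof. by elim: w G => [|z v IHv] G //=; rewrite !IHv addrACA. Qed.

Lemma splD G H w : spl (fun a b => G a b + H a b) w = spl G w + spl H w.
Proof.
elim: w G H => [|z v IHv] G H //=.
by rewrite (IHv (fun a b => G _ _)) (IHv (fun a b => G _ _)) addrACA.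
Qed.

Lemma splN G w : spl (fun a b => - G a b) w = - spl G w.
Proof.
by elim: w G => [|z v IHv] G //=; rewrite (IHv (fun a b => G _ _)) (IHv (fun a b => G _ _)) opprD.
Qed.

(** The innermost letter x is a pivot. Working outwards, each letter goes to the far left, or to the
    far right with a minus sign, so those on the right end up in reverse order. *)
Lemma dyn_spl f v x : dyn f (rcons v x)
  = spl (fun a b => if odd (size b) then - f (a ++ x :: b) else f (a ++ x :: b)) v.
Proof.
elim: v f => [//|y v IHv] f; rewrite [rcons _ _]/= dynS ?size_rcons // !IHv /= -splN.
congr (_ + _); apply: eq_spl => a b _; rewrite size_rcons /=.
by rewrite rcons_cat /=; case: odd; rewrite ?opprK.
Qed.

End Dynkin.

(** * Permutations acting on words *)

Section Words.
Variable N : nat.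

Definition word (X : Type) (h : 'I_N -> X) : seq X := [seq h i | i <- enum 'I_N].

Lemma size_word X (h : 'I_N -> X) : size (word h) = N.
Proof. by rewrite size_map size_enum_ord. Qed.

Lemma eq_word X (h h' : 'I_N -> X) : h =1 h' -> word h = word h'.
Proof. by move=> E; apply: eq_map. Qed.

Lemma map_word X Y (f : X -> Y) (h : 'I_N -> X) : map f (word h) = word (f \o h).
Proof. by rewrite /word -map_comp. Qed.

Lemma nth_word X (x0 : X) (h : 'I_N -> X) (i : 'I_N) : nth x0 (word h) i = h i.
Proof. by rewrite (nth_map i) ?size_enum_ord // nth_ord_enum. Qed.

Lemma word_perm_inj (p q : 'S_N) : word p = word q -> p = q.
Proof.
by move=> E; apply/permP => i; rewrite -(nth_word i p) E nth_word.
Qed.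

Definition seqperm (s : seq 'I_N) : 'S_N :=
  odflt 1%g [pick p : 'S_N | word p == s].

Lemma word_seqperm (s : seq 'I_N) : perm_eq s (enum 'I_N) -> word (seqperm s) = s.
Proof.
move=> sE; rewrite /seqperm; case: pickP => [p /eqP //|/=] noP.
have us : uniq s by rewrite (perm_uniq sE) enum_uniq.
have ss : size s = N by rewrite (perm_size sE) size_enum_ord.
have inj : injective (fun i : 'I_N => nth i s i).
  move=> i j; rewrite (set_nth_default j) ?ss // => /eqP.
  by rewrite nth_uniq ?ss // => /eqP/val_inj.
have /eqP[] := negbT (noP (perm inj)).
case: s ss {sE noP us} inj => [s0|x0 s ss] inj; first by apply: size0nil; rewrite size_word.
apply: (@eq_from_nth _ x0) => [|i]; rewrite size_word // => iN.
rewrite (nth_word x0 _ (Ordinal iN)) permE /=.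
by apply: set_nth_default; rewrite ss.
Qed.

Section Evaluation.
Variables (F : fieldType) (X : Type) (V : lmodType F).
Local Notation A := (galg F 'S_N).
Implicit Types (f g : seq X -> V) (h : 'I_N -> X) (a b : A).

(** As (p * q) i = q (p i), a right factor rearranges the letters of [h] first and a left factor
    acts next to [f]. Thus operators on functions of words are left factors, and Schur functors come
    from right ideals. *)
Definition ev f h a : V := \sum_(p : 'S_N) gcoef a p *: f (word (h \o p)).

Lemma ev_linear f h : linear (ev f h).
Proof.
move=> k a b; rewrite /ev scaler_sumr -big_split; apply: eq_bigr => p _ /=.
by rewrite gcoefD gcoefZ scalerDl scalerA.
Qed.
HB.instance Definition _ f h :=
  GRing.isLinear.Build F A V _ (ev f h) (ev_linear f h).

Lemma ev_ge f h p : ev f h (ge F p) = f (word (h \o p)).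
Proof.
rewrite /ev (bigD1 p) //= big1 ?addr0 => [|q qp].
  by rewrite gcoef_ge eqxx scale1r.
by rewrite gcoef_ge (negbTE qp) scale0r.
Qed.

Lemma ev1 f h : ev f h 1 = f (word h).
Proof.
rewrite -ge1 ev_ge; congr f; apply: eq_word => i /=.
by rewrite perm1.
Qed.

Lemma eq_ev f g h a : (forall p : 'S_N, f (word (h \o p)) = g (word (h \o p))) ->
  ev f h a = ev g h a.
Proof. by move=> E; apply: eq_bigr => p _; rewrite E. Qed.

Lemma evZ k f h a : ev (fun w => k *: f w) h a = k *: ev f h a.
Proof.
by rewrite /ev scaler_sumr; apply: eq_bigr => p _; rewrite !scalerA mulrC.
Qed.

Lemma ev_mul_ge f h a q : ev f h (a * ge F q) = ev f (h \o q) a.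
Proof.
rewrite /ev (reindex_inj (mulIg q)) /=; apply: eq_bigr => p _.
rewrite gcoefMg mulgK; congr (_ *: f _); apply: eq_word => i /=.
by rewrite permM.
Qed.

Lemma ev_mul f g h a b : (forall h', ev f h' a = g (word h')) ->
  ev f h (a * b) = ev g h b.
Proof.
move=> E; rewrite [in LHS](gsumE b) mulr_sumr linear_sum; apply: eq_bigr => q _.
by rewrite -scalerAr linearZ /= ev_mul_ge E.
Qed.

End Evaluation.

Lemma perm_word (p : 'S_N) : perm_eq (word p) (enum 'I_N).
Proof.
apply: uniq_perm; last 1 first.
- move=> i; rewrite mem_enum; apply/mapP.
  by exists ((p^-1)%g i); rewrite ?mem_enum ?permKV.
- by rewrite map_inj_uniq; [apply: enum_uniq | apply: perm_inj].
- exact: enum_uniq.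
Qed.

Lemma galg_evE (F : fieldType) (a : galg F 'S_N) :
  ev (fun w => ge F (seqperm w)) id a = a.
Proof.
rewrite [RHS]gsumE; apply: eq_bigr => p _; congr (_ *: ge F _).
apply: word_perm_inj; rewrite word_seqperm; first exact: eq_word.
exact: perm_word.
Qed.

(** The distinct letters of [id] separate all permutations, so identities in the group algebra may
    be checked on words. *)
Lemma galg_ev_inj (F : fieldType) (a b : galg F 'S_N) :
  (forall f : seq 'I_N -> galg F 'S_N, ev f id a = ev f id b) -> a = b.
Proof. by move=> E; rewrite -(galg_evE a) E galg_evE. Qed.

Definition wrot (X : Type) j m k (w : seq X) :=
  take m w ++ rot j (take k (drop m w)) ++ drop (m + k) w.

Lemma wrot_cat (X : Type) j (p u t : seq X) m k : size p = m -> size u = k ->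
  wrot j m k (p ++ u ++ t) = p ++ rot j u ++ t.
Proof.
move=> <- <-; rewrite /wrot take_size_cat // drop_size_cat // take_size_cat //.
by congr (_ ++ (_ ++ _)); rewrite catA -size_cat drop_size_cat.
Qed.

Lemma word_split (X : Type) (h : 'I_N -> X) m k : (m + k <= N)%N ->
  exists p u t, [/\ word h = p ++ u ++ t, size p = m & size u = k].
Proof.
move=> le; exists (take m (word h)), (take k (drop m (word h))), (drop k (drop m (word h))).
split; first by rewrite !cat_take_drop.
  by rewrite size_takel // size_word; lia.
by rewrite size_takel // size_drop size_word; lia.
Qed.

Definition cyc m k : 'S_N := seqperm (wrot 1 m k (enum 'I_N)).

Lemma map_wrot (X Y : Type) (f : X -> Y) j m k w :
  map f (wrot j m k w) = wrot j m k (map f w).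
Proof. by rewrite /wrot /rot !(map_cat, map_take, map_drop). Qed.

Lemma perm_wrot (X : eqType) j m k (w : seq X) : perm_eq (wrot j m k w) w.
Proof.
rewrite /wrot -[X in perm_eq _ X](cat_take_drop m) perm_cat2l.
rewrite -[X in perm_eq _ X](cat_take_drop k) drop_drop (addnC k).
by rewrite perm_cat2r perm_rot.
Qed.

Lemma word_comp_seqperm (X : Type) (h : 'I_N -> X) s : perm_eq s (enum 'I_N) ->
  word (h \o seqperm s) = map h s.
Proof. by move=> sE; rewrite -[in RHS](word_seqperm sE) map_word. Qed.

Lemma word_cyc (X : Type) (h : 'I_N -> X) m k : word (h \o cyc m k) = wrot 1 m k (word h).
Proof. by rewrite word_comp_seqperm ?perm_wrot // map_wrot. Qed.

Lemma word_cycX (X : Type) (h : 'I_N -> X) m k j : (m + k <= N)%N -> (j <= k)%N ->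
  word (h \o (cyc m k ^+ j)%g) = wrot j m k (word h).
Proof.
move=> mk; elim: j h => [|j IHj] h jk.
  have [p [u [t [E pm uk]]]] := word_split h mk.
  rewrite expg0 E wrot_cat // rot0 -E; apply: eq_word => i /=.
  by rewrite perm1.
have -> : word (h \o (cyc m k ^+ j.+1)%g) = word ((h \o cyc m k) \o (cyc m k ^+ j)%g).
  by apply: eq_word => i; rewrite expgSr /= permM.
rewrite IHj 1?ltnW // word_cyc; have [p [u [t [-> pm uk]]]] := word_split h mk.
rewrite !wrot_cat ?size_rot //; congr (_ ++ _ ++ _).
by rewrite -rotD ?addn1 ?uk.
Qed.

Lemma cycX_order m k : (m + k <= N)%N -> (cyc m k ^+ k = 1)%g.
Proof.
move=> mk; apply: word_perm_inj; rewrite -[LHS]/(word (id \o (cyc m k ^+ k)%g)).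
rewrite word_cycX //; have [p [u [t [E pm uk]]]] := word_split id mk.
rewrite E wrot_cat // -uk rot_size -E; apply: eq_word => i.
by rewrite perm1.
Qed.

End Words.

(** * Dynkin elements and the theorem of Klyachko *)

Lemma eq_dyn_perm (X : eqType) (V : zmodType) (f g : seq X -> V) w :
  (forall u, perm_eq u w -> f u = g u) -> dyn f w = dyn g w.
Proof.
elim: w f g => [|x [|y u] IHu] f g E; [exact: E|exact: E|].
rewrite (dynS f) // (dynS g) // (IHu _ (fun t => g (x :: t))) => [|t tu].
  rewrite (IHu (fun t => f (rcons t x)) (fun t => g (rcons t x))) // => t tu.
  by rewrite E // perm_rcons perm_cons.
by rewrite E // perm_cons.
Qed.

Lemma dyn_delta (X : eqType) (F : fieldType) (u : seq X) : uniq u -> (0 < size u)%N ->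
  dyn (fun t => (t == u)%:R : F) u = 1.
Proof.
elim: u => [//|y [|z v] IHv]; first by rewrite /= eqxx.
move=> /andP[yv uv] _; rewrite dynS // -[RHS]subr0; congr (_ - _).
  by rewrite -[RHS](IHv uv isT); apply: eq_dyn => t _; rewrite eqseq_cons eqxx.
rewrite -[RHS](dyn0 _ (z :: v)); apply: eq_dyn_perm => t tv.
case: eqP => // E; suff : y \in z :: v by rewrite (negbTE yv).
rewrite -(perm_mem tv); case: t E {tv} => [//|a t] [-> _].
by rewrite mem_head.
Qed.

Lemma geX (F : fieldType) (gT : finGroupType) (g : gT) n :
  ge F (g ^+ n)%g = ge F g ^+ n.
Proof. by elim: n => [|n IHn]; rewrite ?expg0 // expgS geM IHn exprS. Qed.

Lemma gcoef1_mulC (F : fieldType) (gT : finGroupType) (a b : galg F gT) :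
  gcoef (a * b) 1%g = gcoef (b * a) 1%g.
Proof.
rewrite !gcoefM (reindex_inj invg_inj) /=; apply: eq_bigr => g _.
by rewrite !mulg1 invgK mulrC.
Qed.

Lemma odd_permX (T : finType) (s : {perm T}) n :
  odd_perm (s ^+ n)%g = odd n && odd_perm s.
Proof.
elim: n => [|n IHn]; first by rewrite expg0 odd_perm1.
by rewrite expgS odd_permM IHn /=; case: (odd_perm s); case: (odd n).
Qed.

Lemma gtr_ge_parity (F : fieldType) (T : finType) (s t : {perm T}) :
  odd_perm s != odd_perm t -> gtr (ge F s) (ge F t) = 0.
Proof.
move=> st; rewrite gtr_ge big1 // => x _; rewrite gcoef_ge; case: eqP => // E.
by case/eqP: st; rewrite -E !odd_permM !odd_permV addbAC addbb.
Qed.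

Lemma word_surj N (X : Type) (w : seq X) : size w = N ->
  exists h : 'I_N -> X, word h = w.
Proof.
case: w => [|x0 w] wN.
  have h (i : 'I_N) : X by move: (ltn_ord i); rewrite -[X in (_ < X)%N]wN.
  by exists h; apply: size0nil; rewrite size_word -wN.
exists (fun i : 'I_N => nth x0 (x0 :: w) i); apply: (@eq_from_nth _ x0).
  by rewrite size_word.
by move=> i; rewrite size_word => iN; rewrite (nth_word x0 _ (Ordinal iN)).
Qed.

(** * Dynkin elements of the group algebra *)

Section Theta.
Variables (F : fieldType) (N : nat).
Local Notation A := (galg F 'S_N).
Local Notation ge := (@ge F _ : 'S_N -> A).

(** The Dynkin element acting on the last [b.+1] places. *)
Fixpoint theta b : A :=
  if b is b'.+1 then (1 - ge (cyc N (N - b.+1) b.+1)) * theta b' else 1.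

Section EvTheta.
Variables (X : Type) (V : lmodType F).
Implicit Types (f : seq X -> V) (h : 'I_N -> X).

Lemma ev_theta f h b p u : word h = p ++ u -> size u = b.+1 ->
  ev f h (theta b) = dyn (fun t => f (p ++ t)) u.
Proof.
elim: b f p u => [|b IHb] f p u hE ub.
  by case: u ub hE => [|x []] // _ hE; rewrite ev1 hE.
case: u ub hE => [//|y u] [ub] hE; rewrite dynS ?ub // [theta _]/=.
have NE : N = (size p + b.+2)%N by rewrite -(size_word h) hE size_cat /= ub.
have hE' : word h = rcons p y ++ u by rewrite cat_rcons.
rewrite mulrBl mul1r linearB /= (IHb _ _ _ hE' ub); congr (_ - _).
  by apply: eq_dyn => t _; rewrite cat_rcons.
have E h' : ev f h' (ge (cyc N (N - b.+2) b.+2))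
    = (f \o wrot 1 (N - b.+2) b.+2) (word h').
  by rewrite ev_ge word_cyc.
rewrite (ev_mul _ _ E) (IHb _ _ _ hE' ub); apply: eq_dyn => t tu /=.
rewrite cat_rcons -[in LHS](cats0 (y :: t)) wrot_cat ?cats0.
- by rewrite rot1_cons.
- by rewrite {1}NE addnK.
- by rewrite /= tu ub.
Qed.

Definition dynw b f w := dyn (fun t => f (take (N - b.+1) w ++ t)) (drop (N - b.+1) w).

Lemma ev_theta_mul f h b a : (b < N)%N -> ev f h (theta b * a) = ev (dynw b f) h a.
Proof.
move=> bN; apply: ev_mul => h'.
apply: ev_theta; rewrite ?cat_take_drop // size_drop size_word; lia.
Qed.

End EvTheta.

Lemma theta_sqr b : (b < N)%N -> theta b * theta b = b.+1%:R *: theta b.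
Proof.
move=> bN; apply: galg_ev_inj => f; rewrite ev_theta_mul // linearZ /=.
have [p [u [t [hE ps us]]]] : exists p u t,
    [/\ word (id : 'I_N -> _) = p ++ u ++ t, size p = N - b.+1 & size u = b.+1]%N.
  by apply: word_split; lia.
have tE : t = [::].
  by apply/size0nil; have := size_word (id : 'I_N -> _); rewrite hE !size_cat; lia.
rewrite tE cats0 in hE; rewrite !(ev_theta _ hE us) scaler_nat -us -dyn_dyn ?us //.
apply: eq_dyn => v _; rewrite /dynw -ps take_size_cat // drop_size_cat //.
Qed.

Lemma theta_mul_pred b : (b.+1 < N)%N ->
  theta b.+1 * theta b = b.+1%:R *: theta b.+1.
Proof. by move=> bN; rewrite -mulrA theta_sqr 1?ltnW // scalerAr. Qed.

Lemma theta_coef1 b : (b < N)%N -> gcoef (theta b) 1%g = 1.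
Proof.
move=> bN; have -> : gcoef (theta b) 1%g
    = ev (fun w => (w == enum 'I_N)%:R : F^o) id (theta b).
  rewrite /ev (bigD1 1%g) //= big1 ?addr0 => [|s s1].
    rewrite (_ : word _ = enum 'I_N) ?eqxx; first by rewrite /GRing.scale /= mulr1.
    by rewrite -[RHS]map_id; apply: eq_word => i /=; rewrite perm1.
  case: eqP => [E|]; last by rewrite scaler0.
  case/eqP: s1; apply: word_perm_inj; rewrite -[LHS]/(word (id \o s)) E -[LHS]map_id.
  by apply: eq_word => i; rewrite perm1.
have [p [u [t [hE ps us]]]] : exists p u t,
    [/\ word (id : 'I_N -> _) = p ++ u ++ t, size p = N - b.+1 & size u = b.+1]%N.
  by apply: word_split; lia.
have tE : t = [::].
  by apply/size0nil; have := size_word (id : 'I_N -> _); rewrite hE !size_cat; lia.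
rewrite tE cats0 in hE; rewrite (ev_theta _ hE us).
have eE : enum 'I_N = p ++ u by rewrite -hE /word map_id.
rewrite -[RHS](@dyn_delta _ F u) ?us //; last first.
  by have := enum_uniq 'I_N; rewrite eE cat_uniq => /and3P[].
by apply: eq_dyn => v _; rewrite eE eqseq_cat // eqxx.
Qed.

End Theta.

(** * Comparison with characters of a cyclic group *)

Section Klyachko.
Variables (F : numFieldType) (N b : nat) (w : F).
Hypotheses (bN : (b < N)%N) (w1 : w ^+ b.+1 = 1).
Hypothesis w_prim : forall i, (0 < i <= b)%N -> w ^+ i != 1.
Local Notation A := (galg F 'S_N).
Local Notation ge := (@ge F _ : 'S_N -> A).
Local Notation n := b.+1.
Local Notation m := (N - n)%N.
Local Notation c := (cyc N m n).

Let mnN : (m + n <= N)%N. Proof. by rewrite subnK. Qed.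
Let w0 : w != 0.
Proof. by apply: contra_eq_neq w1 => ->; rewrite expr0n eq_sym oner_eq0. Qed.

(** [n] times the idempotent of the character [c |-> w] of the cyclic group. *)
Definition cycsum : A := \sum_(i < n) w^-1 ^+ i *: ge (c ^+ i)%g.

Lemma cycsum_cyc : cycsum * ge c = w *: cycsum.
Proof.
rewrite /cycsum mulr_suml scaler_sumr big_ord_recr big_ord_recl /= addrC.
congr (_ + _).
  rewrite expr0 scale1r expg0 ge1 -scalerAl -geM -expgSr cycX_order // ge1.
  congr (_ *: _); apply: (mulfI (expf_neq0 b w0)).
  by rewrite exprVn mulfV ?expf_neq0 // -exprSr w1.
apply: eq_bigr => i _; rewrite -scalerAl -geM -expgSr scalerA exprS mulrA.
by rewrite mulfV // mul1r.
Qed.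

Lemma cycsum_cycX j : cycsum * ge (c ^+ j)%g = w ^+ j *: cycsum.
Proof.
elim: j => [|j IHj]; first by rewrite expg0 ge1 mulr1 scale1r.
by rewrite expgSr geM mulrA IHj -scalerAl cycsum_cyc scalerA exprSr.
Qed.

Lemma cycsum_sqr : cycsum * cycsum = n%:R *: cycsum.
Proof.
rewrite {2}/cycsum mulr_sumr (eq_bigr (fun=> cycsum)) => [|i _].
  by rewrite sumr_const card_ord scaler_nat.
by rewrite -scalerAr cycsum_cycX scalerA exprVn mulVf ?scale1r ?expf_neq0.
Qed.

Lemma cycX_neq1 i : (0 < i < n)%N -> (c ^+ i)%g != 1%g.
Proof.
move=> /andP[i0 iN]; apply/eqP => E.
have [p [u [t [hE ps us]]]] := word_split (id : 'I_N -> _) mnN.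
have : word (id \o (c ^+ i)%g) = word (id : 'I_N -> _).
  by rewrite E; apply: eq_word => j /=; rewrite perm1.
rewrite word_cycX // 1?ltnW // hE wrot_cat // => /eqP.
rewrite eqseq_cat // eqxx eqseq_cat ?size_rot // eqxx andbT /= => /eqP rot_u.
have uu : uniq u.
  have := enum_uniq 'I_N; rewrite -[enum _]map_id -/(word id) hE !cat_uniq.
  by case/and3P => _ _ /and3P[].
case: u us rot_u uu {hE} => [//|x u] us rot_u uu.
have := congr1 (nth x ^~ 0%N) rot_u; rewrite /rot nth_cat size_drop us.
rewrite subn_gt0 iN nth_drop addn0 => /eqP.
by rewrite -[X in _ == X]/(nth x (x :: u) 0) nth_uniq ?us // gtn_eqF.
Qed.

Lemma cycsum_coef1 : gcoef cycsum 1%g = 1.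
Proof.
rewrite gcoef_sum big_ord_recl big1 ?addr0 => [|i _].
  by rewrite gcoefZ expg0 gcoef_ge eqxx expr0 mulr1.
rewrite gcoefZ gcoef_ge eq_sym (negbTE (cycX_neq1 _)) ?mulr0 //=.
by rewrite /bump /= ltnS; have := ltn_ord i.
Qed.

(** The cycle here rotates the first k places of the block. A factor keeps the k-th letter or brings
    it to the front with coefficient -w: up to rotation, these are the two choices in the expansion
    of a bracket. *)
Fixpoint rprod k : A :=
  if k is k'.+1 then (1 - w *: ge (cyc N m k)^-1%g) * rprod k' else 1.

Lemma ev_rprod (X : Type) (V : lmodType F) (f : seq X -> V) h k p v t :
  (k <= n)%N -> word h = p ++ v ++ t -> size p = m -> size v = k ->
  ev f h (rprod k) = spl (fun a b => (- w) ^+ size b *: f (p ++ b ++ a ++ t)) v.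
Proof.
elim: k f v t => [|k IHk] f v t kn hE pm vk.
  by case: v vk hE => // _ hE; rewrite ev1 hE /= scale1r.
case/lastP: v vk hE => [//|v y]; rewrite size_rcons => -[vk]; rewrite cat_rcons => hE.
have mk : (m + k.+1 <= N)%N by rewrite (leq_trans _ mnN) ?leq_add2l.
have cV : (cyc N m k.+1)^-1%g = (cyc N m k.+1 ^+ k)%g.
  by apply/eqP; rewrite eq_mulVg1 invgK -expgS cycX_order.
pose g u := f u - w *: f (wrot k m k.+1 u).
transitivity (ev g h (rprod k)).
  apply: (@ev_mul _ _ _ _ f g) => h'.
  by rewrite linearB linearZ /= ev1 ev_ge cV word_cycX.
rewrite (IHk _ v (y :: t)) ?(ltnW kn) // spl_rcons -splD.
apply: eq_spl => a d ad; rewrite /g scalerBr cat_rcons; congr (_ + _).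
have -> : p ++ d ++ a ++ y :: t = p ++ ((d ++ a) ++ [:: y]) ++ t.
  by rewrite -!catA.
rewrite wrot_cat //; last by rewrite !size_cat addn1 addnC ad vk.
have -> : k = size (d ++ a) by rewrite size_cat addnC ad vk.
rewrite rot_size_cat /= -catA scalerA -scaleNr -mulrN mulrC.
by rewrite -exprS.
Qed.

(** After multiplication by [cycsum], rotating a word by j costs w^j. Rotating the pivot of
    [dyn_spl] to the end therefore turns the sign (-1)^|b| into (-w)^|b|, as in [ev_rprod]. *)
Lemma cycsum_theta : cycsum * theta F N b = cycsum * rprod b.
Proof.
apply: galg_ev_inj => f.
pose f' u := \sum_(i < n) w^-1 ^+ i *: f (wrot i m n u).
have f'E (h : 'I_N -> 'I_N) : ev f h cycsum = f' (word h).
  rewrite /cycsum linear_sum; apply: eq_bigr => i _.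
  by rewrite linearZ /= ev_ge word_cycX // ltnW.
have f'_rot p (u : seq 'I_N) j : size p = m -> size u = n -> (j <= n)%N ->
    f' (p ++ rot j u) = w ^+ j *: f' (p ++ u).
  move=> pm un jn; have [h hE] : exists h : 'I_N -> 'I_N, word h = p ++ u.
    by apply: word_surj; rewrite size_cat pm un subnK.
  rewrite -hE -f'E; transitivity (ev f h (cycsum * ge (c ^+ j)%g)); last first.
    by rewrite cycsum_cycX linearZ.
  rewrite ev_mul_ge f'E word_cycX // hE.
  by rewrite -[u in RHS](cats0 u) wrot_cat ?cats0.
have [p [u [t [hE ps us]]]] := word_split (id : 'I_N -> _) mnN.
have tE : t = [::].
  by apply/size0nil; have := size_word (id : 'I_N -> _); rewrite hE !size_cat ps us; lia.
rewrite tE cats0 in hE; case/lastP: u us hE => [us0|v x]; first by discriminate us0.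
rewrite size_rcons => -[vb] hE.
rewrite !(@ev_mul _ _ _ _ f f' id _ _ f'E) (ev_theta _ hE) ?size_rcons ?vb // dyn_spl.
rewrite (@ev_rprod _ _ f' _ b p v [:: x]) ?cats1 ?hE //.
apply: eq_spl => a d ad.
have -> : a ++ x :: d = rot (size d) (d ++ a ++ [:: x]).
  by rewrite rot_size_cat -catA.
rewrite f'_rot //; last by rewrite -vb -ad leqW // leq_addl.
  rewrite -[RHS](_ : (-1) ^+ odd (size d) *: (w ^+ size d *: f' (p ++ d ++ a ++ [:: x])) = _).
    by case: odd; rewrite ?scale1r // expr1 scaleN1r.
  by rewrite scalerA signr_odd -exprNn.
by rewrite !size_cat addn1 addnS addnC ad vb.
Qed.

(** In the factor 1 - x for the first k + 1 places, x^(k+1) is the scalar w^(k+1), which differs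
    from 1; a geometric sum then inverts the factor. *)
Lemma rprod_unit k : (k <= b)%N -> exists W, rprod k * W = 1.
Proof.
elim: k => [|k IHk] kb; first by exists 1; rewrite mulr1.
have [W E] := IHk (ltnW kb).
pose x := w *: ge (cyc N m k.+1)^-1%g.
have xk : x ^+ k.+1 = w ^+ k.+1 *: 1.
  rewrite exprZn -geX expgVn cycX_order ?invg1 //.
  by apply: leq_trans mnN; rewrite leq_add2l leqW.
pose S := \sum_(i < k.+1) x ^+ i.
have xS : (1 - x) * S = (1 - w ^+ k.+1) *: 1.
  by rewrite -opprB mulNr -subrX1 xk opprB scalerBl scale1r.
exists (W * ((1 - w ^+ k.+1)^-1 *: S)).
rewrite [rprod _]/= -mulrA (mulrA (rprod k)) E mul1r -scalerAr xS scalerA mulVf ?scale1r //.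
by rewrite subr_eq0 eq_sym w_prim.
Qed.

Lemma gtr_theta_cycsum x : gtr (theta F N b) x = gtr cycsum x.
Proof.
have n0 : n%:R != 0 :> F by rewrite pnatr_eq0.
have [W E] := rprod_unit (leqnn b).
have [t tE] : exists t, t = theta F N b by exists (theta F N b).
have [C CE] : exists C, C = cycsum by exists cycsum.
have [e eE] : exists e, e = n%:R^-1 *: t by exists (n%:R^-1 *: t).
have [ep epE] : exists ep, ep = n%:R^-1 *: C by exists (n%:R^-1 *: C).
have ee : e * e = e.
  rewrite eE -scalerAl -scalerAr tE theta_sqr // !scalerA -mulrA mulVf ?mulr1 //.
have epep : ep * ep = ep.
  by rewrite epE -scalerAl -scalerAr CE cycsum_sqr !scalerA -mulrA mulVf ?mulr1.
have epeW : ep * e * (n%:R *: W) = ep.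
  rewrite epE eE -!scalerAr -!scalerAl CE tE cycsum_theta -(mulrA cycsum) E mulr1.
  by rewrite !scalerA mulVKf.
have ce1 : gcoef e 1%g = gcoef ep 1%g.
  by rewrite eE epE !gcoefZ tE theta_coef1 // CE cycsum_coef1.
have [al alE] : exists al, al = e * (n%:R *: W) * ep by eexists.
have [be beE] : exists be, be = ep * e by eexists.
have ba : be * al = ep by rewrite alE beE !mulrA -(mulrA ep e e) ee epeW epep.
have eal : e * al = al by rewrite alE !mulrA ee.
have bee : be * e = be by rewrite beE -mulrA ee.
have epbe : ep * be = be by rewrite beE mulrA epep.
have idm : (al * be) * (al * be) = al * be.
  by rewrite mulrA -(mulrA al) ba -mulrA epbe.
(* The idempotent al * be lies under e and has the same coefficient at 1 as be * al = ep, hence as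
   e. The difference is an idempotent of trace zero. *)
have ab : e = al * be.
  apply/eqP; rewrite -subr_eq0; apply/eqP/idem_coef1_eq0.
    by rewrite mulrBl !mulrBr ee idm mulrA eal -mulrA bee subrr subr0.
  by rewrite gcoefB (gcoef1_mulC al) ba ce1 subrr.
have : gtr e x = gtr ep x by rewrite ab gtr_mulCl ba.
rewrite eE epE !gtrZl tE CE => /mulfI; apply.
by rewrite invr_eq0.
Qed.

End Klyachko.

(** A cycle of odd length has only even powers. Otherwise only odd powers of c can meet an odd s,
    and passing from w to -w negates their coefficients, so the trace equals its own negative. *)
Lemma gtr_cycsum_odd (F : numFieldType) N b (w w' : F) s : (b < N)%N ->
    (forall x, gtr (cycsum N b w) x = gtr (cycsum N b w') x) ->
    (odd b.+1 \/ w' = - w) -> odd_perm s -> gtr (cycsum N b w) (ge F s) = 0.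
Proof.
move=> bN E ww' s_odd; set c := cyc N (N - b.+1) b.+1.
have c_even i : odd b.+1 || ~~ odd i -> gtr (ge F (c ^+ i)%g) (ge F s) = 0.
  move=> ob; apply: gtr_ge_parity; rewrite s_odd odd_permX.
  case/orP: ob => [ob|/negbTE-> //].
  have := odd_permX c b.+1; rewrite cycX_order ?subnK // odd_perm1 ob /= => <-.
  by rewrite andbF.
have trE z : gtr (cycsum N b z) (ge F s)
    = \sum_(i < b.+1) z^-1 ^+ i * gtr (ge F (c ^+ i)%g) (ge F s).
  by rewrite gtr_suml; apply: eq_bigr => i _; rewrite gtrZl.
case: ww' => [ob|wE]; first by rewrite trE big1 // => i _; rewrite c_even ?ob ?mulr0.
apply/eqP; rewrite -[_ == 0]orFb -[false](pnatr_eq0 F 2) -mulf_eq0 mulr_natl mulr2n.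
rewrite {2}E !trE wE -big_split big1 //= => i _.
case: (boolP (odd i)) => oi; last by rewrite c_even ?oi ?orbT // !mulr0 addr0.
by rewrite invrN exprNn -signr_odd oi expr1 mulN1r mulNr subrr.
Qed.

Lemma ratr_theta (F : numFieldType) N b g :
  gcoef (theta F N b) g = ratr (gcoef (theta rat N b) g).
Proof.
elim: b g => [|b IHb] g.
  have E (K : fieldType) : gcoef (theta K N 0) g = (g == 1%g)%:R by apply: gcoef_ge.
  by rewrite !E ratr_nat.
by rewrite /= !mulrBl !mul1r !gcoefB !gcoefgM !IHb rmorphB.
Qed.

Theorem theta_odd N b (s : 'S_N) : (b < N)%N -> (b.+1 %% 4)%N != 2%N ->
  odd_perm s -> gtr (theta rat N b) (ge rat s) = 0.
Proof.
move=> bN b4 s_odd; apply: (fmorph_inj (@ratr algC)); rewrite rmorph0.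
transitivity (gtr (theta algC N b) (ge algC s)).
  rewrite !gtr_ge rmorph_sum; apply: eq_bigr => x _ /=.
  exact/esym/ratr_theta.
have [w w_prim] := C_prim_root_exists (ltn0Sn b).
have prim i : (0 < i <= b)%N -> w ^+ i != 1.
  move=> /andP[i0 ib]; rewrite -(prim_order_dvd w_prim).
  by rewrite gtnNdvd // ltnS.
have w1 := prim_expr_order w_prim.
rewrite (gtr_theta_cycsum bN w1 prim).
case: (boolP (odd b.+1)) => [ob|eb].
  by apply: (@gtr_cycsum_odd _ _ _ w w) => //; left.
have b4' : (4 %| b.+1)%N.
  by move: eb b4; rewrite -dvdn2; lia.
apply: (@gtr_cycsum_odd _ _ _ w (- w)) => //; last by right.
move=> x; rewrite -(gtr_theta_cycsum bN w1 prim) -gtr_theta_cycsum //.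
  by rewrite exprNn w1 -signr_odd (negbTE eb) mulr1.
(* If (-w)^i = 1 with i odd, then w^(2i) = 1, and 0 < i < b + 1 forces 2i = b + 1; this contradicts
   4 dividing b + 1. *)
move=> i ib; rewrite exprNn -signr_odd; case: (boolP (odd i)) => oi.
  rewrite expr1 mulN1r eqr_oppLR; apply/eqP => wi.
  have : (w ^+ (2 * i)%N == 1) by rewrite mulnC exprM wi sqrrN expr1n.
  rewrite -(prim_order_dvd w_prim) => /dvdnP[q qE].
  have q1 : q = 1%N by nia.
  by move: oi b4'; rewrite q1 mul1n in qE; rewrite -qE; lia.
by rewrite expr0 mul1r prim.
Qed.

(** * Right-normed brackets in the free Lie algebra *)

Lemma dyn_additive (X : Type) (U V : zmodType) (g : U -> V) (f : seq X -> U) w :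
  {morph g : x y / x - y} -> dyn (fun t => g (f t)) w = g (dyn f w).
Proof.
move=> gB; elim: w f => [|x [|y u] IHu] f //.
by rewrite (dynS f) // gB (dynS _ x) // (IHu (fun t => f _)) (IHu (fun t => f _)).
Qed.

Inductive lspan (V : lmodType rat) (S : V -> Prop) : V -> Prop :=
| lspan_gen x : S x -> lspan S x
| lspan0 : lspan S 0
| lspanD x y : lspan S x -> lspan S y -> lspan S (x + y)
| lspanZ a x : lspan S x -> lspan S (a *: x).

Section LieTheory.
Variable L : lieAlgType.
Implicit Types x y z : L.

Lemma lieDl x x' y : lie (x + x') y = lie x y + lie x' y.
Proof. exact: (linD (lie_linearl y)). Qed.
Lemma lieZl a x y : lie (a *: x) y = a *: lie x y.
Proof. exact: (linZ (lie_linearl y)). Qed.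
Lemma lie0l y : lie 0 y = 0 :> L.
Proof. exact: (lin0 (lie_linearl y)). Qed.
Lemma lieBr x y y' : lie x (y - y') = lie x y - lie x y'.
Proof. exact: (linB (lie_linearr x)). Qed.
Lemma lieDr x y y' : lie x (y + y') = lie x y + lie x y'.
Proof. exact: (linD (lie_linearr x)). Qed.
Lemma lieNr x y : lie x (- y) = - lie x y.
Proof. exact: (linearN (linear_pack (lie_linearr x))). Qed.
Lemma lieZr a x y : lie x (a *: y) = a *: lie x y.
Proof. exact: (linZ (lie_linearr x)). Qed.
Lemma lie0r x : lie x 0 = 0 :> L.
Proof. exact: (lin0 (lie_linearr x)). Qed.
Lemma lieMnr x y n : lie x (y *+ n) = lie x y *+ n.
Proof. exact: (linMn (lie_linearr x)). Qed.

Lemma lieC x y : lie x y = - lie y x.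
Proof.
apply/eqP; rewrite -addr_eq0; apply/eqP.
by have := liexx (x + y); rewrite lieDl !lieDr !liexx add0r addr0.
Qed.

Lemma lie_lie x y z : lie (lie x y) z = lie x (lie y z) - lie y (lie x z).
Proof.
have := lie_jacobi x y z; rewrite (lieC z (lie x y)) (lieC z x) lieNr.
by move/eqP; rewrite subr_eq0 => /eqP.
Qed.

End LieTheory.

Section RightNormed.
Variable H : lmodType rat.
Local Notation gen := (@free_gen H).
Implicit Types (x : H) (w u : seq H) (z : free_lie H).

Fixpoint rn w : free_lie H :=
  match w with
  | [::] => 0
  | x :: u => if u is [::] then gen x else lie (gen x) (rn u)
  end.

Lemma rnS x u : (0 < size u)%N -> rn (x :: u) = lie (gen x) (rn u).
Proof. by case: u. Qed.

Definition adw w z := foldr (fun x => lie (gen x)) z w.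

Lemma dyn_adw w z : (0 < size w)%N -> dyn (fun u => adw u z) w = lie (rn w) z.
Proof.
elim: w z => [//|x [//|y u] IHu] z _.
rewrite dynS // rnS // lie_lie -!IHu //; congr (_ - _).
  by rewrite -(dyn_additive _ _ (lieBr _)).
by apply: eq_dyn => t _; rewrite /adw foldr_rcons.
Qed.

Lemma rn_rcons u x : (0 < size u)%N -> rn (rcons u x) = adw u (gen x).
Proof.
by elim: u => [//|y [//|z u] IHu] _; rewrite [rcons _ _]/= rnS ?size_rcons // IHu.
Qed.

Lemma dyn_rn w : (0 < size w)%N -> dyn rn w = rn w *+ size w.
Proof.
elim: w => [//|x [|y u] IHu] _; first by rewrite mulr1n.
set yu := y :: u in IHu *; have yu0 : (0 < size yu)%N by [].
rewrite dynS // rnS //.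
have -> : dyn (fun t => rn (x :: t)) yu = lie (gen x) (rn yu) *+ size yu.
  rewrite -lieMnr -IHu // -(dyn_additive _ _ (lieBr _)).
  by apply: eq_dyn => t tu; rewrite rnS // tu.
have -> : dyn (fun t => rn (rcons t x)) yu = lie (rn yu) (gen x).
  rewrite -dyn_adw //; apply: eq_dyn => t tu.
  by rewrite rn_rcons // tu.
by rewrite (lieC (rn yu)) opprK -mulrSr.
Qed.

Lemma lie_part_rn w : (0 < size w)%N -> lie_part (size w) (rn w).
Proof.
elim: w => [//|x [|y u] IHu] _; first exact: lie_part_gen.
rewrite rnS // -[size _]/(1 + size (y :: u))%N.
by apply: lie_part_br; [apply: lie_part_gen | apply: IHu].
Qed.

Definition rn_deg j z := exists2 w, (0 < size w)%N & size w = j /\ z = rn w.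

Lemma lie_gen_span x j z : lspan (rn_deg j) z -> lspan (rn_deg j.+1) (lie (gen x) z).
Proof.
elim=> [_ [w w0 [wj ->]]||a b _ IHa _ IHb|k a _ IHa].
- by apply: lspan_gen; exists (x :: w); rewrite //= wj; split=> //; case: w w0 {wj}.
- by rewrite lie0r; apply: lspan0.
- by rewrite lieDr; apply: lspanD.
- by rewrite lieZr; apply: lspanZ.
Qed.

(** Induction on the left bracket through [[x, u], z] = [x, [u, z]] - [u, [x, z]]. *)
Lemma lie_rn_span w j z : (0 < size w)%N -> lspan (rn_deg j) z ->
  lspan (rn_deg (size w + j)%N) (lie (rn w) z).
Proof.
elim: w j z => [//|x [|y u] IHu] j z _ zj; first exact: lie_gen_span.
rewrite rnS // lie_lie -scaleN1r; apply: lspanD.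
  by apply: lie_gen_span; apply: IHu.
apply: lspanZ; rewrite -[size (x :: _)]/(size (y :: u)).+1 addSnnS.
by apply: IHu => //; apply: lie_gen_span.
Qed.

Lemma lie_part_span j z : lie_part j z -> lspan (rn_deg j) z.
Proof.
elim=> {j z} [h|j|j x y _ IHx _ IHy|j a x _ IHx|i j x y _ IHx _ IHy].
- by apply: lspan_gen; exists [:: h].
- exact: lspan0.
- exact: lspanD.
- exact: lspanZ.
elim: IHx => {x} [_ [w w0 [<- ->]]||a b _ IHa _ IHb|k a _ IHa].
- exact: lie_rn_span.
- by rewrite lie0l; apply: lspan0.
- by rewrite lieDl; apply: lspanD.
- by rewrite lieZl; apply: lspanZ.
Qed.

Lemma tpure_linearl (v : free_lie H) : linear ((@tpure H (free_lie H))^~ v).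
Proof.
move=> a u u'; rewrite /tpure /pgen -pclassZ -pclassD.
exact/(@pclassP (presented_premod (@tens_rel H (free_lie H))))/lin_rel/tens_rell.
Qed.

Lemma tpure_linearr (u : H) : linear (@tpure H (free_lie H) u).
Proof.
move=> a v v'; rewrite /tpure /pgen -pclassZ -pclassD.
exact/(@pclassP (presented_premod (@tens_rel H (free_lie H))))/lin_rel/tens_relr.
Qed.

Lemma tpure0r (u : H) : tpure u (0 : free_lie H) = 0.
Proof. exact: (lin0 (tpure_linearr u)). Qed.
Lemma tpureDr (u : H) (v v' : free_lie H) : tpure u (v + v') = tpure u v + tpure u v'.
Proof. exact: (linD (tpure_linearr u)). Qed.
Lemma tpureZr (u : H) a (v : free_lie H) : tpure u (a *: v) = a *: tpure u v.
Proof. exact: (linZ (tpure_linearr u)). Qed.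

Definition hexp w : HL H := if w is x :: u then tpure x (rn u) else 0.

Lemma HL_part_hexp k w : size w = k.+2 -> HL_part k.+1 (hexp w).
Proof.
case: w => [//|x u] [uk]; apply: HL_part_pure; rewrite -uk.
by apply: lie_part_rn; rewrite uk.
Qed.

Lemma HL_part_span k (t : HL H) : HL_part k.+1 t ->
  lspan (fun t => exists2 w, size w = k.+2 & t = hexp w) t.
Proof.
elim=> [h u /lie_part_span|||].
- elim=> [_ [w w0 [wk ->]]||a b _ IHa _ IHb|c a _ IHa].
  + by apply: lspan_gen; exists (h :: w); rewrite /= ?wk.
  + by rewrite tpure0r; apply: lspan0.
  + by rewrite tpureDr; apply: lspanD.
  + by rewrite tpureZr; apply: lspanZ.
- exact: lspan0.
- by move=> x y _ IHx _ IHy; apply: lspanD.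
- by move=> a x _ IHx; apply: lspanZ.
Qed.

Lemma HL_bracket_hexp w : (1 < size w)%N -> HL_bracket (hexp w) = rn w.
Proof.
by case: w => [|x [|y u]] // _; rewrite /hexp (HL_bracket_spec H).2 -rnS.
Qed.

Lemma free_map_rn (phi : H -> H) w : linear phi -> free_map phi (rn w) = rn (map phi w).
Proof.
move=> lphi; have [lF lieF genF] := free_map_spec lphi.
elim: w => [|x [|y u] IHu]; first exact: (lin0 lF).
  exact: genF.
by rewrite [map _ _]/= rnS // [RHS]rnS // lieF genF IHu.
Qed.

Lemma HL_act_hexp (phi : H -> H) w : linear phi -> HL_act phi (hexp w) = hexp (map phi w).
Proof.
move=> lphi; have [lA pA] := HL_act_spec lphi.
case: w => [|x u] /=; first exact: (lin0 lA).
by rewrite pA free_map_rn.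
Qed.

Definition mlin n (V : lmodType rat) (F : seq H -> V) :=
  forall p s, (size p + size s).+1 = n -> linear (fun x => F (p ++ x :: s)).

Lemma mlin_cons n (V : lmodType rat) (F : seq H -> V) x :
  mlin n.+1 F -> mlin n (fun u => F (x :: u)).
Proof. by move=> FF p s ps; apply: (FF (x :: p)); rewrite /= addSn ps. Qed.

Lemma mlin_rn n : mlin n rn.
Proof.
move=> p s _; elim: p => [|y p IHp] a x x'.
  case: s => [|z s]; first exact: free_gen_linear.
  by rewrite !cat0s !(rnS _ (isT : (0 < size (z :: s))%N)) free_gen_linear lie_linearl.
by rewrite !cat_cons !(rnS y) ?size_cat ?addnS // IHp lie_linearr.
Qed.

Lemma mlin_hexp n : mlin n hexp.
Proof.
case=> [|y p] s ps a x x' /=; first exact: tpure_linearl.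
by rewrite (@mlin_rn n.-1 p s) ?tpure_linearr // -ps.
Qed.

End RightNormed.

(** * Coordinates on the free Lie algebra *)

Definition mxlie (M : nat) : Type := 'M[rat]_M.

Section MatrixLie.
Variable M : nat.
HB.instance Definition _ := GRing.Lmodule.on (mxlie M).

Definition mxbr (A B : mxlie M) : mxlie M := A *m B - B *m A.

Lemma mxbr_linearl B : linear (mxbr^~ B).
Proof.
move=> a A A'; rewrite /mxbr !mulmxDl !mulmxDr -!scalemxAl -!scalemxAr.
by rewrite scalerBr opprD addrACA.
Qed.

Lemma mxbr_linearr A : linear (mxbr A).
Proof.
move=> a B B'; rewrite /mxbr !mulmxDl !mulmxDr -!scalemxAl -!scalemxAr.
by rewrite scalerBr opprD addrACA.
Qed.

Lemma mxbrxx A : mxbr A A = 0. Proof. exact: subrr. Qed.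

Lemma mxbr_jacobi A B C : mxbr A (mxbr B C) + mxbr B (mxbr C A) + mxbr C (mxbr A B) = 0.
Proof.
rewrite /mxbr !mulmxBr !mulmxBl !mulmxA.
move: (A *m B *m C) (A *m C *m B) (B *m C *m A) (C *m B *m A) (B *m A *m C) (C *m A *m B).
by move=> a b c d e f; apply/matrixP => i j; rewrite !mxE; ring.
Qed.

HB.instance Definition _ := Lmodule_isLie.Build (mxlie M)
  mxbr_linearl mxbr_linearr mxbrxx mxbr_jacobi.

End MatrixLie.

Section Coordinates.
Variables (H : vectType rat) (N : nat).
Local Notation d := (\dim {:H}).
Local Notation gen := (@free_gen H).
Implicit Types (x : H) (w u : seq H) (J : seq 'I_d) (j : 'I_d).

Definition bas j : H := (vbasis {:H})`_j.
Definition xco j x : rat := coord (vbasis {:H}) j x.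

Lemma xco_sum x : x = \sum_j xco j x *: bas j.
Proof. exact: coord_vbasis (memvf x). Qed.

Lemma xco_bas i j : xco i (bas j) = (i == j)%:R.
Proof.
rewrite eq_sym; apply: coord_free.
exact: basis_free (vbasisP _).
Qed.

Lemma xcoP j a x y : xco j (a *: x + y) = a * xco j x + xco j y.
Proof. by rewrite /xco linearP. Qed.

Fixpoint mono J w : rat :=
  match J, w with
  | j :: J', x :: w' => xco j x * mono J' w'
  | [::], [::] => 1
  | _, _ => 0
  end.

Section MultiSum.
Variable V : lmodType rat.
Implicit Types (F : seq 'I_d -> V) (G : seq H -> V).

Fixpoint msum n F : V :=
  if n is n'.+1 then \sum_j msum n' (fun J => F (j :: J)) else F [::].

Lemma eq_msum n F F' : (forall J, size J = n -> F J = F' J) -> msum n F = msum n F'.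
Proof.
elim: n F F' => [|n IHn] F F' E; first exact: E.
by apply: eq_bigr => j _; apply: IHn => J Jn; rewrite E //= Jn.
Qed.

Lemma msumP n a F F' : msum n (fun J => a *: F J + F' J) = a *: msum n F + msum n F'.
Proof.
elim: n F F' => [//|n IHn] F F' /=; rewrite scaler_sumr -big_split.
by apply: eq_bigr => j _; rewrite IHn.
Qed.

Lemma msum0 n : msum n (fun=> 0) = 0.
Proof. by elim: n => //= n IHn; rewrite big1. Qed.

Lemma msumZ n a F : msum n (fun J => a *: F J) = a *: msum n F.
Proof.
rewrite -[RHS]addr0 -(msum0 n) -msumP; by apply: eq_msum => J _; rewrite addr0.
Qed.

Lemma msum_sum n (I : finType) (F : I -> seq 'I_d -> V) :
  msum n (fun J => \sum_i F i J) = \sum_i msum n (F i).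
Proof.
elim: n F => [//|n IHn] F /=; rewrite exchange_big.
by apply: eq_bigr => j _; rewrite IHn.
Qed.

Lemma msum_expand n G w : mlin n G -> size w = n ->
  G w = msum n (fun J => mono J w *: G (map bas J)).
Proof.
elim: n G w => [|n IHn] G [|x w] // GG; first by rewrite /= scale1r.
move=> [wn]; rewrite {1}(xco_sum x).
have L := GG [::] w (congr1 S wn); rewrite [LHS](lin_sum L); apply: eq_bigr => j _.
rewrite [LHS](linZ L) (IHn (fun u => G (bas j :: u)) w (mlin_cons _ GG) wn) -msumZ.
by apply: eq_msum => J _; rewrite scalerA.
Qed.

End MultiSum.

Lemma dyn_sum (V : zmodType) (X : Type) (I : finType) (F : I -> seq X -> V) (w : seq X) :
  dyn (fun u : seq X => \sum_i F i u) w = \sum_i dyn (F i) w.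
Proof.
elim: w F => [|x [|y u] IHu] F //.
rewrite (dynS _ x) // (IHu (fun i t => F i _)) (IHu (fun i t => F i _)) -sumrB.
by apply: eq_bigr => i _; rewrite (dynS (F i)) //.
Qed.

Lemma dyn_msum (V : lmodType rat) (X : Type) n (F : seq X -> seq 'I_d -> V) (w : seq X) :
  dyn (fun u : seq X => msum n (F u)) w = msum n (fun J => dyn (F^~ J) w).
Proof.
elim: n F => [//|n IHn] F /=; rewrite dyn_sum.
by apply: eq_bigr => j _; rewrite IHn.
Qed.

Local Notation word := {bseq N of 'I_d}.
Local Notation M := #|{: word}|.

Definition widx (s : seq 'I_d) : 'I_M := enum_rank (insubd ([bseq] : word) s).

Lemma widxK s : (size s <= N)%N -> val (enum_val (widx s)) = s.
Proof. by move=> sN; rewrite enum_rankK val_insubd sN. Qed.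

Lemma eq_widx s (a : 'I_M) : (size s <= N)%N -> (a == widx s) = (val (enum_val a) == s).
Proof.
move=> sN; apply/eqP/eqP => [->|E]; first exact: widxK.
by apply: enum_val_inj; apply: val_inj; rewrite E widxK.
Qed.

(** The right regular representation of the free associative algebra truncated in
    degree [N]; row [widx [::]] of a matrix in its image lists the coefficients
    of the words. *)
Definition letter j : 'M[rat]_M :=
  \matrix_(a, b) (val (enum_val b) == rcons (val (enum_val a)) j)%:R.

Definition rho0 x : mxlie M := \sum_j xco j x *: letter j.

Lemma rho0_linear : linear rho0.
Proof.
move=> a x y; rewrite /rho0 scaler_sumr -big_split; apply: eq_bigr => j _ /=.
by rewrite xcoP scalerDl scalerA.
Qed.

Definition rho : free_lie H -> mxlie M := free_lift rho0.

Fixpoint prodm w : 'M[rat]_M := if w is x :: u then rho0 x *m prodm u else 1%:M.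

Lemma prodm_rcons u x : prodm (rcons u x) = prodm u *m rho0 x.
Proof.
by elim: u => [|y u IHu] /=; rewrite ?mulmx1 ?mul1mx // IHu mulmxA.
Qed.

Lemma rho_rn w : (0 < size w)%N -> rho (rn w) = dyn prodm w.
Proof.
elim: w => [//|x [|y u] IHu] _.
  by rewrite /rho (free_liftE rho0_linear) /= mulmx1.
rewrite rnS // dynS // /rho (free_lift_lie rho0_linear) (free_liftE rho0_linear).
rewrite -/(rho _) IHu //.
rewrite [LHS]/(_ *m _ - _ *m _); congr (_ - _).
  by rewrite -(dyn_additive _ _ (mulmxBr (rho0 x))).
rewrite -(dyn_additive _ _ (fun A B => mulmxBl A B (rho0 x))).
by apply: eq_dyn => t _; rewrite prodm_rcons.
Qed.

Lemma prodm_coef u s t : (size s + size u <= N)%N -> size t = (size s + size u)%N ->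
  prodm u (widx s) (widx t)
  = (take (size s) t == s)%:R * mono (drop (size s) t) u.
Proof.
elim: u s => [|x u IHu] s su ts.
  rewrite addn0 in su ts; rewrite mxE eq_widx ?ts // widxK //.
  by rewrite -ts take_size drop_size mulr1 eq_sym.
have sN : (size s < N)%N by apply: leq_trans su; rewrite -addSnnS leq_addr.
rewrite /= mxE.
have [j0 [t' [tE t's]]] : exists j0 t', drop (size s) t = j0 :: t' /\ size t' = size u.
  have : size (drop (size s) t) = (size u).+1 by rewrite size_drop ts addKn.
  by case: (drop _ t) => [//|j0 t'] [E]; exists j0, t'.
have tcat : t = rcons (take (size s) t) j0 ++ t'.
  by rewrite cat_rcons -tE cat_take_drop.
have st : size (rcons (take (size s) t) j0) = (size s).+1.
  by rewrite size_rcons size_takel // ts leq_addr.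
have tk : take (size s).+1 t = rcons (take (size s) t) j0.
  by rewrite {1}tcat take_size_cat.
have dk : drop (size s).+1 t = t' by rewrite tcat drop_size_cat.
transitivity (\sum_j xco j x * prodm u (widx (rcons s j)) (widx t)).
  under eq_bigr => a _.
    rewrite summxE mulr_suml; over.
  rewrite exchange_big; apply: eq_bigr => j _ /=.
  rewrite (bigD1 (widx (rcons s j))) //= big1 ?addr0 => [|a].
    by rewrite !mxE !widxK ?size_rcons // ?eqxx ?mulr1 // ltnW.
  rewrite eq_widx ?size_rcons // => aj; rewrite !mxE widxK 1?ltnW //.
  by rewrite (negbTE aj) mulr0 mul0r.
have E j : prodm u (widx (rcons s j)) (widx t)
    = ((take (size s) t == s) && (j0 == j))%:R * mono t' u.
  by rewrite IHu ?size_rcons ?addSnnS // tk dk eqseq_rcons.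
under eq_bigr do rewrite E.
rewrite (bigD1 j0) //= eqxx andbT big1 ?addr0 => [|j /negbTE jj0].
  by rewrite tE /= mulrCA.
by rewrite [j0 == j]eq_sym jj0 andbF mul0r mulr0.
Qed.

Definition lco J (P : free_lie H) : rat := (rho P : 'M_M) (widx [::]) (widx J).

Lemma lcoP J a P Q : lco J (a *: P + Q) = a * lco J P + lco J Q.
Proof.
by rewrite /lco /rho (free_lift_linear rho0_linear) !mxE.
Qed.

Lemma lco_rn J w : (0 < size w)%N -> (size w <= N)%N -> size J = size w ->
  lco J (rn w) = dyn (mono J) w.
Proof.
move=> w0 wN Jw; rewrite /lco rho_rn //.
have B : {morph (fun A : 'M[rat]_M => A (widx [::]) (widx J)) : A B / A - B}.
  by move=> A B; rewrite !mxE.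
rewrite -(dyn_additive prodm w B); apply: eq_dyn => u uw.
by rewrite prodm_coef /= ?uw // take0 drop0 eqxx mul1r.
Qed.

(** Expands P into words of length n and applies [F] to them. Linearity in P is inherited from the
    coordinates, whereas a definition by [F] on brackets would have to respect the Lie relations. *)
Definition liftL n (V : lmodType rat) (F : seq H -> V) (P : free_lie H) : V :=
  msum n (fun J => lco J P *: F (map bas J)).

Lemma liftL_linear n (V : lmodType rat) (F : seq H -> V) : linear (liftL n F).
Proof.
move=> a P Q; rewrite /liftL -msumP; apply: eq_msum => J _.
by rewrite lcoP scalerDl scalerA.
Qed.

Lemma liftL_rn n (V : lmodType rat) (F : seq H -> V) w : mlin n F ->
  (0 < n <= N)%N -> size w = n -> liftL n F (rn w) = dyn F w.
Proof.
move=> FF /andP[n0 nN] wn.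
transitivity (dyn (fun u => msum n (fun J => mono J u *: F (map bas J))) w).
  rewrite dyn_msum; apply: eq_msum => J Jn; rewrite lco_rn ?wn //.
  have B : {morph (fun r : rat => r *: F (map bas J)) : r s / r - s}.
    by move=> r s; rewrite scalerBl.
  by rewrite -(dyn_additive (mono J) w B).
by apply: eq_dyn => u uw; rewrite -msum_expand // uw.
Qed.

Definition liftHL n (V : lmodType rat) (F : seq H -> V) : HL H -> V :=
  tens_lift (fun x P => liftL n (fun u => F (x :: u)) P).

Lemma liftHL_spec n (V : lmodType rat) (F : seq H -> V) : mlin n.+1 F ->
  (0 < n <= N)%N -> linear (liftHL n F) /\
  (forall w, size w = n.+1 -> liftHL n F (hexp w) =
     dyn (fun t => F (take 1 w ++ t)) (drop 1 w)).
Proof.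
move=> FF nN; have [|x|lin E] := @tens_lift_spec H (free_lie H) V
    (fun x P => liftL n (fun u => F (x :: u)) P).
- move=> P a x y; rewrite /liftL -msumP; apply: eq_msum => J Jn.
  rewrite (FF [::] (map bas J) _ a x y) ?size_map ?Jn // scalerDr !scalerA.
  by rewrite mulrC.
- exact: liftL_linear.
split=> // -[//|x u] [un]; rewrite /liftHL E liftL_rn //; last exact: mlin_cons.
by rewrite /= drop0 take0.
Qed.

End Coordinates.

(** * Specht modules as right ideals *)

Section SpechtAlgebra.
Variable N : nat.
Local Notation A := (galg rat 'S_N).
Local Notation ge := (@ge rat _ : 'S_N -> A).
Local Notation G := [set: 'S_N]%G.
Local Notation aG := (regular_repr rat G).
Local Notation row_vec := 'rV[rat]_#|[set: 'S_N]|.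
Implicit Types (D : diagram N) (s : 'S_N).

Definition row_galg (v : row_vec) : A := [ffun g => v 0 (gring_index [set: 'S_N] g)].

Lemma gcoef_row_galg v g : gcoef (row_galg v) g = v 0 (gring_index [set: 'S_N] g).
Proof. by rewrite /gcoef ffunE. Qed.

Lemma row_galg_linear : linear row_galg.
Proof. by move=> a v w; apply: gcoefP => g; rewrite gcoefD gcoefZ !gcoef_row_galg !mxE. Qed.
HB.instance Definition _ :=
  GRing.isLinear.Build rat row_vec A _ row_galg row_galg_linear.

Lemma row_galg_delta g : row_galg (delta_mx 0 (gring_index [set: 'S_N] g)) = ge g.
Proof.
apply: gcoefP => h; rewrite gcoef_row_galg mxE eqxx /= gcoef_ge.
by rewrite -(inj_eq enum_val_inj) !gring_indexK ?inE.
Qed.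

Lemma row_galgJ v s : row_galg (v *m aG s) = row_galg v * ge s.
Proof.
rewrite [v]row_sum_delta mulmx_suml !linear_sum mulr_suml; apply: eq_bigr => i _.
rewrite -scalemxAl !linearZ /= -scalerAl; congr (_ *: _).
by rewrite -rowE rowK row_galg_delta geM -(row_galg_delta (enum_val i)) gring_valK.
Qed.

Lemma row_galg_inj : injective row_galg.
Proof.
move=> v w E; apply/rowP => i; have := congr1 (fun a => gcoef a (enum_val i)) E.
by rewrite !gcoef_row_galg gring_valK.
Qed.

Definition galg_row (a : A) : row_vec := \row_i gcoef a (enum_val i).

Lemma galg_rowK a : row_galg (galg_row a) = a.
Proof.
by apply: gcoefP => g; rewrite gcoef_row_galg mxE gring_indexK ?inE.
Qed.

Lemma row_galg_young D : row_galg (young_symmetrizer D) = ysym rat D.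
Proof.
have sE f (P : pred 'S_N) : P =1 fixes f -> sym rat f = \sum_(s | P s) ge s.
  by move=> E; rewrite sym_sum; apply: eq_bigl => s; rewrite E.
have rE : row_group D =i fixes (rlab D).
  by move=> s; rewrite inE; apply: eq_forallb => i; rewrite !ffunE.
have cE : col_group D =i fixes (clab D).
  by move=> s; rewrite inE; apply: eq_forallb => i; rewrite !ffunE.
rewrite /ysym /asym (sE _ (mem (row_group D)) rE) (sE _ (mem (col_group D)) cE).
rewrite linear_sum mulr_suml linear_sum; apply: eq_bigr => p _.
rewrite mulr_sumr linear_sum; apply: eq_bigr => q _.
by rewrite linearZ /= row_galg_delta tw_ge geM scalerAr.
Qed.

Section Specht.
Variable D : diagram N.
Local Notation rV := (specht_repr D).
Local Notation dim := (\rank (specht_module D)).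
Local Notation eps := (eps rat D).
Implicit Types v w : 'rV[rat]_dim.

(** The embedding of the Specht module as the right ideal [eps D * A]. *)
Definition gv v : A := row_galg (val_submod v).

Lemma gv_linear : linear gv.
Proof. by move=> a v w; rewrite /gv !linearP. Qed.
HB.instance Definition _ := GRing.isLinear.Build rat 'rV[rat]_dim A _ gv gv_linear.

Lemma gv_inj : injective gv.
Proof. by move=> v w /row_galg_inj/val_submod_inj. Qed.

Lemma gvJ v s : gv (v *m rV s) = gv v * ge s.
Proof. by rewrite /gv val_submodJ ?inE // row_galgJ. Qed.

Lemma eps_gv v : eps * gv v = gv v.
Proof.
have /cyclic_mxP[B /envelop_mxP[a ->] E] := val_submodP v.
rewrite /gv E mulmx_sumr linear_sum mulr_sumr; apply: eq_bigr => s _.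
rewrite -scalemxAr linearZ /= row_galgJ row_galg_young -scalerAr mulrA.
by congr (_ *: (_ * _)); rewrite ysym_eps -scalerAr epsK.
Qed.

Definition vg (a : A) : 'rV[rat]_dim := in_submod (specht_module D) (galg_row a).

Lemma vgK a : eps * a = a -> gv (vg a) = a.
Proof.
move=> epsa; rewrite /gv in_submodK ?galg_rowK //; apply/cyclic_mxP.
exists (\sum_(s in [set: 'S_N]) (ykap rat D)^-1 * gcoef a s *: aG s).
  by apply/envelop_mxP; eexists.
apply: row_galg_inj; rewrite galg_rowK -[LHS]epsa [X in _ * X]gsumE.
rewrite mulmx_sumr linear_sum mulr_sumr big_set /=; apply: eq_bigr => s _.
rewrite -scalemxAr linearZ /= row_galgJ row_galg_young /eps -scalerAl -scalerAr.
by rewrite scalerA.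
Qed.

Lemma gvK v : vg (gv v) = v.
Proof. by apply: gv_inj; rewrite vgK // eps_gv. Qed.

End Specht.
End SpechtAlgebra.

(** * Schur modules *)

Lemma presented_ind (X : Type) (rel : lin_expr X -> lin_expr X -> Prop)
    (Q : presented rel -> Prop) : (forall x, Q (pgen rel x)) -> Q 0 ->
  (forall x y, Q x -> Q y -> Q (x + y)) -> (forall a x, Q x -> Q (a *: x)) ->
  forall z, Q z.
Proof.
move=> Qg Q0 QD QZ; elim/(@pquot_ind (presented_premod rel)).
elim=> [x||x IHx y IHy|a x IHx] //; first exact: Qg.
  by rewrite pclassD; apply: QD.
by rewrite pclassZ; apply: QZ.
Qed.

Lemma presented_ext (X : Type) (rel : lin_expr X -> lin_expr X -> Prop)
    (V : lmodType rat) (f1 f2 : presented rel -> V) : linear f1 -> linear f2 ->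
  (forall x, f1 (pgen rel x) = f2 (pgen rel x)) -> f1 =1 f2.
Proof.
move=> l1 l2 E; elim/presented_ind => [//||x y Ex Ey|a x Ex].
- by rewrite (lin0 l1) (lin0 l2).
- by rewrite (linD l1) (linD l2) Ex Ey.
- by rewrite (linZ l1) (linZ l2) Ex.
Qed.

Lemma lspan_ext (V W : lmodType rat) (S : V -> Prop) (f1 f2 : V -> W) :
  linear f1 -> linear f2 -> (forall x, S x -> f1 x = f2 x) ->
  forall x, lspan S x -> f1 x = f2 x.
Proof.
move=> l1 l2 E x; elim=> [y /E //||y z _ Ey _ Ez|a y _ Ey].
- by rewrite (lin0 l1) (lin0 l2).
- by rewrite (linD l1) (linD l2) Ey Ez.
- by rewrite (linZ l1) (linZ l2) Ey.
Qed.

(** * The idempotent of the kernel of the bracket *)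

Section KernelIdempotent.
Variable k : nat.
Local Notation N := k.+2.
Local Notation A := (galg rat 'S_N).
Local Notation ge := (@ge rat _ : 'S_N -> A).

Definition dynP : A := k.+1%:R^-1 *: theta rat N k.
Definition dynQ : A := k.+2%:R^-1 *: theta rat N k.+1.

Lemma dynPP : dynP * dynP = dynP.
Proof.
rewrite /dynP -scalerAl -scalerAr theta_sqr // !scalerA -mulrA mulVf ?mulr1 //.
by rewrite pnatr_eq0.
Qed.

Lemma dynQQ : dynQ * dynQ = dynQ.
Proof.
rewrite /dynQ -scalerAl -scalerAr theta_sqr // !scalerA -mulrA mulVf ?mulr1 //.
by rewrite pnatr_eq0.
Qed.

Lemma dynQP : dynQ * dynP = dynQ.
Proof.
rewrite /dynQ /dynP -scalerAl -scalerAr theta_mul_pred // !scalerA.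
by rewrite -mulrA mulVf ?mulr1 // pnatr_eq0.
Qed.

(** The kernel of the bracket is the image of this idempotent. *)
Definition kerid : A := dynP * (1 - dynQ).

Lemma kerid_idem : kerid * kerid = kerid.
Proof.
rewrite /kerid !mulrBr !mulrBl !mulr1 dynPP.
rewrite -[dynP * dynQ * dynP]mulrA dynQP [dynP * dynQ * (_ * _)]mulrA.
by rewrite -[dynP * dynQ * dynP]mulrA dynQP -mulrA dynQQ mulrA dynPP subrr subr0.
Qed.

Lemma kerid_dynP : kerid * dynP = kerid.
Proof. by rewrite /kerid -mulrA mulrBl mul1r dynQP !mulrBr dynPP mulr1. Qed.

(** By cyclicity the trace of P Q is that of Q P = Q, so [kerid] has the traces of P - Q. *)
Lemma kerid_odd (s : 'S_N) : (N %% 4)%N != 2%N -> (k.+1 %% 4)%N != 2%N ->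
  odd_perm s -> gtr kerid (ge s) = 0.
Proof.
move=> N4 k4 s_odd; rewrite /kerid mulrBr mulr1 gtr_subl gtr_mulCl dynQP.
by rewrite /dynP /dynQ !gtrZl !theta_odd // !mulr0 subrr.
Qed.

End KernelIdempotent.

Section Slots.
Variables (H : lmodType rat) (N : nat).
Implicit Types (h : {ffun 'I_N -> H}) (s : 'S_N).

Lemma mlin_set_slot (V : lmodType rat) (F : seq H -> V) h i s : mlin N F ->
  linear (fun x => F (word (set_slot h i x \o s))).
Proof.
move=> FF; pose j := (s^-1)%g i.
have [p [t [E]]] : exists p t, enum 'I_N = p ++ j :: t /\ (j \notin p) && (j \notin t).
  have jE : j \in enum 'I_N by rewrite mem_enum.
  case/splitPr: jE (enum_uniq 'I_N) => p t; rewrite cat_uniq /= => /and4P[_ jp jt _].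
  exists p, t; split=> //; rewrite jt andbT.
  by apply: contra jp => jp; rewrite jp.
move=> /andP[jp jt].
have WE x : word (set_slot h i x \o s) = map (h \o s) p ++ x :: map (h \o s) t.
  rewrite /word E map_cat /=; congr (_ ++ _ :: _).
  - apply/eq_in_map => l lp /=; rewrite ffunE; case: eqP => // sl.
    by move: jp; rewrite /j -sl permK lp.
  - by rewrite ffunE /j permKV eqxx.
  - apply/eq_in_map => l lp /=; rewrite ffunE; case: eqP => // sl.
    by move: jt; rewrite /j -sl permK lp.
have sz : (size (map (h \o s) p) + size (map (h \o s) t)).+1 = N.
  by rewrite !size_map -[RHS](size_enum_ord N) E size_cat /= addnS.
by move=> a x y; rewrite !WE (FF _ _ sz).
Qed.

Lemma word_permute h s (t : 'S_N) : word (permute_slots h s \o t) = word ((h \o (s^-1)%g) \o t).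
Proof. by apply: eq_word => i; rewrite /= ffunE. Qed.

End Slots.

Section SchurModules.
Variables (H : lmodType rat) (N : nat) (D : diagram N).
Local Notation A := (galg rat 'S_N).
Local Notation rV := (specht_repr D).
Local Notation dim := (\rank (specht_module D)).
Local Notation rel := (@schur_rel H N dim rV).
Local Notation eps := (eps rat D).
Implicit Types (h : {ffun 'I_N -> H}) (s : 'S_N) (v w : 'rV[rat]_dim).

Definition tgen h v : schur_module H D := pgen rel (h, v).

Lemma tgen_linear h : linear (tgen h).
Proof.
move=> a v w; rewrite /tgen /pgen -pclassZ -pclassD.
exact/(@pclassP (presented_premod rel))/lin_rel/schur_rel_vec.
Qed.

Lemma tgen_slot h i v : linear (fun x => tgen (set_slot h i x) v).
Proof.
move=> a x y; rewrite /tgen /pgen -pclassZ -pclassD.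
exact/(@pclassP (presented_premod rel))/lin_rel/schur_rel_slot.
Qed.

Lemma tgen_perm h s v : tgen (permute_slots h s) v = tgen h (v *m rV (s^-1)%g).
Proof. exact/(@pclassP (presented_premod rel))/lin_rel/schur_rel_perm. Qed.

Lemma schur_ext (V : lmodType rat) (f1 f2 : schur_module H D -> V) :
  linear f1 -> linear f2 -> (forall h v, f1 (tgen h v) = f2 (tgen h v)) -> f1 =1 f2.
Proof. by move=> l1 l2 E; apply: presented_ext l1 l2 _ => -[h v]; apply: E. Qed.

Definition tword v (w : seq H) : schur_module H D := tgen [ffun i => nth 0 w (i : 'I_N)] v.

Lemma tword_word h v : tword v (word h) = tgen h v.
Proof. by congr tgen; apply/ffunP => i; rewrite ffunE nth_word. Qed.

Lemma tword_comp h s v : tword v (word (h \o s)) = tgen h (v *m rV s).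
Proof.
rewrite -[s in rV s]invgK -tgen_perm -tword_word; congr tword.
by apply: eq_word => i; rewrite ffunE invgK.
Qed.

Lemma mlin_tword v : mlin N (tword v).
Proof.
move=> p t pt; have pN : (size p < N)%N by rewrite -pt ltnS leq_addr.
pose h : {ffun 'I_N -> H} := [ffun i => nth 0 (p ++ 0 :: t) (i : 'I_N)].
have E x : tword v (p ++ x :: t) = tgen (set_slot h (Ordinal pN) x) v.
  congr tgen; apply/ffunP => i; rewrite !ffunE -val_eqE /= !nth_cat.
  by case: ltngtP => [//|ip|->]; rewrite ?subnn // -(subnSK ip).
by move=> a x y; rewrite !E tgen_slot.
Qed.

Lemma ev_tword h v b : ev (tword v) h b = tgen h (vg D (gv v * b)).
Proof.
have lin : linear (fun b : A => tgen h (vg D (gv v * b))).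
  move=> a c c'; rewrite mulrDr -scalerAr /vg.
  have -> : galg_row (a *: (gv v * c) + gv v * c')
      = a *: galg_row (gv v * c) + galg_row (gv v * c').
    by apply/rowP => i; rewrite !mxE gcoefD gcoefZ.
  by rewrite linearP tgen_linear.
apply: galg_ext lin _ b => [|s]; first exact: ev_linear.
by rewrite ev_ge tword_comp -gvJ gvK.
Qed.

Section LiftSchur.
Variables (V : lmodType rat) (F : seq H -> V) (y : A).
Hypothesis FF : mlin N F.

Definition schur_fun (p : {ffun 'I_N -> H} * 'rV[rat]_dim) : V :=
  ev F p.1 (y * gv p.2).

Definition schur_lift : schur_module H D -> V := presented_lift schur_fun.

Lemma schur_lift_rel a b : rel a b -> lin_eval schur_fun a = lin_eval schur_fun b.
Proof.
rewrite /schur_fun; case=> [h i c x z v|h c v w|h s v] /=.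
- rewrite /ev scaler_sumr -big_split; apply: eq_bigr => s _ /=.
  by rewrite (mlin_set_slot h i s FF) scalerDr !scalerA mulrC.
- by rewrite linearP mulrDr -scalerAr ev_linear.
- rewrite gvJ mulrA ev_mul_ge; apply: eq_bigr => t _.
  by rewrite word_permute.
Qed.

Lemma schur_lift_linear : linear schur_lift.
Proof. exact/presented_lift_linear/schur_lift_rel. Qed.

Lemma schur_liftE h v : schur_lift (tgen h v) = ev F h (y * gv v).
Proof. exact/presented_liftE/schur_lift_rel. Qed.

End LiftSchur.
End SchurModules.

(** * Decomposition of the kernel of the bracket *)

Section Existence.
Variables (k : nat) (H : vectType rat).
Local Notation N := k.+2.
Local Notation A := (galg rat 'S_N).
Local Notation hexp := (@hexp H).
Local Notation rn := (@rn H).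
Local Notation eps := (@eps rat N).
Implicit Types (h : {ffun 'I_N -> H}) (D : diagram N).

Lemma evZr (V : lmodType rat) (F : seq H -> V) h c a : ev F h (c *: a) = c *: ev F h a.
Proof. by rewrite linearZ. Qed.

Lemma dynw_cons (V : lmodType rat) (F : seq H -> V) x u :
  dynw N k F (x :: u) = dyn (fun t => F (x :: t)) u.
Proof.
have t1 : take 1 (x :: u) = [:: x] by rewrite /= take0.
have d1 : drop 1 (x :: u) = u by rewrite /= drop0.
by rewrite /dynw subSnn t1 d1.
Qed.

Lemma dynw_hexp (w : seq H) : size w = N ->
  dynw N k hexp w = k.+1%:R *: hexp w.
Proof.
case: w => [//|x u] [uk]; rewrite dynw_cons.
rewrite (dyn_additive rn u (linB (tpure_linearr x))) [LHS]/=.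
by rewrite dyn_rn uk // scaler_nat -(linMn (tpure_linearr x)).
Qed.

Lemma dynw_rn (w : seq H) : size w = N -> dynw N k rn w = k.+1%:R *: rn w.
Proof.
case: w => [//|x u] [uk]; rewrite dynw_cons.
transitivity (dyn (fun t => lie (free_gen x) (rn t)) u).
  by apply: eq_dyn => t tu; rewrite rnS // tu uk.
rewrite (dyn_additive rn u (lieBr _)) dyn_rn uk // lieMnr scaler_nat.
by case: u uk.
Qed.

Lemma ev_dynP (V : lmodType rat) (F : seq H -> V) h a :
  (forall w, size w = N -> dynw N k F w = k.+1%:R *: F w) ->
  ev F h (dynP k * a) = ev F h a.
Proof.
move=> E; rewrite /dynP -scalerAl evZr ev_theta_mul //.
transitivity (k.+1%:R^-1 *: (k.+1%:R *: ev F h a)).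
  congr (_ *: _); rewrite -evZ; apply: eq_ev => p.
  by rewrite E // size_word.
by rewrite scalerA mulVf ?scale1r // pnatr_eq0.
Qed.

Lemma ev_dynQ_rn h a : ev rn h (dynQ k * a) = ev rn h a.
Proof.
rewrite /dynQ -scalerAl evZr ev_theta_mul //.
transitivity (k.+2%:R^-1 *: (k.+2%:R *: ev rn h a)).
  congr (_ *: _); rewrite -evZ; apply: eq_ev => p.
  by rewrite /dynw subnn take0 drop0 dyn_rn size_word // scaler_nat.
by rewrite scalerA mulVf ?scale1r // pnatr_eq0.
Qed.

Lemma HL_part_ev h a : HL_part k.+1 (ev hexp h a).
Proof.
rewrite /ev; elim/big_ind: _ => [|x y Hx Hy|p _].
- exact: HL_part0.
- exact: HL_partD.
- by apply/HL_partZ/HL_part_hexp; rewrite size_word.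
Qed.

Lemma HL_bracket_ev h a : HL_bracket (ev hexp h a) = ev rn h a.
Proof.
have l := (HL_bracket_spec H).1; rewrite (lin_sum l).
apply: eq_bigr => p _; rewrite (linZ l); congr (_ *: _).
by apply: HL_bracket_hexp; rewrite size_word.
Qed.

Lemma hg1_ev h a : hg1 k (ev hexp h (kerid k * a)).
Proof.
split; first exact: HL_part_ev.
rewrite HL_bracket_ev /kerid -mulrA ev_dynP; last exact: dynw_rn.
by rewrite mulrBl mul1r linearB /= ev_dynQ_rn subrr.
Qed.

Lemma liftHL_ev (V : lmodType rat) (F : seq H -> V) h a : mlin N F ->
  liftHL k.+1 k.+1 F (ev hexp h a) = ev F h (theta rat N k * a).
Proof.
move=> FF; have [lin E] := liftHL_spec FF (leqnn k.+1 : (0 < k.+1 <= k.+1)%N).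
rewrite (lin_sum lin) ev_theta_mul //.
apply: eq_bigr => p _; rewrite (linZ lin) E ?size_word //.
by rewrite /dynw subSnn.
Qed.

Lemma HL_act_ev (phi : H -> H) h a : linear phi ->
  HL_act phi (ev hexp h a) = ev hexp [ffun i => phi (h i)] a.
Proof.
move=> lphi; have l := (HL_act_spec lphi).1; rewrite (lin_sum l).
apply: eq_bigr => p _; rewrite (linZ l) HL_act_hexp // map_word.
by congr (_ *: hexp _); apply: eq_word => i /=; rewrite ffunE.
Qed.

Variables (m : diagram N -> nat) (y u : diagram N -> nat -> A).
Hypothesis dec : idem_dec (kerid k) m y u.

Definition copy D (i : 'I_(m D)) : {linear schur_module H D -> HL H} :=
  linear_pack (@schur_lift_linear H N D (HL H) hexp (y D i) (@mlin_hexp H N)).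

Lemma copyE D i h v : @copy D i (tgen h v) = ev hexp h (y D i * gv v).
Proof. exact/schur_liftE/mlin_hexp. Qed.

(** The inverse of [copy] on its image. [liftHL] produces [theta], so the factor 1/(k+1) turns it
    into [dynP], which [u D i] absorbs on its right. *)
Definition proj D (i : nat) (z : HL H) : schur_module H D :=
  liftHL k.+1 k.+1 (tword (vg D (k.+1%:R^-1 *: u D i))) z.

Lemma proj_linear D i : linear (@proj D i).
Proof.
have [lin _] := @liftHL_spec H k.+1 k.+1 _ _ (mlin_tword (vg D (k.+1%:R^-1 *: u D i)))
  (leqnn k.+1 : (0 < k.+1 <= k.+1)%N).
exact: lin.
Qed.

Lemma proj_ev D i h a : (i < m D)%N ->
  @proj D i (ev hexp h a) = tgen h (vg D (u D i * a)).
Proof.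
move=> im; rewrite /proj liftHL_ev; last exact: mlin_tword.
rewrite ev_tword vgK; last by rewrite -scalerAr (dec_epsu dec).
congr (tgen h (vg D _)); have uP : u D i * dynP k = u D i.
  by rewrite -(dec_ue dec im) -mulrA kerid_dynP.
rewrite -[in RHS]uP -mulrA /dynP -scalerAl; set t := theta _ _ _.
by rewrite -[_ *: t * a]scalerAl -scalerAr.
Qed.

Lemma vg0 D : vg D 0 = 0.
Proof. by rewrite -[0 in LHS](linear0 (@gv N D)) gvK. Qed.

Lemma proj_copy_neq D (i : 'I_(m D)) E (j : 'I_(m E)) x :
  ~~ ((D == E) && (i == j :> nat)) -> @proj D i (copy j x) = 0.
Proof.
move=> ne; have lin : linear (@proj D i \o @copy E j).
  by move=> a b c; rewrite [LHS]/comp linearP proj_linear.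
have zlin : linear (fun=> 0 : schur_module H D).
  by move=> V a b c; rewrite scaler0 addr0.
apply: (schur_ext lin (zlin _)) x => h v; rewrite ?[LHS]/comp ?[RHS]/comp.
rewrite copyE proj_ev // mulrA (dec_uy dec) // (negbTE ne) mul0r vg0.
exact: (lin0 (tgen_linear h)).
Qed.

Lemma proj_copy_id D (i : 'I_(m D)) x : @proj D i (copy i x) = x.
Proof.
have lin : linear (@proj D i \o @copy D i).
  by move=> a b c; rewrite [LHS]/comp linearP proj_linear.
have lin1 : linear (id : schur_module H D -> _) by [].
apply: (schur_ext lin lin1) x => h v; rewrite ?[LHS]/comp ?[RHS]/comp.
by rewrite copyE proj_ev // mulrA (dec_uy dec) // !eqxx eps_gv gvK.
Qed.

Lemma copy_decomposes z : hg1 k z ->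
  z = \sum_(D : diagram N) \sum_(i < m D) copy i (@proj D i z).
Proof.
move=> [/HL_part_span zS z0].
(* S maps [rn w] to the action of [dynQ] on [hexp w]. So f1 extends the identity of the kernel to
   all of degree k + 1, where it can be compared with f2 on the spanning elements [hexp w]. *)
pose S (P : free_lie H) := k.+2%:R^-1 *: liftL k.+2 k.+2 hexp P.
have Slin : linear S.
  move=> a P Q; rewrite /S liftL_linear scalerDr !scalerA.
  by rewrite mulrC.
pose f1 t := t - S (HL_bracket t).
pose f2 t := \sum_(D : diagram N) \sum_(i < m D) copy i (@proj D i t).
have l1 : linear f1.
  move=> a s t; rewrite /f1 (HL_bracket_spec H).1 Slin scalerBr opprD.
  by rewrite addrACA.
have l2 : linear f2.
  move=> a s t; rewrite /f2 scaler_sumr -big_split; apply: eq_bigr => D _ /=.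
  rewrite scaler_sumr -big_split; apply: eq_bigr => i _ /=.
  by rewrite proj_linear; exact: (linearP (copy i)).
have E t : (exists2 w, size w = N & t = hexp w) -> f1 t = f2 t.
  case=> w wN ->; have [h0 hE] := word_surj wN.
  pose h : {ffun 'I_N -> H} := [ffun i => h0 i].
  have wE : word h = w by rewrite -hE; apply: eq_word => i; rewrite ffunE.
  have {}hE : hexp w = ev hexp h 1 by rewrite ev1 wE.
  have -> : f1 (hexp w) = ev hexp h (kerid k).
    rewrite /kerid -[_ * _]mulr1 -mulrA ev_dynP; last exact: dynw_hexp.
    rewrite mulr1 linearB /= -hE; congr (_ - _).
    rewrite /S HL_bracket_hexp ?wN // (liftL_rn (@mlin_hexp H k.+2)) //.
    rewrite /dynQ evZr; congr (_ *: _).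
    rewrite (@ev_theta _ _ _ _ _ _ _ [::] (word h)) ?size_word //.
      by rewrite wE.
    by rewrite leqnn.
  rewrite -(dec_sum dec) linear_sum; apply: eq_bigr => D _.
  rewrite linear_sum; apply: eq_bigr => i _.
  rewrite hE proj_ev // mulr1 copyE vgK //.
  exact: (dec_epsu dec).
have := lspan_ext l1 l2 E zS; rewrite /f1 z0.
by rewrite (_ : S 0 = 0) ?subr0 //; apply: (lin0 Slin).
Qed.

Theorem idem_gl_decomposition : gl_decomposition H m.
Proof.
exists copy => total; split.
- move=> phi _ D i x.
  have [lact actE] := tens_repr_act_spec (specht_repr D) (linearP phi).
  have lHL := (HL_act_spec (linearP phi)).1.
  have l1 : linear (copy i \o schur_act phi).
    by move=> a b c; rewrite /comp /schur_act lact; exact: linearP.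
  have l2 : linear (HL_act phi \o copy i).
    by move=> a b c; rewrite /comp [copy _ _](linearP (copy i)) lHL.
  apply: (schur_ext l1 l2) x => h v; rewrite ?[LHS]/comp ?[RHS]/comp.
  transitivity (ev hexp [ffun j => phi (h j)] (y D i * gv v)).
    by rewrite [schur_act _ _]actE; exact: copyE.
  by rewrite copyE HL_act_ev //; exact: linearP.
- move=> z; split=> [/copy_decomposes ->|[s ->]].
    by exists (fun D i => @proj D i z).
  rewrite /total; have [lb _] := HL_bracket_spec H.
  have hgD (x t : HL H) : hg1 k x -> hg1 k t -> hg1 k (x + t).
    move=> [xk x0] [tk t0]; split; first exact: HL_partD.
    by rewrite (linD lb x t : HL_bracket _ = _) /= x0 t0 addr0.
  have hg0 : hg1 k (0 : HL H).
    by split; [apply: HL_part0 | apply: (lin0 lb)].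
  have hgZ a (x : HL H) : hg1 k x -> hg1 k (a *: x).
    move=> [xk x0]; split; first exact: HL_partZ.
    by rewrite (linZ lb a x : HL_bracket _ = _) /= x0 scaler0.
  elim/big_ind: _ => // D _; elim/big_ind: _ => // i _.
  elim/presented_ind: (s D i) => [[h v]||x t hx ht|a x hx].
  - rewrite [copy _ _]copyE -(dec_ey dec (ltn_ord i)) -mulrA; exact: hg1_ev.
  - by rewrite [copy _ _](linear0 (copy i)).
  - by rewrite [copy _ _](linearD (copy i)); apply: hgD.
  - by rewrite [copy _ _](linearZ_LR (copy i)); apply: hgZ.
- move=> s s0 D i; transitivity (@proj D i (total s)); last first.
    by rewrite s0; apply: (lin0 (@proj_linear D i)).
  rewrite /total [RHS](lin_sum (@proj_linear D i)) (bigD1 D) //= [X in _ + X]big1 ?addr0 => [|E ED].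
    rewrite [RHS](lin_sum (@proj_linear D i)) (bigD1 i) //= big1 ?addr0.
      by rewrite proj_copy_id.
    by move=> j ji; rewrite proj_copy_neq // eqxx /= eq_sym.
  rewrite [LHS](lin_sum (@proj_linear D i)) big1 // => j _.
  by rewrite /= proj_copy_neq // eq_sym (negbTE ED).
Qed.

End Existence.

(** * Weights in Schur modules *)

Lemma msum_ind (H : vectType rat) (V : lmodType rat) (Q : V -> Prop) n
    (F : seq 'I_(\dim {:H}) -> V) : Q 0 -> (forall x y, Q x -> Q y -> Q (x + y)) ->
  (forall J, size J = n -> Q (F J)) -> Q (msum n F).
Proof.
move=> Q0 QD; elim: n F => [|n IHn] F QF; first exact: QF.
by rewrite /=; elim/big_ind: _ => // j _; apply: IHn => J Jn; apply: QF; rewrite /= Jn.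
Qed.

Section Weights.
Variables (H : vectType rat) (N : nat).
Local Notation d := (\dim {:H}).
Hypothesis Nd : (N <= d)%N.
Local Notation A := (galg rat 'S_N).
Local Notation bas := (@bas H).
Local Notation xco := (@xco H).
Local Notation mono := (@mono H).
Implicit Types (h : {ffun 'I_N -> H}) (s : 'S_N) (D : diagram N) (J : seq 'I_d).

Lemma bas_ext (V : lmodType rat) (f g : H -> V) : linear f -> linear g ->
  (forall j, f (bas j) = g (bas j)) -> f =1 g.
Proof.
move=> lf lg E x; rewrite (xco_sum x) (lin_sum lf) (lin_sum lg).
by apply: eq_bigr => j _; rewrite (linZ lf) (linZ lg) E.
Qed.

(** A tensor is an eigenvector of [dil j] for the eigenvalue [2 ^ r] if and only
    if it has degree [r] in [bas j]. *)
Definition dil j (x : H) : H := x + xco j x *: bas j.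

Lemma dil_linear j : linear (dil j).
Proof. by move=> a x y; rewrite /dil xcoP scalerDl scalerDr scalerA addrACA. Qed.

Definition dilL j : {linear H -> H} := linear_pack (dil_linear j).

Lemma xco_dil i j x : xco i (dil j x) = 2%:R ^+ (i == j) * xco i x.
Proof.
rewrite /dil addrC xcoP xco_bas; case: eqP => [->|_].
  by rewrite mulr1 expr1 mulr_natl mulr2n.
by rewrite mulr0 add0r mul1r.
Qed.

Lemma dil_bij j : bijective (dilL j).
Proof.
exists (fun x => x - (2%:R^-1 * xco j x) *: bas j) => x /=.
  by rewrite xco_dil eqxx mulrA mulVf // mul1r /dil addrK.
rewrite /dil -scaleNr (addrC x) xcoP xco_bas eqxx addrAC -scalerDl.
have -> : (- (2%:R^-1 * xco j x) + (- (2%:R^-1 * xco j x) * 1 + xco j x)) = 0 by field.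
by rewrite scale0r add0r.
Qed.

Lemma mono_dil j J w : mono J (map (dil j) w) = 2%:R ^+ count_mem j J * mono J w.
Proof.
elim: w J => [|x w IHw] [|i J] //=; rewrite ?mulr0 ?mulr1 //.
by rewrite IHw xco_dil exprD mulrACA.
Qed.

Definition emb : {ffun 'I_N -> H} := [ffun i => bas (widen_ord Nd i)].

Definition lift_perm_fun s (i : 'I_d) : 'I_d :=
  if insub (val i) is Some a then widen_ord Nd (s a) else i.

Lemma lift_perm_widen s a : lift_perm_fun s (widen_ord Nd a) = widen_ord Nd (s a).
Proof. by rewrite /lift_perm_fun valK. Qed.

Lemma lift_permK s : cancel (lift_perm_fun s) (lift_perm_fun s^-1).
Proof.
move=> i; rewrite {2}/lift_perm_fun; case: insubP => [a _ ai|iN].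
  by rewrite lift_perm_widen permK; apply: val_inj.
by rewrite /lift_perm_fun insubN.
Qed.

Definition permH s (x : H) : H := \sum_i xco i x *: bas (lift_perm_fun s i).

Lemma permH_linear s : linear (permH s).
Proof.
move=> a x y; rewrite /permH scaler_sumr -big_split; apply: eq_bigr => i _ /=.
by rewrite xcoP scalerDl scalerA.
Qed.

Definition permL s : {linear H -> H} := linear_pack (permH_linear s).

Lemma permH_bas s j : permH s (bas j) = bas (lift_perm_fun s j).
Proof.
rewrite /permH (bigD1 j) //= big1 ?addr0 => [|i ij]; rewrite xco_bas.
  by rewrite eqxx scale1r.
by rewrite (negbTE ij) scale0r.
Qed.

Lemma permH_bij s : bijective (permL s).
Proof.
have K t : cancel (permL t) (permL t^-1).
  apply: bas_ext => [a x y|//|j] /=; last by rewrite !permH_bas lift_permK.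
  by rewrite !permH_linear.
by exists (permL s^-1) => // x; rewrite -{1}[s]invgK; apply: K.
Qed.

Lemma permH_emb s i : permH s (emb i) = emb (s i).
Proof. by rewrite !ffunE permH_bas lift_perm_widen. Qed.

Lemma mlin_mono n J : size J = n -> @mlin H n rat^o (mono J).
Proof.
move=> Jn p t pt a x y; elim: p n J Jn pt => [|z p IHp] n [|j J] //=; try by move=> <-.
- by rewrite xcoP mulrDl /GRing.scale /= mulrA.
- case: n => [//|n] [Jn] [pt]; rewrite (IHp n J Jn pt).
  by rewrite mulrDr /GRing.scale /= mulrCA.
Qed.

Section Component.
Variable D : diagram N.
Local Notation eps := (eps rat D).
Local Notation S := (schur_module H D).
Local Notation u0 := (vg D eps).

Lemma gv_u0 : gv u0 = eps.
Proof. by rewrite vgK // epsK. Qed.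

Lemma schur_act_linear (phi : {linear H -> H}) : linear (@schur_act H N D phi).
Proof. exact: (tens_repr_act_spec (specht_repr D) (linearP phi)).1. Qed.

Lemma schur_act_tgen (phi : {linear H -> H}) h v :
  schur_act phi (tgen h v) = tgen [ffun i => phi (h i)] v :> S.
Proof. exact: (tens_repr_act_spec (specht_repr D) (linearP phi)).2. Qed.

(** The coefficient of [bas J] in the image of a tensor under the embedding
    of the Schur module in the tensor power of [H]. *)
Definition kap J : S -> rat^o := @schur_lift H N D rat^o (mono J) 1.

Lemma kap_linear J : size J = N -> linear (kap J).
Proof. by move=> JN; apply/schur_lift_linear/mlin_mono. Qed.

Lemma kap_tgen J h v : size J = N -> kap J (tgen h v) = ev (mono J : _ -> rat^o) h (gv v).
Proof. by move=> JN; rewrite /kap schur_liftE ?mul1r //; apply: mlin_mono. Qed.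

(** Embedding in the tensor power and then tensoring with u0, that is with eps, is the identity,
    because eps * v = v for every v in the right ideal. *)
Lemma kap_expand (x : S) : x = msum N (fun J => kap J x *: tword u0 (map bas J)).
Proof.
pose f (x : S) : S := msum N (fun J => kap J x *: tword u0 (map bas J)).
have lf : linear f.
  move=> a y z; rewrite /f -msumP; apply: eq_msum => J JN.
  by rewrite kap_linear // scalerDl scalerA.
apply: (@schur_ext H N D S id f) => // h v; rewrite /f.
transitivity (ev (fun w => msum N (fun J => mono J w *: tword u0 (map bas J))) h (gv v)).
  rewrite -[LHS](_ : ev (tword u0) h (gv v) = _); last by rewrite ev_tword gv_u0 eps_gv gvK.
  by apply: eq_ev => p; rewrite -msum_expand ?size_word //; apply: mlin_tword.
rewrite /ev; under eq_bigr do rewrite -msumZ.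
rewrite -(msum_sum _ (fun (p : 'S_N) J => _ *: (_ *: _))).
apply: eq_msum => J JN; rewrite kap_tgen // /ev scaler_suml; apply: eq_bigr => p _.
by rewrite scalerA.
Qed.

Lemma kap_dil J j (x : S) : size J = N ->
  kap J (schur_act (dilL j) x) = 2%:R ^+ count_mem j J * kap J x.
Proof.
move=> JN; pose c : rat := 2%:R ^+ count_mem j J.
apply: (@schur_ext H N D rat^o (kap J \o schur_act (dilL j)) (fun x => c * kap J x)).
- by move=> a y z; rewrite /comp schur_act_linear kap_linear.
- move=> a y z; rewrite kap_linear // mulrDr; congr (_ + _).
  exact: mulrCA.
move=> h v; rewrite /comp schur_act_tgen !kap_tgen // /ev mulr_sumr.
apply: eq_bigr => p _; rewrite /GRing.scale /= mulrCA; congr (_ * _).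
rewrite /c -mono_dil map_word; congr mono; apply: eq_word => i /=.
by rewrite ffunE.
Qed.

(** A word J with nonzero coefficient contains each of the first N basis indices exactly once, since
    2^r = 2 only for r = 1. Having length N, it is a rearrangement of them. *)
Lemma weight_tgen (x : S) :
  (forall j : 'I_d, (j < N)%N -> schur_act (dilL j) x = 2%:R *: x) ->
  exists v, x = tgen emb v.
Proof.
move=> xw; pose Q (x : S) := exists v, x = tgen emb v.
have Q0 : Q 0 by exists 0; rewrite (lin0 (tgen_linear emb)).
have QZ a y : Q y -> Q (a *: y).
  by move=> [v ->]; exists (a *: v); rewrite (linZ (tgen_linear emb)).
rewrite (kap_expand x) -/(Q _); apply: msum_ind => // [y z [v ->] [w ->]|J JN].
  by exists (v + w); rewrite (linD (tgen_linear emb)).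
have [->|n0] := eqVneq (kap J x) 0; first by rewrite scale0r.
apply: QZ; have cnt1 (j : 'I_d) : (j < N)%N -> count_mem j J = 1%N.
  move=> jN; have := kap_dil j x JN; rewrite xw //.
  rewrite (linZ (kap_linear JN)) /= => /(mulIf n0)/eqP.
  rewrite -[X in X == _]expr1 eq_sym => /eqP/ieexprIn; apply=> //.
pose W := [seq widen_ord Nd i | i <- enum 'I_N].
have W_uniq : uniq W.
  rewrite map_inj_uniq ?enum_uniq // => a b /(congr1 val) /= ab; exact: val_inj.
have WJ : {subset W <= J}.
  by move=> _ /mapP[i _ ->]; rewrite -has_pred1 has_count (cnt1 (widen_ord Nd i) (ltn_ord i)).
have szW : (size J <= size W)%N by rewrite size_map size_enum_ord JN.
have [_ JW] := uniq_min_size W_uniq WJ szW.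
have J_uniq := leq_size_uniq W_uniq WJ szW.
pose J' : seq 'I_N := pmap insub (map val J).
have J'E : map val J' = map val J.
  rewrite /J' (pmap_filter (insubK _)); apply/all_filterP/allP => _ /mapP[j jJ ->].
  by move: jJ; rewrite -JW => /mapP[i _ ->] /=; rewrite insubT.
have J'J : map (widen_ord Nd) J' = J.
  by apply: (inj_map val_inj); rewrite -J'E -map_comp.
have J'_uniq : uniq J' by rewrite -(map_inj_uniq val_inj) J'E map_inj_uniq //; apply: val_inj.
have J'_perm : perm_eq J' (enum 'I_N).
  apply: uniq_perm; rewrite ?enum_uniq //.
  have sub : {subset J' <= enum 'I_N} by move=> i _; rewrite mem_enum.
  have sz : (size (enum 'I_N) <= size J')%N.
    by rewrite size_enum_ord -(size_map val J') J'E size_map JN.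
  by case: (uniq_min_size J'_uniq sub sz).
exists (u0 *m specht_repr D (seqperm J')).
rewrite -tword_comp word_comp_seqperm // -[in LHS]J'J -map_comp; congr tword.
by apply: eq_map => i /=; rewrite ffunE.
Qed.

Lemma size_widen : size [seq widen_ord Nd i | i <- enum 'I_N] = N.
Proof. by rewrite size_map size_enum_ord. Qed.

Lemma kap_emb v : kap [seq widen_ord Nd i | i <- enum 'I_N] (tgen emb v)
  = gcoef (gv v) 1%g.
Proof.
rewrite (kap_tgen _ _ size_widen) /ev.
have monoE (f g : 'I_N -> 'I_d) (r : seq 'I_N) :
    mono (map f r) (map (fun i => bas (g i)) r) = \prod_(i <- r) (f i == g i)%:R.
  by elim: r => [|i r IHr] /=; rewrite ?big_nil ?big_cons ?IHr ?xco_bas.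
have E (p : 'S_N) : mono [seq widen_ord Nd i | i <- enum 'I_N] (word (emb \o p))
    = \prod_(i <- enum 'I_N) (widen_ord Nd i == widen_ord Nd (p i))%:R.
  by rewrite -monoE; congr mono; apply: eq_map => i /=; rewrite ffunE.
rewrite (bigD1 1%g) //= big1 ?addr0 => [|p p1]; rewrite /GRing.scale /= E.
  by rewrite big1 ?mulr1 // => i _; rewrite perm1 eqxx.
have [i pi] : exists i, p i != i.
  apply/existsP; apply: contra_neqT p1; rewrite negb_exists => /forallP pE.
  by apply/permP => i; rewrite perm1; apply/eqP/negbNE/pE.
rewrite (bigD1_seq i) ?mem_enum ?enum_uniq //= -val_eqE /= val_eqE eq_sym (negbTE pi).
by rewrite mul0r mulr0.
Qed.

(** A vector of weight (1,...,1,0,...,0) that plays the part of a highest weight vector: within that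
    weight space it spans the image of eps. *)
Definition hwv : S := tgen emb u0.

Lemma hwv_neq0 : hwv != 0.
Proof.
apply/eqP => /(congr1 (kap [seq widen_ord Nd i | i <- enum 'I_N])).
rewrite kap_emb gv_u0 (lin0 (kap_linear size_widen)).
by rewrite gcoefZ ysym_coef1 mulr1 => /eqP; rewrite invr_eq0 (negbTE (ykap_neq0 _ _)).
Qed.

Lemma dil_emb (j : 'I_d) (v : 'rV[rat]_(\rank (specht_module D))) : (j < N)%N ->
  schur_act (dilL j) (tgen emb v) = 2%:R *: tgen emb v.
Proof.
move=> jN; rewrite schur_act_tgen.
pose i := Ordinal jN; have ji : widen_ord Nd i = j by apply: val_inj.
have E : [ffun l => dilL j (emb l)] = set_slot emb i (2%:R *: emb i).
  apply/ffunP => l; rewrite !ffunE /= /dil xco_bas.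
  have -> : (j == widen_ord Nd l) = (l == i) by rewrite -ji -!val_eqE /= eq_sym.
  case: eqP => [->|_]; last by rewrite scale0r addr0.
  by rewrite scale1r -mulr2n scaler_nat.
have e0 : set_slot emb i (emb i) = emb.
  by apply/ffunP => l; rewrite !ffunE; case: eqP => [->|].
rewrite E; apply: etrans (linZ (tgen_slot emb i v) _ _) _; by rewrite e0.
Qed.

Lemma perm_emb s (v : 'rV[rat]_(\rank (specht_module D))) :
  schur_act (permL s) (tgen emb v) = tgen emb (v *m specht_repr D s).
Proof.
rewrite schur_act_tgen -tword_comp -tword_word; congr tword.
by apply: eq_word => i /=; rewrite ffunE -permH_emb.
Qed.

End Component.

Definition galg_act (V : lmodType rat) (act : (H -> H) -> V -> V) (a : A) (z : V) : V :=
  \sum_(s : 'S_N) gcoef a s *: act (permH s) z.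

Lemma galg_act_emb D a (v : 'rV[rat]_(\rank (specht_module D))) :
  galg_act (@schur_act H N D) a (tgen emb v) = tgen emb (vg D (gv v * a)).
Proof.
rewrite -ev_tword; apply: eq_bigr => s _; congr (_ *: _).
by rewrite tword_comp; apply: perm_emb.
Qed.

End Weights.

(** * Uniqueness of the multiplicities *)

Section Multiplicities.
Variables (k : nat) (H : vectType rat).
Local Notation N := k.+2.
Local Notation d := (\dim {:H}).
Hypothesis Nd : (N <= d)%N.
Local Notation eps := (@eps rat N).
Local Notation hwv := (hwv Nd).
Implicit Types (D : diagram N) (z : HL H).

(** The equations satisfied by the image of [hwv D] in any GL(H)-module; in a
    direct sum of Schur modules they cut out the span of the copies of [hwv D]. *)
Definition hw_like D z :=
  (forall j : 'I_d, (j < N)%N -> HL_act (dilL j) z = 2%:R *: z) /\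
  galg_act Nd (@HL_act H) (eps D) z = z.

Section OneDecomposition.
Variables (m : diagram N -> nat).
Variable f : forall D : diagram N, 'I_(m D) -> {linear schur_module H D -> HL H}.
Local Notation total s := (\sum_(D : diagram N) \sum_(i < m D) f i (s D i)).
Hypothesis f_act : forall phi : {linear H -> H}, bijective phi ->
  forall D (i : 'I_(m D)) (x : schur_module H D),
    f i (schur_act phi x) = HL_act phi (f i x).
Hypothesis f_onto : forall z, hg1 k z <->
  exists s : forall D, 'I_(m D) -> schur_module H D, z = total s.
Hypothesis f_inj : forall s : forall D, 'I_(m D) -> schur_module H D,
  total s = 0 -> forall D i, s D i = 0.

Let fam := forall D, 'I_(m D) -> schur_module H D.

Lemma total_inj (s t : fam) : total s = total t -> forall D i, s D i = t D i.
Proof.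
move=> E D i; apply/eqP; rewrite -subr_eq0; apply/eqP.
apply: (f_inj (s := fun D i => s D i - t D i)); rewrite -[RHS](subrr (total t)) -{1}E.
rewrite -sumrB; apply: eq_bigr => D' _; rewrite -sumrB; apply: eq_bigr => j _.
by rewrite linearB.
Qed.

Definition one_fam D (c : 'I_(m D) -> schur_module H D) : fam :=
  dfwith (fun D' (_ : 'I_(m D')) => 0) c.

Lemma total_one D c : total (@one_fam D c) = \sum_(i < m D) f i (c i).
Proof.
rewrite (bigD1 D) //= [X in _ + X]big1 ?addr0 => [|E ED].
  by apply: eq_bigr => i _; rewrite /one_fam dfwith_in.
by rewrite big1 // => i _; rewrite /one_fam dfwith_out ?linear0 // eq_sym.
Qed.

Lemma hwv_indep D (c : 'I_(m D) -> rat) :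
  \sum_(i < m D) c i *: f i (hwv D) = 0 -> forall i, c i = 0.
Proof.
move=> c0 i; have := f_inj (s := @one_fam D (fun i => c i *: hwv D)) _ i.
rewrite total_one /one_fam dfwith_in => E.
have {}E : c i *: hwv D = 0.
  apply: E; rewrite -[RHS]c0; apply: eq_bigr => j _; exact: linearZ.
by move/eqP: E; rewrite scaler_eq0 (negbTE (hwv_neq0 _ _)) orbF => /eqP.
Qed.

Lemma hwv_hg1 D (i : 'I_(m D)) : hg1 k (f i (hwv D)).
Proof.
apply/f_onto; exists (@one_fam D (fun j => if j == i then hwv D else 0)).
rewrite total_one (bigD1 i) //= eqxx big1 ?addr0 // => j /negbTE->.
exact: linear0.
Qed.

Lemma hwv_hw_like D (i : 'I_(m D)) : hw_like D (f i (hwv D)).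
Proof.
split=> [j jN|].
  by rewrite -f_act ?dil_emb ?linearZ //; apply: dil_bij.
transitivity (f i (galg_act Nd (@schur_act H N D) (eps D) (hwv D))).
  rewrite /galg_act linear_sum; apply: eq_bigr => s _; rewrite linearZ; congr (_ *: _).
  by rewrite (f_act (permH_bij Nd s)).
by rewrite /hwv galg_act_emb gv_u0 epsK.
Qed.

(** The weight equations put each component in the Specht module of its shape E. There right
    multiplication by eps D gives zero if E differs from D, and a multiple of eps D if E = D. *)
Lemma hw_like_span D z : hg1 k z -> hw_like D z ->
  exists b : 'I_(m D) -> rat, z = \sum_(i < m D) b i *: f i (hwv D).
Proof.
move=> /f_onto[s zE] [z_dil z_eps].
have s_emb E (j : 'I_(m E)) : exists v, s E j = tgen (emb Nd) v.
  apply: weight_tgen => a aN.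
  apply: (total_inj (s := fun E j => schur_act (dilL a) (s E j))
            (t := fun E j => 2%:R *: s E j)).
  transitivity (HL_act (dilL a) z).
    rewrite zE (lin_sum (HL_act_spec (linearP (dilL a))).1); apply: eq_bigr => E' _.
    rewrite (lin_sum (HL_act_spec (linearP (dilL a))).1); apply: eq_bigr => i _.
    by rewrite f_act //; apply: dil_bij.
  rewrite z_dil // zE scaler_sumr; apply: eq_bigr => E' _.
  rewrite scaler_sumr; apply: eq_bigr => i _.
  by rewrite linearZ.
have s_eps E (j : 'I_(m E)) : galg_act Nd (@schur_act H N E) (eps D) (s E j) = s E j.
  apply: (total_inj (s := fun E j => galg_act Nd (@schur_act H N E) (eps D) (s E j))).
  rewrite -zE -[RHS]z_eps /galg_act.
  under eq_bigr => E' _.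
    under eq_bigr => i _ do rewrite linear_sum.
    rewrite exchange_big; over.
  rewrite exchange_big; apply: eq_bigr => t _ /=.
  have lH := (HL_act_spec (linearP (permL Nd t))).1.
  rewrite zE [HL_act _ _](lin_sum lH) scaler_sumr; apply: eq_bigr => E' _.
  rewrite (lin_sum lH) scaler_sumr; apply: eq_bigr => i _.
  by rewrite linearZ /= -(f_act (permH_bij Nd t)).
have s_neq E (j : 'I_(m E)) : E != D -> s E j = 0.
  move=> ED; have [v sE] := s_emb E j; rewrite -s_eps sE galg_act_emb -eps_gv.
  by rewrite eps_ortho // vg0 (lin0 (tgen_linear _)).
have s_eq (j : 'I_(m D)) : exists b, s D j = b *: hwv D.
  have [v sE] := s_emb D j; have [b bE] := eps_corner D (gv v).
  exists b; rewrite -s_eps sE galg_act_emb -eps_gv bE.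
  rewrite /hwv -(linZ (tgen_linear _)); congr tgen.
  have e1 : eps D * (b *: eps D) = b *: eps D.
    by rewrite -[LHS](scalerAr b) epsK.
  apply: gv_inj; rewrite (vgK e1) (linZ (@gv_linear N D) b).
  by congr (_ *: _); rewrite (vgK (epsK rat D)).
have /fin_all_exists [b bE] := s_eq.
exists b; rewrite zE (bigD1 D) //= [X in _ + X]big1 ?addr0 => [|E ED].
  by apply: eq_bigr => i _; rewrite bE linearZ.
by rewrite big1 // => i _; rewrite s_neq // linear0.
Qed.

End OneDecomposition.

Lemma gl_decomposition_le (m m' : diagram N -> nat) D :
  gl_decomposition H m -> gl_decomposition H m' -> (m D <= m' D)%N.
Proof.
move=> [f [f_act f_onto f_inj]] [g [g_act g_onto g_inj]].
have /fin_all_exists [b bE] (i : 'I_(m D)) :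
    exists b : 'I_(m' D) -> rat, f D i (hwv D) = \sum_(j < m' D) b j *: g D j (hwv D).
  apply: (hw_like_span g_act g_onto g_inj); first exact: (hwv_hg1 f_onto).
  exact: (hwv_hw_like f_act).
rewrite leqNgt; apply/negP => lt.
(* With more rows than columns, the rows of B satisfy a linear relation, contradicting the
   independence of the vectors f D i (hwv D). *)
pose B : 'M[rat]_(m D, m' D) := \matrix_(i, j) b i j.
have : kermx B != 0.
  by rewrite -mxrank_eq0 mxrank_ker subn_eq0 -ltnNge (leq_ltn_trans (rank_leq_col _)).
case/rowV0Pn => c /sub_kermxP cB c0.
have /(hwv_indep f_inj) c_eq0 : \sum_(i < m D) c 0 i *: f D i (hwv D) = 0.
  under eq_bigr do rewrite bE scaler_sumr.
  rewrite exchange_big big1 // => j _ /=.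
  have := congr1 (fun M : 'rV_(m' D) => M 0 j) cB; rewrite !mxE => E.
  transitivity ((\sum_i c 0 i * B i j) *: g D j (hwv D)); last by rewrite E scale0r.
  by rewrite scaler_suml; apply: eq_bigr => i _; rewrite scalerA mxE.
by case/eqP: c0; apply/rowP => i; rewrite c_eq0 mxE.
Qed.

Lemma gl_decomposition_unique (m m' : diagram N -> nat) :
  gl_decomposition H m -> gl_decomposition H m' -> m =1 m'.
Proof.
by move=> dm dm' D; apply/eqP; rewrite eqn_leq !gl_decomposition_le.
Qed.

End Multiplicities.

Local Close Scope ring_scope.

Theorem theorem1p1 (k : nat) (k_gt0 : 0 < k)
    (k_mod4 : k %% 4 = 2 \/ k %% 4 = 3) :
  (exists m : diagram k.+2 -> nat, stable_decomposition m) /\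
  (forall m : diagram k.+2 -> nat, stable_decomposition m ->
     forall D : diagram k.+2, m D = m (conj_diagram D)).
Proof.
have [m [y [u dec]]] := idem_dec_exists (kerid_idem k).
have m_conj : forall D, m D = m (conj_diagram D).
  (* For k = 2 or 3 modulo 4, the pair (k + 1, k + 2) is (3, 0) or (0, 1) modulo 4. *)
  apply: idem_dec_conj dec _ => s; apply: kerid_odd; move: k_mod4; lia.
split=> [|m' [g0 dec'] D].
  (* The decomposition with these multiplicities holds in every dimension, so 0 serves as the stable
     bound. *)
  by exists m, 0 => g _ _ H _; apply: idem_gl_decomposition dec.
(* One space suffices: g reaches the stable range of m', and 2g is at least k + 2, as uniqueness
   requires. *)
pose g := maxn g0 k.+2; pose H : vectType rat := 'rV[rat]_(2 * g).
have dimH : \dim {:H} = 2 * g by rewrite dimvf /= /dim /= mul1n.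
have Nd : k.+2 <= \dim {:H} by rewrite dimH /g; lia.
have E : m' =1 m.
  apply: (gl_decomposition_unique Nd); last exact: idem_gl_decomposition dec.
  by apply: (dec' g) => //; rewrite /g; lia.
by rewrite !E.
Qed.
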